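(* Let $p$ be a prime, let $K/\mathbb{Q}_p$ be a quadratic extension with ring of integers $\mathcal{O}$ and uniformizer $\pi$, let $0<\varepsilon<1$ be a real number, and let $X_n\in \mathrm{H}_n(\mathcal{O})$ be an $\varepsilon$-balanced random matrix for each positive integer $n$. Let $G=\prod_{i=1}^{r}\mathcal{O}/\pi^{\lambda_i}\mathcal{O}$ for integers $\lambda_1\ge\cdots\ge\lambda_r\ge1$. (1) If $K/\mathbb{Q}_p$ is unramified, then $$\lim_{n\to\infty}\mathbb{E}(\#\mathrm{Sur}_{\mathcal{O}}(\mathrm{cok}(X_n),G))=p^{\sum_{i=1}^{r}(2i-1)\lambda_i}.$$ (2) If $K/\mathbb{Q}_p$ is ramified, then $$\lim_{n\to\infty}\mathbb{E}(\#\mathrm{Sur}_{\mathcal{O}}(\mathrm{cok}(X_n),G))=p^{\sum_{i=1}^{r}\left((i-1)\lambda_i+\left\lfloor\frac{\lambda_i}{2}\right\rfloor\right)}.$$ In both cases the error term is exponentially small in $n$: there are constants $c,K_0>0$ independent of $n$ such that the absolute value of the difference between $\mathbb{E}(\#\mathrm{Sur}_{\mathcal{O}}(\mathrm{cok}(X_n),G))$ and its limit is at most $K_0e^{-cn}$ for every $n$.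
   Context: Let $\sigma$ be the generator of $\mathrm{Gal}(K/\mathbb{Q}_p)$. $\mathrm{H}_n(\mathcal{O})$ is the set of Hermitian matrices $A\in \mathrm{M}_n(\mathcal{O})$, i.e. $A_{ij}=\sigma(A_{ji})$ for all $i,j$. For $X\in\mathrm{H}_n(\mathcal{O})$, $\mathrm{cok}(X)=\mathcal{O}^n/X\mathcal{O}^n$. $\mathrm{Sur}_{\mathcal{O}}(M,G)$ is the set of surjective $\mathcal{O}$-module homomorphisms $M\to G$. If $K/\mathbb{Q}_p$ is unramified, fix a primitive $(p^2-1)$-th root of unity $w\in K$ and take $\pi=p$; then $\mathcal{O}=\mathbb{Z}_p[w]$, and one writes $X_{ij}=Y_{ij}+wZ_{ij}$ with $Y_{ij},Z_{ij}\in\mathbb{Z}_p$. If $K/\mathbb{Q}_p$ is ramified, then $\mathcal{O}=\mathbb{Z}_p[\pi]$, and one writes $X_{ij}=Y_{ij}+\pi Z_{ij}$ with $Y_{ij},Z_{ij}\in\mathbb{Z}_p$. In both cases $Z_{ii}=0$ and $X\in \mathrm{H}_n(\mathcal{O})$ is determined by the $n^2$ elements $Y_{ij}$ ($i\le j$), $Z_{ij}$ ($i<j$). A random variable $x$ in $\mathbb{Z}_p$ is $\varepsilon$-balanced if $\mathbb{P}(x\equiv r \pmod p)\le 1-\varepsilon$ for every $r\in\mathbb{Z}/p\mathbb{Z}$. A random matrix $X$ in $\mathrm{H}_n(\mathcal{O})$ is $\varepsilon$-balanced if the $n^2$ elements $Y_{ij}$ ($i\le j$), $Z_{ij}$ ($i<j$)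 are independent and $\varepsilon$-balanced. (This notion does not depend on the choice of $w$, resp. $\pi$.) *)

(* Defs.v *)
From HB Require Import structures.
From mathcomp Require Import all_boot all_order all_algebra all_field zify.
From mathcomp Require Import all_classical all_reals all_analysis.
Set Implicit Arguments.
Unset Strict Implicit.
Unset Printing Implicit Defensive.
Import Order.TTheory GRing.Theory Num.Theory.
Import numFieldNormedType.Exports.
Local Open Scope classical_set_scope.
Local Open Scope ring_scope.

(** * Products of families of modules and of rings *)

Definition dprod (I : Type) (V : I -> Type) := forall i, V i.

HB.instance Definition _ I (V : I -> choiceType) :=
  gen_eqMixin (dprod (fun i => V i)).
HB.instance Definition _ I (V : I -> choiceType) :=
  gen_choiceMixin (dprod (fun i => V i)).

Section DprodZmodule.
Variables (I : Type) (V : I -> zmodType).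
Local Notation T := (dprod (fun i => V i)).

Definition dprod_zero : T := fun=> 0.
Definition dprod_opp (x : T) : T := fun i => - x i.
Definition dprod_add (x y : T) : T := fun i => x i + y i.

Fact dprod_addA : associative dprod_add.
Proof.
by move=> x y z; apply: functional_extensionality_dep => i; exact: addrA.
Qed.
Fact dprod_addC : commutative dprod_add.
Proof.
by move=> x y; apply: functional_extensionality_dep => i; exact: addrC.
Qed.
Fact dprod_add0 : left_id dprod_zero dprod_add.
Proof.
by move=> x; apply: functional_extensionality_dep => i; exact: add0r.
Qed.
Fact dprod_addN : left_inverse dprod_zero dprod_opp dprod_add.
Proof.
by move=> x; apply: functional_extensionality_dep => i; exact: addNr.
Qed.

HB.instance Definition _ :=
  GRing.isZmodule.Build T dprod_addA dprod_addC dprod_add0 dprod_addN.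
End DprodZmodule.

Section DprodLmodule.
Variables (R : pzRingType) (I : Type) (V : I -> lmodType R).
Local Notation T := (dprod (fun i => V i)).

Definition dprod_scale (a : R) (x : T) : T := fun i => a *: x i.

Fact dprod_scaleA a b x :
  dprod_scale a (dprod_scale b x) = dprod_scale (a * b) x.
Proof. by apply: functional_extensionality_dep => i; exact: scalerA. Qed.
Fact dprod_scale1 : left_id 1 dprod_scale.
Proof.
by move=> x; apply: functional_extensionality_dep => i; exact: scale1r.
Qed.
Fact dprod_scaleDr : right_distributive dprod_scale +%R.
Proof.
by move=> a x y; apply: functional_extensionality_dep => i; exact: scalerDr.
Qed.
Fact dprod_scaleDl x : {morph dprod_scale^~ x : a b / a + b}.
Proof.
by move=> a b; apply: functional_extensionality_dep => i; exact: scalerDl.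
Qed.

HB.instance Definition _ := GRing.Zmodule_isLmodule.Build R T
  dprod_scaleA dprod_scale1 dprod_scaleDr dprod_scaleDl.
End DprodLmodule.

Section DprodRing.
Variables (I : Type) (V : I -> comPzRingType).
Local Notation T := (dprod (fun i => V i)).

Definition dprod_one : T := fun=> 1.
Definition dprod_mul (x y : T) : T := fun i => x i * y i.

Fact dprod_mulA : associative dprod_mul.
Proof.
by move=> x y z; apply: functional_extensionality_dep => i; exact: mulrA.
Qed.
Fact dprod_mulC : commutative dprod_mul.
Proof.
by move=> x y; apply: functional_extensionality_dep => i; exact: mulrC.
Qed.
Fact dprod_mul1 : left_id dprod_one dprod_mul.
Proof.
by move=> x; apply: functional_extensionality_dep => i; exact: mul1r.
Qed.
Fact dprod_mulDl : left_distributive dprod_mul +%R.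
Proof.
by move=> x y z; apply: functional_extensionality_dep => i; exact: mulrDl.
Qed.

HB.instance Definition _ := GRing.Zmodule_isComPzRing.Build T
  dprod_mulA dprod_mulC dprod_mul1 dprod_mulDl.
End DprodRing.

(** * The ring of p-adic integers and the field of p-adic numbers *)

(* As an inverse limit. The indices are shifted because ['Z_(p ^ 0)] is not
   the zero ring: the k-th component is the residue modulo p ^ k.+1. *)
Definition residues (p : nat) := dprod (fun k : nat => 'Z_(p ^ k.+1)).

HB.instance Definition _ p := GRing.ComPzRing.on (residues p).

Fact residues_oner_neq0 p : (1 : residues p) != 0.
Proof. by apply/eqP => /(congr1 (fun x : residues p => x 0%N : nat)). Qed.

HB.instance Definition _ p :=
  GRing.PzSemiRing_isNonZero.Build (residues p) (residues_oner_neq0 p).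

Section Padic.
Variables (p : nat) (p_pr : prime p).

(* The primality proof is a parameter so that the closure instance below,
   which needs it, can be inferred. *)
Definition coherent of prime p : {pred residues p} :=
  fun x => `[< forall k : nat, (x k.+1 = x k %[mod p ^ k.+1])%N >].

Fact Zp_trunc_expn k : (Zp_trunc (p ^ k.+1)).+2 = (p ^ k.+1)%N.
Proof. by rewrite Zp_cast // -(exp1n k.+1) ltn_exp2r // prime_gt1. Qed.

Fact modn_Zp_trunc a k j : (k <= j)%N ->
  (a %% (Zp_trunc (p ^ j.+1)).+2 = a %[mod p ^ k.+1])%N.
Proof. by move=> kj; rewrite Zp_trunc_expn modn_dvdm // dvdn_exp2l. Qed.

Fact residuesD (x y : residues p) k j : (k <= j)%N ->
  ((x + y)%R j = x j + y j %[mod p ^ k.+1])%N.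
Proof. exact: modn_Zp_trunc. Qed.

Fact residuesM (x y : residues p) k j : (k <= j)%N ->
  ((x * y)%R j = x j * y j %[mod p ^ k.+1])%N.
Proof. exact: modn_Zp_trunc. Qed.

Fact coherent_subring : subring_closed (coherent p_pr).
Proof.
split.
- by apply/asboolP => k.
- move=> x y /asboolP hx /asboolP hy; apply/asboolP => k; apply/eqP.
  rewrite -(eqn_modDr (y k)); apply/eqP.
  rewrite -(residuesD _ _ (leqnn k)) subrK -hx -modnDmr -hy modnDmr.
  by rewrite -(residuesD _ _ (leqnSn k)) subrK.
- move=> x y /asboolP hx /asboolP hy; apply/asboolP => k.
  by rewrite !residuesM // -modnMm hx hy modnMm.
Qed.

HB.instance Definition _ := GRing.isSubringClosed.Build (residues p)
  (coherent p_pr) coherent_subring.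

Record padic_int :=
  PadicInt { padic_val : residues p; _ : padic_val \in coherent p_pr }.

Definition padic_residue (x : padic_int) (k : nat) : 'Z_(p ^ k.+1) :=
  padic_val x k.
Coercion padic_residue : padic_int >-> Funclass.

HB.instance Definition _ := [isSub for padic_val].
HB.instance Definition _ := [Choice of padic_int by <:].
HB.instance Definition _ := [SubChoice_isSubComNzRing of padic_int by <:].

Implicit Types x y : padic_int.

Definition padic_unit : {pred padic_int} := fun x => `[< exists y, y * x = 1 >].

Definition padic_inv x : padic_int :=
  if pselect (exists y, y * x = 1) is left h then projT1 (cid h) else x.

Fact padic_mulVx : {in padic_unit, left_inverse 1 padic_inv *%R}.
Proof.
move=> x /asboolP ux; rewrite /padic_inv; case: pselect => // h.
by case: cid.
Qed.

Fact padic_unitPl x y : y * x = 1 -> padic_unit x.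
Proof. by move=> yx; apply/asboolP; exists y. Qed.

Fact padic_invr_out : {in [predC padic_unit], padic_inv =1 id}.
Proof.
move=> x ux; rewrite /padic_inv; case: pselect => // h.
by case/negP: ux; apply/asboolP.
Qed.

HB.instance Definition _ := GRing.ComNzRing_hasMulInverse.Build padic_int
  padic_mulVx padic_unitPl padic_invr_out.

Fact padic_coherent x k j : (k <= j)%N -> (x j = x k %[mod p ^ k.+1])%N.
Proof.
move=> /subnKC <-; elim: (j - k)%N => [|n IHn]; first by rewrite addn0.
have /asboolP/(_ (k + n)%N) hx := valP x.
rewrite addnS -IHn.
have dv : (p ^ k.+1 %| p ^ (k + n).+1)%N by rewrite dvdn_exp2l // ltnS leq_addr.
by rewrite -(modn_dvdm (x (k + n).+1) dv) hx modn_dvdm.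
Qed.

Fact padic_neq0 x : x != 0 ->
  exists k, forall j, (k <= j)%N -> ~~ (p ^ k.+1 %| x j)%N.
Proof.
move=> x0; apply: contrapT => /forallNP h; case/eqP: x0.
apply/val_inj/functional_extensionality_dep => k; apply/val_inj => /=.
apply: contrapT => xk; apply: (h k) => j kj.
rewrite /dvdn (padic_coherent x kj) modn_small; first exact/eqP.
by rewrite -[ltnRHS](Zp_trunc_expn k) ltn_ord.
Qed.

Fact padic_domain : GRing.integral_domain_axiom padic_int.
Proof.
move=> x y xy; case: (eqVneq x 0) => //= x0; case: (eqVneq y 0) => //= y0.
have [i hi] := padic_neq0 x0; have [j hj] := padic_neq0 y0.
have := residuesM x y (leqnn (i + j).+1).
rewrite -[(padic_val x * padic_val y)]/(padic_val (x * y)) xy /= mod0n.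
move=> /esym/eqP; rewrite -/(dvdn _ _).
set a := nat_of_ord (x _); set b := nat_of_ord (y _) => ab.
have ha : ~~ (p ^ i.+1 %| a)%N by apply: hi; rewrite -addnS leq_addr.
have hb : ~~ (p ^ j.+1 %| b)%N by apply: hj; rewrite -addSn leq_addl.
have a0 : (0 < a)%N by case: posnP ha => // ->; rewrite dvdn0.
have b0 : (0 < b)%N by case: posnP hb => // ->; rewrite dvdn0.
move: ab ha hb; rewrite !pfactor_dvdn ?muln_gt0 ?a0 ?b0 // lognM //.
by move: (logn p a) (logn p b) => u v; lia.
Qed.

HB.instance Definition _ :=
  GRing.ComUnitRing_isIntegral.Build padic_int padic_domain.

HB.instance Definition _ := isPointed.Build padic_int 0.

Definition padic_eqmod (k : nat) x y := exists z, x - y = p%:R ^+ k * z.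

(* The open sets of the p-adic topology; [padic_borel] carries the Borel
   sigma-algebra they generate. *)
Definition padic_open : set (set padic_int) :=
  [set U | forall x, U x -> exists k, forall y, padic_eqmod k x y -> U y].

Definition padic_borel := g_sigma_algebraType padic_open.

End Padic.

Definition padic_rat (p : nat) (p_pr : prime p) := {fraction padic_int p_pr}.
HB.instance Definition _ p (p_pr : prime p) := GRing.Field.on (padic_rat p_pr).

(** * Quotient modules and cokernels *)

Section QuotientModule.
Local Open Scope quotient_scope.
Variables (R : pzRingType) (V : lmodType R) (S : submodClosed V).

(* [Quotient.quot] wants a [zmodClosed] predicate, and the library does not
   derive one from [submodClosed]. *)
Definition submod_zmod : {pred V} := fun x => x \in (S : {pred V}).

Fact submod_zmod_closed : zmod_closed submod_zmod.
Proof. exact: (GRing.submod_closedB (submodClosedP S)). Qed.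

HB.instance Definition _ :=
  GRing.isZmodClosed.Build V submod_zmod submod_zmod_closed.

Definition quotmod := Quotient.quot submod_zmod.
HB.instance Definition _ := GRing.Zmodule.on quotmod.
HB.instance Definition _ := EqQuotient.on quotmod.

Definition quotmod_scale (a : R) (x : quotmod) : quotmod :=
  \pi_quotmod (a *: repr x).

Fact quotmod_scale_pi a v :
  quotmod_scale a (\pi_quotmod v) = \pi_quotmod (a *: v).
Proof.
apply/eqP; rewrite /quotmod_scale -Quotient.idealrBE -scalerBr.
apply: (rpredZ (s := S)).
by rewrite -[_ \in _]/(_ \in submod_zmod) Quotient.idealrBE reprK.
Qed.

Fact quotmod_piD (u v : V) :
  \pi_quotmod (u + v) = \pi_quotmod u + \pi_quotmod v.
Proof. exact: (Quotient.pi_add submod_zmod u v). Qed.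

Fact quotmod_scaleA a b x :
  quotmod_scale a (quotmod_scale b x) = quotmod_scale (a * b) x.
Proof.
rewrite -[x]reprK [quotmod_scale b _]quotmod_scale_pi.
by rewrite !quotmod_scale_pi scalerA.
Qed.
Fact quotmod_scale1 : left_id 1 quotmod_scale.
Proof. by move=> x; rewrite -[x]reprK quotmod_scale_pi scale1r. Qed.
Fact quotmod_scaleDr : right_distributive quotmod_scale +%R.
Proof.
move=> a x y; rewrite -[x]reprK -[y]reprK -quotmod_piD !quotmod_scale_pi.
by rewrite scalerDr quotmod_piD.
Qed.
Fact quotmod_scaleDl x : {morph quotmod_scale^~ x : a b / a + b}.
Proof.
by move=> a b; rewrite -[x]reprK !quotmod_scale_pi scalerDl quotmod_piD.
Qed.

HB.instance Definition _ := GRing.Zmodule_isLmodule.Build R quotmod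
  quotmod_scaleA quotmod_scale1 quotmod_scaleDr quotmod_scaleDl.
End QuotientModule.

Section Cokernel.
Variable R : comNzRingType.

Definition colspan n (X : 'M[R]_n) : {pred 'cV[R]_n} :=
  fun v => `[< exists u, v = X *m u >].

Fact colspan_submod n (X : 'M[R]_n) : submod_closed (colspan X).
Proof.
split; first by apply/asboolP; exists 0; rewrite mulmx0.
move=> a u v /asboolP[u' ->] /asboolP[v' ->]; apply/asboolP.
by exists (a *: u' + v'); rewrite mulmxDr scalemxAr.
Qed.

HB.instance Definition _ n (X : 'M[R]_n) :=
  GRing.isSubmodClosed.Build R 'cV[R]_n (colspan X) (colspan_submod X).

Definition cok n (X : 'M[R]_n) : lmodType R := quotmod (colspan X).

Definition multiples (a : R) : {pred R^o} :=
  fun v => `[< exists u, v = a * u >].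

Fact multiples_submod a : submod_closed (multiples a).
Proof.
split; first by apply/asboolP; exists 0; rewrite mulr0.
move=> b u v /asboolP[u' ->] /asboolP[v' ->]; apply/asboolP.
by exists (b * u' + v'); rewrite mulrDr mulrCA.
Qed.

HB.instance Definition _ a := GRing.isSubmodClosed.Build R R^o
  (multiples a) (multiples_submod a).

Definition cyclic_mod (a : R) : lmodType R := quotmod (multiples a).

Definition prod_cyclic (a : R) (r : nat) (lam : 'I_r -> nat) : lmodType R :=
  dprod (fun i : 'I_r => cyclic_mod (a ^+ lam i)).

Definition Sur (M G : lmodType R) : set (M -> G) :=
  [set f | linear f /\ set_surj setT setT f].

End Cokernel.
Arguments Sur {R} M G _.

(** * The ring of integers of an extension of the p-adic numbers *)

Section IntegerRing.
Variables (p : nat) (p_pr : prime p) (K : fieldExtType (padic_rat p_pr)).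

Definition padic_embed : padic_int p_pr -> K :=
  in_alg K \o @FracField.tofrac (padic_int p_pr).
HB.instance Definition _ := GRing.RMorphism.on padic_embed.

Definition integral_elt : {pred K} :=
  fun x => `[< integralOver padic_embed x >].

Fact integral_elt_subring : subring_closed integral_elt.
Proof.
split.
- by apply/asboolP; exact: integral1.
- by move=> x y /asboolP hx /asboolP hy; apply/asboolP; exact: integral_sub.
- by move=> x y /asboolP hx /asboolP hy; apply/asboolP; exact: integral_mul.
Qed.

HB.instance Definition _ :=
  GRing.isSubringClosed.Build K integral_elt integral_elt_subring.

Record int_ring :=
  IntRing { int_ring_val : K; _ : int_ring_val \in integral_elt }.

HB.instance Definition _ := [isSub for int_ring_val].
HB.instance Definition _ := [Choice of int_ring by <:].
HB.instance Definition _ := [SubChoice_isSubComNzRing of int_ring by <:].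

(* The ring of integers is local, so its non-invertible elements form its
   maximal ideal. *)
Definition uniformizer (pi : int_ring) :=
  forall x : int_ring,
    (exists y, x = pi * y) <-> ~ (exists y, x * y = 1).

(* Ramification index 1: p generates the maximal ideal. *)
Definition unramified := uniformizer p%:R.

(* [sigma] generates the group of automorphisms of K over the p-adic numbers:
   algebra endomorphisms of a finite extension are automorphisms. *)
Definition generates_Gal (sigma : 'AEnd(K)) :=
  forall tau : 'AEnd(K), exists m : nat, forall x, tau x = iter m sigma x.

Definition Herm (sigma : 'AEnd(K)) (n : nat) : set 'M[int_ring]_n :=
  [set A | forall i j, int_ring_val (A i j) = sigma (int_ring_val (A j i))].

End IntegerRing.

(** * Balanced random variables and random Hermitian matrices *)

Section Balanced.
Variables (R : realType) (p : nat) (p_pr : prime p).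
Variables (d : measure_display) (T : measurableType d) (P : probability T R).
Local Notation Zp := (padic_int p_pr).

Definition independent_padic (I : finType) (x : I -> T -> Zp) :=
  forall (J : {set I}) (B : I -> set (padic_borel p_pr)),
    (forall i, measurable (B i)) ->
    P (\bigcap_(i in [set` J]) (x i @^-1` B i)) =
    (\prod_(i in J) P (x i @^-1` B i))%E.

Definition balanced (eps : R) (x : T -> Zp) :=
  forall r : nat, (P [set w | padic_eqmod 1 (x w) r%:R] <= (1 - eps)%:E)%E.

Section Hermitian.
Variable K : fieldExtType (padic_rat p_pr).
Variable n : nat.

(* The n ^ 2 elements Y_ij (i <= j) and Z_ij (i < j), indexed by all pairs:
   Z_ij sits at position (j, i). *)
Definition herm_coord (Y Z : T -> 'M[Zp]_n) (ij : 'I_n * 'I_n) (w : T) : Zp :=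
  if (ij.1 <= ij.2)%N then Y w ij.1 ij.2 else Z w ij.2 ij.1.

(* [t] is meant to be such that 1 and t form a basis of the ring of integers
   over the p-adic integers; then Y and Z exist, and are unique, for every X. *)
Definition balanced_matrix (eps : R) (t : K) (X : T -> 'M[int_ring K]_n) :=
  exists Y Z : T -> 'M[Zp]_n,
    [/\ forall w i j,
          int_ring_val (X w i j)
          = padic_embed K (Y w i j) + t * padic_embed K (Z w i j),
        forall ij,
          measurable_fun setT (herm_coord Y Z ij : T -> padic_borel p_pr),
        independent_padic (herm_coord Y Z) &
        forall ij, balanced eps (herm_coord Y Z ij)].

End Hermitian.

Definition expected_sur (S : comNzRingType) (n : nat) (X : T -> 'M[S]_n)
    (G : lmodType S) : \bar R :=
  (\int[P]_w counting (Sur (cok (X w)) G))%E.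

End Balanced.

(* Main.v *)
Require Import Defs.
From HB Require Import structures.
From mathcomp Require Import all_boot all_order all_algebra all_solvable all_field.
From mathcomp Require Import all_classical all_reals all_analysis.
From mathcomp Require Import measurable_realfun complex ring lra zify.

(* Fix N with p ^ N G = 0. A surjection from cok X onto G is a matrix F over the
   finite ring A = O / p ^ N whose columns generate a copy of G in A ^ r and which
   satisfies F X = 0. Expanding the probability of F X = 0 in additive characters
   of Z / p ^ N turns it into an average over matrices C of products of values of
   characteristic functions, one for each coordinate of X. The value is 1 where a
   certain coordinate of the Gram matrix of the columns of F and C vanishes, and is
   bounded away from 1 in absolute value elsewhere since X is balanced. The columns
   of F and C form n elements of a hyperbolic hermitian module, where orthogonal
   sets have at most |A| ^ r elements; hence the total contribution of the pairs
   (F, C) whose Gram matrix does not vanish decays geometrically. The remaining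
   pairs contribute the same for all balanced X, so that X may be replaced by a
   uniform hermitian matrix. For this one, F = kappa F' with kappa diagonal and F'
   split, and counting the hermitian X with F X = 0 reduces to counting the
   hermitian r x r matrices Y with kappa Y = 0, which yields the limit. The two
   cases differ only in the index of pi ^ l O in O = Zp + t Zp: a + b t lies in
   pi ^ l O iff p ^ al divides a and p ^ be divides b, with al = be = l if K is
   unramified, and al = ceil (l / 2), be = floor (l / 2) if t = pi is ramified. *)
Set Implicit Arguments.
Unset Strict Implicit.
Unset Printing Implicit Defensive.
Import Order.TTheory GRing.Theory Num.Theory.
Import numFieldNormedType.Exports.
Local Open Scope ring_scope.

(** * Geometric decay and the energy estimate *)

(** Fourier inversion divides by [M ^ n], where [M = |A| ^ r] is the number of values of one column
    of C, while the pairs (F, C) number [(|G| M) ^ n], so that bounding the terms one by one is far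
    too weak. What saves the argument is that [M] is also the sharp bound for orthogonal sets: a
    tuple of columns either stays close to an orthogonal set, and such tuples number about [M ^ n],
    or it has so many nonorthogonal pairs that its term is tiny. Tuples inside one orthogonal set of
    size [M] do reach the order [M ^ n]; they belong to the main term as soon as their diagonal
    forms vanish, whence the restriction to positive energy. The diagonal form is tracked apart:
    self-orthogonality only kills its multiples by 2 and by T, and neither is a unit when p = 2 is
    ramified. *)

Section GeometricDecay.
Variable R : realType.
Implicit Types f g : nat -> R.

Definition geometric_decay f := exists K rho : R,
  [/\ 0 < K, 0 < rho, rho < 1 & forall n, `|f n| <= K * rho ^+ n].

Lemma geometric_decay_le f g :
  (forall n, `|f n| <= `|g n|) -> geometric_decay g -> geometric_decay f.
Proof.
by move=> fg [K [rho [K0 r0 r1 h]]]; exists K, rho; split=> // n; apply: le_trans (h n).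
Qed.

Lemma geometric_decayD f g :
  geometric_decay f -> geometric_decay g -> geometric_decay (fun n => f n + g n).
Proof.
move=> [K [rho [K0 r0 r1 h]]] [K' [rho' [K0' r0' r1' h']]].
exists (K + K'), (Num.max rho rho'); split; rewrite ?addr_gt0 ?lt_max ?r0 ?gt_max ?r1 ?r1' //.
move=> n; apply: le_trans (ler_normD _ _) _; rewrite mulrDl.
apply: lerD; [apply: le_trans (h n) _|apply: le_trans (h' n) _].
  by rewrite ler_pM2l //; apply: lerXn2r; rewrite ?nnegrE ?le_max ?(ltW r0) ?lexx.
rewrite ler_pM2l //; apply: lerXn2r; rewrite ?nnegrE ?le_max ?(ltW r0') ?lexx ?orbT //.
Qed.

Lemma geometric_decay0 : geometric_decay (fun=> 0).
Proof.
exists 1, 2^-1; split=> [|||n]; [lra|lra|lra|].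
by rewrite normr0 mulr_ge0 // exprn_ge0 // invr_ge0.
Qed.

Lemma geometric_decay_sum (I : finType) (F : I -> nat -> R) :
  (forall i, geometric_decay (F i)) -> geometric_decay (fun n => \sum_i F i n).
Proof.
move=> h; suff: forall s : seq I, geometric_decay (fun n => \sum_(i <- s) F i n).
  exact.
elim=> [|i s IHs].
  apply: geometric_decay_le geometric_decay0 => n.
  by rewrite big_nil.
apply: geometric_decay_le (geometric_decayD (h i) IHs) => n.
by rewrite big_cons.
Qed.

(** The finitely many terms before [n0] go into the constant: its summand of index [n] alone gives
    the bound at [n < n0]. *)
Lemma geometric_decay_eventually f (n0 : nat) (rho : R) : 0 < rho -> rho < 1 ->
  (forall n, (n0 <= n)%N -> `|f n| <= rho ^+ n) -> geometric_decay f.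
Proof.
move=> r0 r1 h.
have pos i : 0 <= `|f i| / rho ^+ i by rewrite divr_ge0 // exprn_ge0 // ltW.
exists (1 + \sum_(i < n0) `|f i| / rho ^+ i), rho; split=> //.
  by rewrite ltr_wpDr // sumr_ge0.
move=> n; case: (leqP n0 n) => [le|lt].
  apply: le_trans (h n le) _; rewrite ler_peMl ?exprn_ge0 ?(ltW r0) //.
  by rewrite lerDl sumr_ge0.
rewrite -ler_pdivrMr ?exprn_gt0 //.
rewrite (bigD1 (Ordinal lt)) //= addrCA lerDl addr_ge0 ?sumr_ge0 //.
Qed.

Lemma geometric_decayZ f (a : R) : geometric_decay f ->
  geometric_decay (fun n => a * f n).
Proof.
move=> [K [rho [K0 r0 r1 h]]]; exists ((`|a| + 1) * K), rho; split=> //.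
  by rewrite mulr_gt0 // ltr_wpDl.
move=> n; rewrite normrM -mulrA; apply: ler_pM => //.
by rewrite lerDl.
Qed.

Lemma geometric_decayX (a : R) : 0 <= a -> a < 1 -> geometric_decay (fun n => a ^+ n).
Proof.
(* [a] may be 0 but the ratio has to be positive, hence the midpoint of [a] and 1. *)
move=> a0 a1; apply: (@geometric_decay_eventually _ 0 ((a + 1) / 2)); [lra|lra|].
move=> n _; rewrite ger0_norm ?exprn_ge0 //; apply: lerXn2r; rewrite ?nnegrE; lra.
Qed.

End GeometricDecay.

(** Used with [x = |W|]: a weight [expR (- (2 * |W|))] on each of at most |W| values adds up to at
    most 1/2. *)
Lemma mulr_expRN_le (R : realType) (x : R) : 0 <= x -> x * expR (- (2 * x)) <= 2^-1.
Proof.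
move=> x0; rewrite expRN ler_pdivrMr ?expR_gt0 //.
have := expR_ge1Dx (2 * x); lra.
Qed.

(** Choice of the frequency threshold, for [m = M] and [x = |W|]: values rarer than [delta * n] fill
    at most [|W| * delta * n] positions, and the last inequality lets [decay_small] pay for
    these. *)
Lemma threshold_bound (R : realType) (m x : R) : 1 <= m -> 0 <= x ->
  let d := (8 * m * (x + 1) ^+ 2)^-1 in 0 < d /\ 2 * x ^+ 2 * d <= (4 * m)^-1.
Proof.
move=> m1 x0 d; have x1 : 0 < x + 1 by lra.
have m0 : 0 < m by lra.
have d0 : 0 < d by rewrite invr_gt0 !mulr_gt0 // exprn_gt0.
split=> //; rewrite /d ler_pdivrMr ?mulr_gt0 ?exprn_gt0 //.
rewrite ler_pdivlMl ?mulr_gt0 // !expr2; nra.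
Qed.

Section Energy.
Variables (R : realType) (W : finType) (orth : rel W) (q0 : pred W).

(** For the columns of F and C this is comparable with the number of nonzero coordinates of the Gram
    matrix, see [energy_gram]. Pairs are ordered, so for a symmetric [orth] each unordered pair
    counts twice. *)
Definition energy n (u : {ffun 'I_n -> W}) : nat :=
  (\sum_i \sum_j ((i != j) && ~~ orth (u i) (u j)) + \sum_i ~~ q0 (u i))%N.

(** By distributivity the products [\prod_i g (u i)] over all tuples sum to [(\sum_w g w) ^+ n]: a
    bound by a product over positions turns a sum over tuples into a sum over W. *)
Lemma sum_ffun_prod_le n (P : pred {ffun 'I_n -> W}) (F : {ffun 'I_n -> W} -> R)
    (g : W -> R) (C : R) : (forall w, 0 <= g w) -> 0 <= C ->
  (forall u, P u -> F u <= C * \prod_i g (u i)) ->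
  \sum_(u | P u) F u <= C * (\sum_w g w) ^+ n.
Proof.
move=> g0 C0 h.
have -> : (\sum_w g w) ^+ n = \sum_(u : {ffun 'I_n -> W}) \prod_i g (u i).
  by rewrite -(bigA_distr_bigA (fun (_ : 'I_n) w => g w)) /= prodr_const card_ord.
rewrite mulr_sumr [leRHS](bigID P) /=.
apply: le_trans (ler_sum _ h) _; rewrite lerDl; apply: sumr_ge0 => u _.
by rewrite mulr_ge0 // prodr_ge0.
Qed.

Variables (M : nat) (c : R).
Hypothesis M_gt0 : (0 < M)%N.
Hypothesis c_gt0 : 0 < c.
Hypothesis orth_le : forall A : {set W},
  {in A &, forall a b, orth a b} -> (#|A| <= M)%N.
Hypothesis orth_max : forall A : {set W},
  {in A &, forall a b, orth a b} -> #|A| = M ->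
  forall w, {in A, forall a, orth w a} -> w \in A.

Let N : R := #|W|%:R.
Let M1 : 1 <= M%:R :> R. Proof. by rewrite ler1n. Qed.
Let N0 : 0 <= N. Proof. by rewrite ler0n. Qed.

Let delta : R := (8 * M%:R * (N + 1) ^+ 2)^-1.
Let delta_gt0 : 0 < delta.
Proof. by case: (threshold_bound M1 N0). Qed.

Let delta_le : 2 * N ^+ 2 * delta <= (4 * M%:R)^-1.
Proof. by case: (threshold_bound M1 N0). Qed.

Let mult n (u : {ffun 'I_n -> W}) a : nat := (\sum_i (u i == a))%N.
Let heavy n (u : {ffun 'I_n -> W}) := [set a | delta * n%:R <= (mult u a)%:R].

Let Nexp : N * expR (- (2 * N)) <= 2^-1.
Proof. exact: mulr_expRN_le. Qed.

Let cls n A (u : {ffun 'I_n -> W}) := (0 < energy u)%N && (heavy u == A).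

(** Exponential weights, the common frame of the four cases below: each case chooses weights [g n]
    on W whose product dominates the term of [u], and whose sum stays below [M] by a fixed factor,
    up to [C n]. *)
Lemma decay_of_bound A (rho : R) (n0 : nat) (C : nat -> R) (g : nat -> W -> R) :
  0 < rho -> rho < 1 ->
  (forall n, 0 <= C n) -> (forall n w, 0 <= g n w) ->
  (forall n (u : {ffun 'I_n -> W}), (n0 <= n)%N -> cls A u ->
     expR (- (c * (energy u)%:R)) <= C n * \prod_i g n (u i)) ->
  (forall n, (n0 <= n)%N -> C n * (\sum_w g n w) ^+ n <= (rho * M%:R) ^+ n) ->
  geometric_decay (fun n =>
    (\sum_(u : {ffun 'I_n -> W} | cls A u) expR (- (c * (energy u)%:R))) / M%:R ^+ n).
Proof.
move=> r0 r1 C0 g0 h hs; apply: (@geometric_decay_eventually _ _ n0 rho) => // n nn.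
rewrite ger0_norm; last first.
  by rewrite divr_ge0 ?exprn_ge0 // sumr_ge0 // => u _; exact: expR_ge0.
rewrite ler_pdivrMr ?exprn_gt0 ?ltr0n // -exprMn.
apply: le_trans (hs n nn); apply: sum_ffun_prod_le => // u; exact: h.
Qed.

(** The frequent values [a] and [b] occupy at least [(delta * n) ^ 2] pairs of positions, so the
    energy is quadratic in n. It eventually exceeds [D * n], and by the choice of [D] the factor
    [expR (- (2 * N))] per position beats the number [N ^ n] of all tuples. *)
Lemma decay_nonorth (A : {set W}) a b : a \in A -> b \in A -> ~~ orth a b ->
  geometric_decay (fun n =>
    (\sum_(u : {ffun 'I_n -> W} | cls A u) expR (- (c * (energy u)%:R))) / M%:R ^+ n).
Proof.
move=> aA bA nab; pose D := 2 * N / c.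
have D0 : 0 <= D by rewrite divr_ge0 ?mulr_ge0 // ltW.
(* The 1 added to [D] absorbs the n pairs i = j, which the energy omits but the product of
   multiplicities contains when [a = b]. *)
pose n0 := (Num.truncn ((D + 1) / delta ^+ 2)).+1.
apply: (@decay_of_bound A 2^-1 n0 (fun=> 1) (fun _ _ => expR (- (2 * N)))).
- lra.
- lra.
- by [].
- by move=> *; exact: expR_ge0.
- move=> n u nn /andP[_ /eqP hA]; rewrite mul1r prodr_const card_ord -expRM_natl.
  rewrite ler_expR mulrN lerN2.
  suff : D * n%:R <= (energy u)%:R.
    move=> /(ler_wpM2l (ltW c_gt0)); apply: le_trans.
    by rewrite [leRHS]mulrA [c * D]mulrC divfK ?gt_eqF // mulrC.
  have : (mult u a * mult u b <= energy u + n)%N.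
    rewrite /mult big_distrl /= /energy.
    apply: (@leq_trans (\sum_i \sum_(j < n) (((i != j) && ~~ orth (u i) (u j)) + (i == j)))%N).
      apply: leq_sum => i _; rewrite big_distrr /=; apply: leq_sum => j _.
      case: (u i =P a) => // ->; case: (u j =P b) => // ->; rewrite nab andbT.
      by case: eqP.
    have dg : (\sum_(i < n) \sum_(j < n) (i == j) = n)%N.
      rewrite -[RHS]card_ord -sum1_card; apply: eq_bigr => i _.
      by rewrite (bigD1 i) //= eqxx big1 // => j; rewrite eq_sym => /negPf ->.
    under eq_bigr do rewrite big_split /=.
    by rewrite big_split /= dg leq_add2r leq_addr.
  have ha : delta * n%:R <= (mult u a)%:R by move: aA; rewrite -hA inE.
  have hb : delta * n%:R <= (mult u b)%:R by move: bA; rewrite -hA inE.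
  rewrite -(ler_nat R) natrM natrD.
  have dn : 0 <= delta * n%:R by rewrite mulr_ge0 // ltW.
  have := ler_pM dn dn ha hb.
  have hn : (D + 1) <= n%:R * delta ^+ 2.
    rewrite -ler_pdivrMr ?exprn_gt0 //.
    apply: le_trans (ltW (truncnS_gt _)) _; by rewrite ler_nat.
  have n00 : 0 <= n%:R :> R by [].
  have := ler_wpM2r n00 hn.
  rewrite expr2; move: (mult u a * mult u b)%N => *; nra.
- move=> n nn; rewrite mul1r; apply: lerXn2r.
  + by rewrite nnegrE sumr_ge0 // => *; exact: expR_ge0.
  + by rewrite nnegrE mulr_ge0 ?invr_ge0.
  rewrite sumr_const -[_ *+ _]mulr_natl; apply: le_trans Nexp _.
  by rewrite ler_peMr // invr_ge0.
Qed.

Lemma sum_indicator (A : {set W}) (y : R) (g : W -> R) :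
  (forall w, w \in A -> g w <= 1) -> (forall w, w \notin A -> g w <= y) ->
  0 <= y -> \sum_w g w <= #|A|%:R + N * y.
Proof.
move=> gA gnA y0; rewrite (bigID (mem A)) /=; apply: lerD.
  apply: le_trans (ler_sum _ gA) _.
  by rewrite sumr_const.
apply: le_trans (ler_sum _ gnA) _.
rewrite sumr_const -[leLHS]mulr_natl ler_wpM2r // ler_nat.
exact: max_card.
Qed.

(** Here counting tuples is enough. At most [N * delta * n] positions carry a value outside A;
    penalising each of these by [expR (- s)] and compensating by [expR y] at every position, with
    [y = s * N * delta], gives a product that is at least 1 on all tuples considered. *)
Lemma decay_small (A : {set W}) : {in A &, forall a b, orth a b} -> (#|A| < M)%N ->
  geometric_decay (fun n =>
    (\sum_(u : {ffun 'I_n -> W} | cls A u) expR (- (c * (energy u)%:R))) / M%:R ^+ n).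
Proof.
move=> orA ltA.
pose s := 2 * N; pose y := 2 * N ^+ 2 * delta.
have y0 : 0 <= y by rewrite mulr_ge0 ?(ltW delta_gt0) // mulr_ge0 ?exprn_ge0.
pose g w := expR y * (if w \in A then 1 else expR (- s)).
have M0 : 0 < M%:R :> R by rewrite ltr0n.
have M1R : 1 <= M%:R :> R := M1.
apply: (@decay_of_bound A (1 - (4 * M%:R)^-1) 0 (fun=> 1) (fun _ w => g w)).
- rewrite subr_gt0 invf_lt1 ?mulr_gt0 //; lra.
- by rewrite gtrBl invr_gt0 mulr_gt0.
- by [].
- by move=> n w; rewrite mulr_ge0 ?expR_ge0 //; case: ifP; rewrite ?expR_ge0.
- move=> n u _ /andP[_ /eqP hA]; rewrite mul1r.
  apply: (@le_trans _ _ 1).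
    by rewrite -[leRHS]expR0 ler_expR oppr_le0 mulr_ge0 // ltW.
  have -> : \prod_i g (u i) = expR (\sum_(i < n) (y - s * (u i \notin A)%:R)).
    rewrite expR_sum; apply: eq_bigr => i _; rewrite /g expRD.
    by case: (u i \in A); rewrite /= ?mulr0 ?oppr0 ?expR0 ?mulr1.
  rewrite -[leLHS]expR0 ler_expR sumrB sumr_const card_ord -mulr_sumr subr_ge0.
  rewrite -[leRHS]mulr_natr.
  have -> : y * n%:R = s * (N * (delta * n%:R)) by rewrite /y /s; ring.
  rewrite ler_wpM2l ?mulr_ge0 //.
  rewrite -natr_sum.
  have -> : (\sum_(i < n) (u i \notin A) = \sum_(b in ~: A) mult u b)%N.
    rewrite /mult exchange_big /=; apply: eq_bigr => i _.
    case: (boolP (u i \in A)) => uA.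
      by rewrite big1 // => b; rewrite inE => bA; case: eqP bA => // <-; rewrite uA.
    rewrite (bigD1 (u i)) ?inE //= eqxx big1 // => b /andP[_].
    by rewrite eq_sym => /negPf ->.
  rewrite natr_sum.
  apply: (@le_trans _ _ (\sum_(b in ~: A) (delta * n%:R))).
    apply: ler_sum => b; rewrite inE -hA inE -ltNge; exact: ltW.
  rewrite sumr_const -[leLHS]mulr_natl ler_wpM2r ?mulr_ge0 ?(ltW delta_gt0) //.
  by rewrite ler_nat max_card.
- move=> n _; rewrite mul1r; apply: lerXn2r.
  + rewrite nnegrE; apply: sumr_ge0 => w _.
    by rewrite mulr_ge0 ?expR_ge0 //; case: ifP; rewrite ?expR_ge0.
  + rewrite nnegrE mulr_ge0 // subr_ge0 invf_le1 ?mulr_gt0 //; lra.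
  rewrite -mulr_sumr.
  have h1 : \sum_(w : W) (if w \in A then 1 else expR (- s)) <= #|A|%:R + N * expR (- s).
    apply: sum_indicator; rewrite ?expR_ge0 //.
      by move=> w ->.
    by move=> w /negPf ->.
  have h2 : #|A|%:R <= M%:R - 1 :> R by rewrite lerBrDr natr1 ler_nat.
  (* The weights sum to at most [M - 1/2]; the factor [expR y] with [y <= 1 / (4 M)] costs at most
     another 1/4, which leaves [M - 1/4]. *)
  have h3 : \sum_(w : W) (if w \in A then 1 else expR (- s)) <= M%:R - 2^-1.
    by move: Nexp h1 h2; rewrite -/s; lra.
  apply: le_trans (ler_wpM2l (expR_ge0 _) h3) _.
  have := expR_ge1Dx (- y); rewrite expRN => h4.
  have h5 : y * (4 * M%:R) <= 1 by rewrite -ler_pdivlMr ?mulr_gt0 // div1r.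
  have h6 : 1 - (4 * M%:R)^-1 = (M%:R - 4^-1) / M%:R :> R
    by rewrite [RHS]mulrBl divff ?gt_eqF // invfM.
  rewrite h6 divfK ?gt_eqF // mulrC -ler_pdivlMr ?expR_gt0 //.
  have h7 : 1 - y <= (expR y)^-1 by lra.
  have M4 : 0 <= M%:R - 4^-1 :> R by lra.
  apply: le_trans (ler_wpM2l M4 h7); nra.
Qed.

(** By maximality of A, a value outside A fails to be orthogonal to some element of A, which is
    frequent and so occupies at least [delta * n] positions. The position itself is not among them,
    its value being outside A. *)
Lemma off_energy n (A : {set W}) (u : {ffun 'I_n -> W}) :
  (forall w, {in A, forall a, orth w a} -> w \in A) -> heavy u = A ->
  (\sum_i (u i \notin A)%:R) * (delta * n%:R) + \sum_i (~~ q0 (u i))%:R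
    <= (energy u)%:R :> R.
Proof.
move=> mA hA; rewrite /energy natrD !natr_sum lerD2r mulr_suml.
apply: ler_sum => i _; case: (boolP (u i \in A)) => uA /=.
  by rewrite mul0r.
have [a aA na] : exists2 a, a \in A & ~~ orth (u i) a.
  apply/exists_inP; move: uA; apply: contraNT; rewrite negb_exists_in.
  by move=> /forall_inP h; apply: mA => a /h /negPn.
rewrite mul1r; apply: (@le_trans _ _ (mult u a)%:R).
  by move: aA; rewrite -hA inE.
rewrite ler_nat; apply: leq_sum => j _; case: (u j =P a) => // uja.
by rewrite uja na andbT; case: eqP => // ij; rewrite ij uja aA in uA.
Qed.

(** Each occurrence of [a0] costs a factor [expR (- c)] and each position outside A a factor
    exponentially small in n. So the weights sum to [M - 1 + expR (- c)] plus a vanishing term; [h]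
    is half of the gain [1 - expR (- c)], and the other half covers that term from [n0] on. *)
Lemma decay_max_bad (A : {set W}) a0 : {in A &, forall a b, orth a b} -> #|A| = M ->
  a0 \in A -> ~~ q0 a0 ->
  geometric_decay (fun n =>
    (\sum_(u : {ffun 'I_n -> W} | cls A u) expR (- (c * (energy u)%:R))) / M%:R ^+ n).
Proof.
move=> orA cA a0A qa0.
have M0 : 0 < M%:R :> R by rewrite ltr0n.
have M1R : 1 <= M%:R :> R := M1.
have ec1 : expR (- c) < 1 by rewrite -[ltRHS]expR0 ltr_expR oppr_lt0.
have ec0 : 0 < expR (- c) :> R := expR_gt0 _.
pose h := (1 - expR (- c)) / 2; have h0 : 0 < h by rewrite /h; lra.
pose g n w := if w \in A then expR (- (c * (w == a0)%:R)) else expR (- (c * (delta * n%:R))).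
pose n0 := (Num.truncn (N / h / (c * delta))).+1.
apply: (@decay_of_bound A (1 - h / M%:R) n0 (fun=> 1) g).
- rewrite subr_gt0 ltr_pdivrMr // mul1r /h; lra.
- by rewrite gtrBl divr_gt0.
- by [].
- by move=> n w; rewrite /g; case: ifP; rewrite expR_ge0.
- move=> n u _ /andP[_ /eqP hA]; rewrite mul1r.
  have -> : \prod_i g n (u i) =
     expR (\sum_(i < n) - (c * ((u i \notin A)%:R * (delta * n%:R) + (u i == a0)%:R))).
    rewrite expR_sum; apply: eq_bigr => i _; rewrite /g.
    case: (boolP (u i \in A)) => uA; rewrite /= ?mul0r ?add0r ?mul1r //.
    by case: eqP => [ua|]; rewrite ?addr0 //; rewrite ua a0A in uA.
  rewrite ler_expR sumrN -mulr_sumr lerN2 ler_pM2l //.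
  apply: le_trans (off_energy (orth_max orA cA) hA).
  rewrite big_split /= -mulr_suml lerD2l; apply: ler_sum => i _.
  by case: eqP => // ->; rewrite qa0.
- move=> n nn; rewrite mul1r; apply: lerXn2r.
  + by rewrite nnegrE; apply: sumr_ge0 => w _; rewrite /g; case: ifP; rewrite expR_ge0.
  + rewrite nnegrE mulr_ge0 // subr_ge0 ler_pdivrMr // mul1r /h; lra.
  rewrite mulrBl mul1r divfK ?gt_eqF //.
  have e1 : N * expR (- (c * (delta * n%:R))) <= h.
    have cd0 : 0 < c * delta by rewrite mulr_gt0.
    have /ltW : N / h / (c * delta) < n%:R.
      by apply: lt_le_trans (truncnS_gt _) _; rewrite ler_nat.
    rewrite ler_pdivrMr // ler_pdivrMr // => hN.
    rewrite expRN ler_pdivrMr ?expR_gt0 //.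
    apply: le_trans hN _; rewrite [leRHS]mulrC ler_wpM2r ?(ltW h0) //.
    by have := expR_ge1Dx (c * (delta * n%:R)); lra.
  rewrite (bigD1 a0) //= {1}/g a0A eqxx mulr1.
  have e2 : \sum_(w | w != a0) g n w <= M%:R - 1 + N * expR (- (c * (delta * n%:R))).
    rewrite (bigID (mem A)) /=; apply: lerD.
      apply: (@le_trans _ _ (\sum_(w in A :\ a0) 1)).
        rewrite [leRHS](eq_bigl (fun w => (w != a0) && (w \in A))); last first.
          by move=> w; rewrite !inE.
        apply: ler_sum => w /andP[/negPf wa wA].
        by rewrite /g wA wa mulr0 oppr0 expR0.
      have -> : M%:R - 1 = #|A :\ a0|%:R :> R.
        by rewrite -cA (cardsD1 a0 A) a0A natrD addrAC subrr add0r.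
      by rewrite sumr_const.
    apply: (@le_trans _ _ (\sum_(w : W | w \notin A) expR (- (c * (delta * n%:R))))).
      rewrite [leLHS](eq_bigl (fun w => w \notin A)).
        by apply: ler_sum => w /negPf wA; rewrite /g wA.
      by move=> w; case: eqP => // ->; rewrite a0A.
    rewrite sumr_const -[leLHS]mulr_natl ler_wpM2r ?expR_ge0 // ler_nat.
    exact: max_card.
  rewrite /h in e1 *; lra.
Qed.

(** Since A has no energy of its own, positive energy forces k >= 1 positions outside A, at a total
    cost of at least [k * y * n]. Half of the cost of one such position gives the global factor
    [C n]; the other halves give weights on the values outside A, which raise the sum above [M] by a
    factor of at most [expR (y / 4)]. *)
Lemma decay_max_good (A : {set W}) : {in A &, forall a b, orth a b} -> #|A| = M ->
  {in A, forall a, q0 a} ->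
  geometric_decay (fun n =>
    (\sum_(u : {ffun 'I_n -> W} | cls A u) expR (- (c * (energy u)%:R))) / M%:R ^+ n).
Proof.
move=> orA cA qA.
have M0 : 0 < M%:R :> R by rewrite ltr0n.
have M1R : 1 <= M%:R :> R := M1.
pose y := c * delta; have y0 : 0 < y by rewrite mulr_gt0.
pose C n := expR (- (y / 2 * n%:R)).
pose g n w := if w \in A then 1 else C n.
pose n0 := (Num.truncn (N / (M%:R * y / 4) / (y / 2))).+1.
apply: (@decay_of_bound A (expR (- (y / 4))) n0 C g).
- exact: expR_gt0.
- by rewrite -[ltRHS]expR0 ltr_expR oppr_lt0; lra.
- by move=> n; exact: expR_ge0.
- by move=> n w; rewrite /g; case: ifP; rewrite ?expR_ge0.
- move=> n u _ /andP[e0 /eqP hA].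
  have mA := orth_max orA cA.
  have -> : \prod_i g n (u i) = expR (\sum_(i < n) - (y / 2 * n%:R * (u i \notin A)%:R)).
    rewrite expR_sum; apply: eq_bigr => i _; rewrite /g /C.
    by case: (u i \in A); rewrite /= ?mulr0 ?oppr0 ?expR0 ?mulr1.
  rewrite -expRD ler_expR sumrN -mulr_sumr -opprD lerN2.
  have := off_energy mA hA.
  have k1 : 1 <= \sum_(i < n) (u i \notin A)%:R :> R.
    rewrite -natr_sum ler1n lt0n; apply: contraL e0; rewrite -leqNgt leqn0 sum_nat_eq0.
    move=> /forallP uA; have {}uA i : u i \in A.
      by have := uA i; case: (u i \in A).
    rewrite /energy addn_eq0 !sum_nat_eq0; apply/andP; split; apply/forallP => i /=.
      rewrite sum_nat_eq0; apply/forallP => j /=.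
      by rewrite (orA _ _ (uA i) (uA j)) andbF.
    by rewrite qA.
  have d0 : 0 <= \sum_(i < n) (~~ q0 (u i))%:R :> R by rewrite sumr_ge0.
  move: k1 d0; move: (\sum_(i < n) (u i \notin A)%:R) (\sum_(i < n) (~~ q0 (u i))%:R) => k dd.
  move=> k1 d0 h; have n00 : 0 <= y / 2 * n%:R by rewrite mulr_ge0 //; lra.
  have : c * (k * (delta * n%:R)) <= c * (energy u)%:R by rewrite ler_pM2l //; lra.
  apply: le_trans.
  have -> : c * (k * (delta * n%:R)) = k * (y / 2 * n%:R) + k * (y / 2 * n%:R).
    by rewrite -[RHS]mulr2n -mulr_natr /y; field.
  have := ler_wpM2r n00 k1; rewrite mul1r; lra.
- move=> n nn; rewrite exprMn.
  have e1 : \sum_w g n w <= M%:R * expR (y / 4).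
    apply: (@le_trans _ _ (M%:R + N * C n)).
      rewrite -cA; apply: sum_indicator; rewrite ?expR_ge0 // /g.
        by move=> w ->.
      by move=> w /negPf ->.
    have : N * C n <= M%:R * y / 4.
      have My : 0 < M%:R * y / 4 by rewrite mulr_gt0 ?mulr_gt0 // invr_gt0.
      have /ltW : N / (M%:R * y / 4) / (y / 2) < n%:R.
        by apply: lt_le_trans (truncnS_gt _) _; rewrite ler_nat.
      rewrite ler_pdivrMr; last lra.
      rewrite ler_pdivrMr // => hN.
      rewrite /C expRN ler_pdivrMr ?expR_gt0 //.
      apply: le_trans hN _; rewrite [leRHS]mulrC ler_wpM2r ?(ltW My) //.
      by have := expR_ge1Dx (y / 2 * n%:R); lra.
    have := expR_ge1Dx (y / 4) => e4.
    have := ler_wpM2l (ltW M0) e4; lra.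
  apply: (@le_trans _ _ (C n * (M%:R * expR (y / 4)) ^+ n)).
    rewrite ler_wpM2l ?expR_ge0 //; apply: lerXn2r; rewrite ?nnegrE //.
      by apply: sumr_ge0 => w _; rewrite /g; case: ifP; rewrite ?expR_ge0.
  rewrite exprMn mulrCA [leRHS]mulrC; rewrite ler_wpM2l ?exprn_ge0 //.
  rewrite /C -!expRM_natl -expRD ler_expR; lra.
Qed.

(* Tuples are sorted by the set A of their frequent values. If A is not pairwise
   orthogonal, or contains an element violating q0, then most of these tuples
   have an energy growing with n; if A is pairwise orthogonal with fewer than M
   elements, there are too few such tuples; if A has M elements, each value
   outside of A is not orthogonal to some frequent value and costs an energy
   linear in n. *)
Lemma energy_sum_decay : geometric_decay (fun n =>
  (\sum_(u : {ffun 'I_n -> W} | (0 < energy u)%N) expR (- (c * (energy u)%:R)))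
    / M%:R ^+ n).
Proof.
have decay_cls (A : {set W}) : geometric_decay (fun n =>
    (\sum_(u : {ffun 'I_n -> W} | cls A u) expR (- (c * (energy u)%:R))) / M%:R ^+ n).
  case: (boolP [forall a in A, forall b in A, orth a b]) => [orA|].
    have {}orA : {in A &, forall a b, orth a b}.
      by move=> a b aA bA; move/forall_inP: orA => /(_ a aA)/forall_inP; exact.
    have := orth_le orA; rewrite leq_eqVlt => /orP[/eqP cA|]; last exact: decay_small.
    case: (boolP [forall a in A, q0 a]) => [/forall_inP|].
      exact: decay_max_good.
    rewrite negb_forall_in => /exists_inP[a0 a0A qa]; exact: decay_max_bad cA a0A qa.
  rewrite negb_forall_in => /exists_inP[a aA]; rewrite negb_forall_in.
  by move=> /exists_inP[b bA nab]; exact: decay_nonorth aA bA nab.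
apply: geometric_decay_le (geometric_decay_sum decay_cls) => n.
rewrite -mulr_suml (partition_big (fun u => heavy u) predT) //=.
Qed.

End Energy.

(** * Quadratic rings and additive characters *)

(* The ring S[t] with t ^ 2 = T t - D: the pair (a, b) stands for a + b t. *)
Definition quad (S : comNzRingType) (T D : S) : Type := (S * S)%type.

(* Locked: unification would otherwise unfold products of matrices over [quad]
   into products of pairs, with exponential blow-up. *)
HB.lock Definition quad_mul (S : comNzRingType) (T D : S) (x y : quad T D) : quad T D :=
  (x.1 * y.1 - x.2 * y.2 * D, x.1 * y.2 + x.2 * y.1 + x.2 * y.2 * T).

Section QuadraticRing.
Variables (S : comNzRingType) (T D : S).
Local Notation Q := (quad T D).
Implicit Types x y z : Q.

HB.instance Definition _ := GRing.Zmodule.copy Q (S * S)%type.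

Definition quad_one : Q := (1, 0).

Fact quad_mulA : associative (@quad_mul S T D).
Proof. by move=> [a b] [c d] [e f]; rewrite quad_mul.unlock; congr pair => /=; ring. Qed.
Fact quad_mulC : commutative (@quad_mul S T D).
Proof. by move=> [a b] [c d]; rewrite quad_mul.unlock; congr pair => /=; ring. Qed.
Fact quad_mul1 : left_id quad_one (@quad_mul S T D).
Proof. by move=> [a b]; rewrite quad_mul.unlock; congr pair => /=; ring. Qed.
Fact quad_mulDl : left_distributive (@quad_mul S T D) +%R.
Proof. by move=> [a b] [c d] [e f]; rewrite quad_mul.unlock; congr pair => /=; ring. Qed.
Fact quad_oner_neq0 : quad_one != 0.
Proof. by apply/eqP => -[]; apply/eqP; rewrite oner_eq0. Qed.

HB.instance Definition _ := GRing.Zmodule_isComNzRing.Build Q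
  quad_mulA quad_mulC quad_mul1 quad_mulDl quad_oner_neq0.

Definition qconst (a : S) : Q := (a, 0).
Definition qgen : Q := (0, 1).
Definition qconj x : Q := (x.1 + x.2 * T, - x.2).
Definition qcoef x : S := x.2.

Lemma quad_mulE x y : x * y =
  (x.1 * y.1 - x.2 * y.2 * D, x.1 * y.2 + x.2 * y.1 + x.2 * y.2 * T) :> Q.
Proof. by rewrite -[LHS]/(quad_mul x y) quad_mul.unlock. Qed.

Lemma quad_pairE a b : qconst a + qgen * qconst b = (a, b).
Proof. by rewrite quad_mulE; congr pair => /=; ring. Qed.

Fact qconst_is_nmod : nmod_morphism qconst.
Proof. by split=> // a b; congr pair => /=; rewrite addr0. Qed.
Fact qconst_is_monoid : monoid_morphism qconst.
Proof. by split=> // a b; rewrite quad_mulE; congr pair => /=; ring. Qed.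
HB.instance Definition _ := GRing.isNmodMorphism.Build S Q qconst qconst_is_nmod.
HB.instance Definition _ := GRing.isMonoidMorphism.Build S Q qconst qconst_is_monoid.

Fact qconj_is_nmod : nmod_morphism qconj.
Proof.
split=> [|[a b] [c d]]; congr pair => /=; ring.
Qed.
Fact qconj_is_monoid : monoid_morphism qconj.
Proof.
split=> [|x y]; first by congr pair => /=; ring.
by rewrite !quad_mulE; congr pair => /=; ring.
Qed.
HB.instance Definition _ := GRing.isNmodMorphism.Build Q Q qconj qconj_is_nmod.
HB.instance Definition _ := GRing.isMonoidMorphism.Build Q Q qconj qconj_is_monoid.

Fact qcoef_is_nmod : nmod_morphism qcoef.
Proof. by []. Qed.
HB.instance Definition _ := GRing.isNmodMorphism.Build Q S qcoef qcoef_is_nmod.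

Lemma qconjK : involutive qconj.
Proof. by move=> [a b]; congr pair => /=; ring. Qed.

Lemma qconj_const a : qconj (qconst a) = qconst a.
Proof. by congr pair => /=; ring. Qed.

Lemma qcoefZ a x : qcoef (qconst a * x) = a * qcoef x.
Proof. by rewrite quad_mulE /qcoef /=; ring. Qed.

(** The coefficient of the generator replaces the trace as dualizing functional: its pairing is
    perfect for all T and D, whereas the trace pairing degenerates in the ramified case. *)
Lemma qcoef_nondegenerate x : (forall y, qcoef (y * x) = 0) -> x = 0.
Proof.
case: x => a b h; have := h 1; have := h qgen; rewrite !quad_mulE /qcoef /=.
rewrite !mul0r !mul1r add0r !addr0 => e b0; congr pair => //.
by move: e; rewrite b0 mul0r addr0.
Qed.

Lemma qcoef_trace x : qcoef (x + qconj x) = 0.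
Proof. by rewrite raddfD /= /qcoef /= subrr. Qed.

Lemma qcoef_norm x a : qcoef (x * qconst a * qconj x) = 0.
Proof. by rewrite !quad_mulE /qcoef /=; ring. Qed.

End QuadraticRing.
Arguments qcoef : simpl never.
Arguments qconj : simpl never.
Arguments qconst : simpl never.
Arguments quad : simpl never.

HB.instance Definition _ (S : finComNzRingType) (T D : S) :=
  Finite.copy (quad T D) (S * S)%type.

Lemma card_quad (S : finComNzRingType) (T D : S) : #|{: quad T D}| = (#|S| ^ 2)%N.
Proof. by rewrite [LHS](@card_prod S S) expnS expn1. Qed.

(** * Additive characters of finite rings *)

Lemma closed_prim_root_exists (C : numClosedFieldType) (n : nat) :
  (0 < n)%N -> exists z : C, n.-primitive_root z.
Proof.
move=> n_gt0; pose p : {poly C} := 'X^n - 1; have [s Dp] := closed_field_poly_normal p.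
rewrite (monicP _) ?monicXnsubC // scale1r in Dp.
have sn1 : all n.-unity_root s by apply/allP=> z; rewrite -root_prod_XsubC -Dp.
have sz_s : (n < (size s).+1)%N.
  by rewrite -(size_prod_XsubC s id) -Dp size_XnsubC.
have [|z _ z_prim] := hasP (has_prim_root n_gt0 sn1 _ sz_s); last by exists z.
by rewrite -separable_prod_XsubC -Dp separable_Xn_sub_1 // pnatr_eq0 -lt0n.
Qed.

(** The characters are faithful; such characters exist on Z / p ^ N because its additive group is
    cyclic. *)
Record additive_char (C : numClosedFieldType) (S : finComNzRingType) := AdditiveChar {
  achar :> S -> C;
  acharD : {morph achar : a b / a + b >-> a * b};
  norm_achar : forall a, `|achar a| = 1;
  achar_eq1 : forall a, achar a = 1 -> a = 0 }.

Section Characters.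
Variables (C : numClosedFieldType).

(** Orthogonality of characters: translating by [w] in H multiplies the sum by [chi w], so the sum
    vanishes as soon as some [chi w] differs from 1. *)
Lemma char_sum (V : finZmodType) (H : {set V}) (chi : V -> C) :
  {morph chi : a b / a + b >-> a * b} ->
  {in H &, forall a b, a + b \in H} -> {in H, forall a, - a \in H} ->
  \sum_(v in H) chi v = if [forall v in H, chi v == 1] then #|H|%:R else 0.
Proof.
move=> chiD HD HN; case: ifPn => [/forall_inP h|].
  rewrite -sum1_card natr_sum; apply: eq_bigr => v /h/eqP ->.
  by [].
rewrite negb_forall_in => /exists_inP[w wH w1].
have e : \sum_(v in H) chi v = chi w * \sum_(v in H) chi v.
  rewrite mulr_sumr (reindex_inj (addrI w)) /=; apply: eq_big => v; last by rewrite chiD.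
  apply/idP/idP => [h|]; last exact: HD.
  by have := HD _ _ (HN _ wH) h; rewrite addKr.
have : (1 - chi w) * (\sum_(v in H) chi v) = 0 by rewrite mulrBl mul1r -e subrr.
by move=> /eqP; rewrite mulf_eq0 subr_eq0 eq_sym (negPf w1) => /eqP.
Qed.

Variables (S : finComNzRingType) (psi : additive_char C S).

Lemma achar0 : psi 0 = 1.
Proof.
have : psi 0 != 0 by rewrite -normr_eq0 norm_achar oner_eq0.
by move=> /mulfI; apply; rewrite mulr1 -acharD addr0.
Qed.

Lemma achar_sum (I : Type) (s : seq I) (P : pred I) (F : I -> S) :
  psi (\sum_(i <- s | P i) F i) = \prod_(i <- s | P i) psi (F i).
Proof. exact: (big_morph psi (@acharD _ _ psi) achar0). Qed.

Lemma acharN a : psi (- a) = (psi a)^*.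
Proof.
have p0 : psi a != 0 by rewrite -normr_eq0 norm_achar oner_eq0.
apply: (mulfI p0); rewrite -acharD subrr achar0.
by rewrite -normCK norm_achar expr1n.
Qed.

Lemma norm_Re_achar a : `|'Re (psi a)| <= 1.
Proof.
rewrite -(expr_le1 (n := 2)) // real_normK ?Creal_Re //.
rewrite -[leRHS](expr1n _ 2) -(norm_achar psi a) normC2_Re_Im lerDl.
by rewrite -real_normK ?exprn_ge0 // Creal_Im.
Qed.

Lemma achar_gap : exists2 eta : C, 0 < eta <= 1 & forall a, a != 0 -> 'Re (psi a) <= 1 - eta.
Proof.
pose x a := (1 - 'Re (psi a)) / 2.
have rR a : 'Re (psi a) \is Num.real by exact: Creal_Re.
have nRI a : 'Re (psi a) ^+ 2 + 'Im (psi a) ^+ 2 = 1.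
  by rewrite -normC2_Re_Im norm_achar expr1n.
have Re1 := norm_Re_achar.
have x01 a : 0 <= x a <= 1.
  rewrite /x; have := Re1 a; rewrite real_ler_norml // => /andP[h1 h2].
  rewrite divr_ge0 ?subr_ge0 //= ler_pdivrMr // mul1r lerBlDr -lerBlDl.
  by apply: le_trans h1; rewrite lerBlDr; rewrite -[2]/(1 + 1) addrA addNr add0r.
have xpos a : a != 0 -> 0 < x a.
  move=> a0; rewrite lt0r (andP (x01 a)).1 andbT /x mulf_neq0 ?invr_eq0 ?pnatr_eq0 //.
  rewrite subr_eq0; apply: contraNneq a0 => e; apply/eqP; apply: (@achar_eq1 _ _ psi).
  have := nRI a; rewrite -e expr1n => /eqP; rewrite -subr_eq0 addrAC subrr add0r.
  by rewrite expf_eq0 /= => /eqP i0; rewrite [psi a]Crect -e i0 mulr0 addr0.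
(* As C is only partially ordered, the minimum of these numbers of ]0, 1] is
   replaced by their product. *)
exists (\prod_(a | a != 0) x a).
  by rewrite prodr_gt0 //= prodr_ile1 // => i _; exact: x01.
move=> a a0; rewrite (bigD1 a) //= lerBrDr -lerBrDl.
have h : \prod_(i | (i != 0) && (i != a)) x i <= 1.
  by apply: prodr_ile1 => i _; exact: x01.
apply: le_trans (ler_pM (ltW (xpos a a0)) _ (lexx _) h) _.
  by rewrite prodr_ge0 // => i _; have /andP[] := x01 i.
rewrite mulr1 /x ler_pdivrMr // ler_peMr ?ler1n //.
by rewrite subr_ge0; apply: le_trans (Re1 a); rewrite real_ler_norm.
Qed.

(** Symmetrisation: [|phi| ^ 2] is the mean of [psi ((y - z) * s)] for independent y, z of law [mu].
    Given y, the difference is regular with probability at least [eps]; then [(y - z) * s] is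
    nonzero and the real part drops by [eta]. This gives [1 - h], which is at most
    [(1 - h / 2) ^ 2]. *)
Lemma balanced_char_bound (regular : pred S) (eps : C) :
  (forall a s, regular a -> a * s = 0 -> s = 0) -> 0 < eps -> eps <= 1 ->
  exists theta : C, [/\ 0 < theta, theta < 1 & forall mu : S -> C,
    (forall y, 0 <= mu y) -> \sum_y mu y = 1 ->
    (forall y, \sum_(z | ~~ regular (y - z)) mu z <= 1 - eps) ->
    forall s, s != 0 -> `|\sum_y mu y * psi (y * s)| <= theta].
Proof.
move=> regP e0 e1; have [eta /andP[eta0 eta1] gap] := achar_gap.
pose h := eta * eps; have h0 : 0 < h by rewrite mulr_gt0.
have h1 : h <= 1 by rewrite -[leRHS]mulr1 ler_pM // ltW.
have h2 : h / 2 < 1.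
  by rewrite ltr_pdivrMr // mul1r; apply: le_lt_trans h1 _; rewrite ltr1n.
exists (1 - h / 2); split.
- by rewrite subr_gt0.
- by rewrite gtrBl divr_gt0.
move=> mu mu0 mu1 muE s s0; set phi := \sum_y _.
have th0 : 0 <= 1 - h / 2 by rewrite subr_ge0 ltW.
rewrite -(ler_pXn2r (n := 2)) // ?nnegrE //.
have muR y : (mu y)^* = mu y by apply: conj_Creal; exact: ger0_real.
have phi2 : `|phi| ^+ 2 = \sum_y \sum_z mu y * mu z * psi ((y - z) * s).
  rewrite normCK /phi rmorph_sum mulr_suml; apply: eq_bigr => y _.
  rewrite mulr_sumr; apply: eq_bigr => z _ /=.
  by rewrite rmorphM /= muR mulrBl acharD acharN mulrACA.
have bound y z : 'Re (psi ((y - z) * s)) <= 1 - eta * (regular (y - z))%:R.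
  case: (boolP (regular (y - z))) => u /=.
    rewrite mulr1; apply: gap; apply: contraNneq s0 => e.
    by apply/eqP/(regP _ _ u).
  rewrite mulr0 subr0; apply: le_trans (norm_Re_achar _).
  by apply: real_ler_norm; exact: Creal_Re.
apply: (@le_trans _ _ (1 - h)); last first.
  rewrite sqrrB expr1n mul1r -mulr_natr divfK ?pnatr_eq0 // lerDl.
  by rewrite exprn_ge0 // divr_ge0 // ltW.
have phiR : `|phi| ^+ 2 = \sum_y mu y * \sum_z mu z * 'Re (psi ((y - z) * s)).
  have : `|phi| ^+ 2 = 'Re (`|phi| ^+ 2).
    by rewrite (Creal_ReP _ _) // realX.
  move=> ->; rewrite phi2 raddf_sum; apply: eq_bigr => y _.
  rewrite raddf_sum mulr_sumr; apply: eq_bigr => z _ /=.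
  by rewrite mulrA ReMl // realM ?ger0_real.
rewrite phiR.
apply: (@le_trans _ _ (\sum_y mu y * (1 - h))); last by rewrite -mulr_suml mu1 mul1r.
apply: ler_sum => y _; apply: ler_wpM2l => //.
apply: (@le_trans _ _ (\sum_z mu z * (1 - eta * (regular (y - z))%:R))).
  by apply: ler_sum => z _; exact: ler_wpM2l.
under eq_bigr do rewrite mulrBr mulr1 mulrCA.
rewrite sumrB mu1 -mulr_sumr lerD2l lerN2 /h ler_pM2l //.
have -> : \sum_z mu z * (regular (y - z))%:R = \sum_(z | regular (y - z)) mu z.
  rewrite [RHS]big_mkcond; apply: eq_bigr => z _.
  by case: ifP; rewrite ?mulr1 ?mulr0.
have := muE y; rewrite lerBrDr -lerBrDl -{1}mu1.
by rewrite (bigID (fun z => regular (y - z))) /= addrK.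
Qed.

End Characters.

Lemma Zp_char (C : numClosedFieldType) (q : nat) : inhabited (additive_char C 'Z_q).
Proof.
have [w prim_w] := closed_prim_root_exists C (isT : (0 < (Zp_trunc q).+2)%N).
split; exists (fun a : 'Z_q => w ^+ a).
- by move=> a b /=; rewrite (prim_expr_mod prim_w) exprD.
- move=> a; apply/eqP; rewrite -(pexpr_eq1 (n := (Zp_trunc q).+2)) //.
  by rewrite -normrX -exprM mulnC exprM (prim_expr_order prim_w) expr1n normr1.
- move=> a wa; apply/val_inj => /=.
  have : w ^+ a == w ^+ 0 by rewrite wa expr0.
  by rewrite (eq_prim_root_expr prim_w) mod0n modn_small ?ltn_ord // => /eqP.
Qed.

(** * Fourier inversion on hermitian matrices *)

Section HermitianPairing.
Variables (S : finComNzRingType) (T D : S).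
Local Notation A := (quad T D).

(* The coordinates at (i, j) and (j, i), where i < j, are those of the entry (i, j)
   with respect to 1 and the generator of the quadratic ring. *)
Definition herm_mx n (x : {ffun 'I_n * 'I_n -> S}) : 'M[A]_n :=
  \matrix_(i, j)
    if (i < j)%N then qconst T D (x (i, j)) + qgen T D * qconst T D (x (j, i))
    else if (j < i)%N then qconst T D (x (j, i)) + qconj (qgen T D) * qconst T D (x (i, j))
    else qconst T D (x (i, i)).

(** The coefficient of the coordinate [x ij] in the linear form of [gram_pairing]. Below the
    diagonal this coordinate multiplies the generator in the entry (j, i) and its conjugate in the
    entry (i, j). *)
Definition gram_coef n (G : 'M[A]_n) (ij : 'I_n * 'I_n) : S :=
  let: (i, j) := ij in
  qcoef (if (i < j)%N then G i j + G j i
         else if (j < i)%N then G j i * qgen T D + G i j * qconj (qgen T D)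
         else G i i).

Lemma gram_pairing n (G : 'M[A]_n) (x : {ffun 'I_n * 'I_n -> S}) :
  qcoef (\sum_i \sum_j G i j * herm_mx x i j) = \sum_p x p * gram_coef G p.
Proof.
(* The entry (i, j) involves the coordinates of x at (i, j) and at (j, i); [a] and [b] are their
   respective coefficients. *)
pose a (i j : 'I_n) := if (i < j)%N then G i j
  else if (j < i)%N then G i j * qconj (qgen T D) else G i i.
pose b (i j : 'I_n) := if (i < j)%N then G i j * qgen T D
  else if (j < i)%N then G i j else 0.
have e i j : G i j * herm_mx x i j =
    qconst T D (x (i, j)) * a i j + qconst T D (x (j, i)) * b i j.
  rewrite mxE /a /b; case: ltngtP => [_|_|/val_inj ->]; ring.
transitivity (qcoef (\sum_i \sum_j qconst T D (x (i, j)) * (a i j + b j i))).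
  congr qcoef.
  transitivity (\sum_i \sum_j qconst T D (x (i, j)) * a i j +
                \sum_j \sum_i qconst T D (x (j, i)) * b i j).
    rewrite [X in _ + X]exchange_big -big_split /=; apply: eq_bigr => i _.
    by rewrite -big_split /=; apply: eq_bigr => j _; exact: e.
  rewrite -big_split /=; apply: eq_bigr => i _; rewrite -big_split /=.
  by apply: eq_bigr => j _; rewrite mulrDr.
rewrite raddf_sum /=.
under eq_bigr do rewrite raddf_sum.
rewrite pair_bigA /=; apply: eq_bigr => -[i j] _ /=.
rewrite qcoefZ /a /b; congr (_ * qcoef _).
by case: ltngtP => _ //; rewrite ?addr0 // addrC.
Qed.

End HermitianPairing.

Section Fourier.
Variables (C : numClosedFieldType) (S : finComNzRingType) (psi : additive_char C S).
Variables (T D : S).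
Local Notation A := (quad T D).

Lemma mxdot_qcoef_eq0 m n (M : 'M[A]_(m, n)) :
  (forall N : 'M[A]_(m, n), qcoef (\sum_k \sum_j N k j * M k j) = 0) -> M = 0.
Proof.
move=> h; apply/matrixP => k j; rewrite mxE; apply: qcoef_nondegenerate => y.
rewrite -(h (y *: delta_mx k j)); congr qcoef.
rewrite (bigD1 k) //= (bigD1 j) //= !mxE !eqxx mulr1 big1 ?addr0; last first.
  by move=> l /negPf lj; rewrite !mxE lj andbF mulr0 mul0r.
rewrite big1 ?addr0 // => l /negPf lk; rewrite big1 // => i _.
by rewrite !mxE lk mulr0 mul0r.
Qed.

Lemma mx_char_sum m n (M : 'M[A]_(m, n)) :
  \sum_(N : 'M[A]_(m, n)) psi (qcoef (\sum_k \sum_j N k j * M k j)) =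
  if M == 0 then (#|{: A}| ^ (m * n))%:R else 0.
Proof.
pose f (N : 'M[A]_(m, n)) := \sum_k \sum_j N k j * M k j.
have fD N N' : f (N + N') = f N + f N'.
  rewrite /f -big_split /=; apply: eq_bigr => k _; rewrite -big_split /=.
  by apply: eq_bigr => j _; rewrite mxE mulrDl.
have -> : \sum_N psi (qcoef (f N)) = \sum_(N in [set: 'M[A]_(m, n)]) psi (qcoef (f N)).
  by apply: eq_bigl => N; rewrite inE.
rewrite (@char_sum C 'M[A]_(m, n) finset.setT (fun N => psi (qcoef (f N)))); first last.
- by move=> *; rewrite inE.
- by move=> *; rewrite inE.
- by move=> N N'; rewrite fD raddfD acharD.
rewrite cardsT card_mx.
suff -> : [forall v in [set: 'M[A]_(m, n)], psi (qcoef (f v)) == 1] = (M == 0) by [].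
apply/forall_inP/eqP => [h|M0 N _].
  apply: mxdot_qcoef_eq0 => N; apply: (@achar_eq1 _ _ psi); apply/eqP/h.
  by rewrite inE.
rewrite /f M0 big1 ?raddf0 ?achar0 // => k _; rewrite big1 // => j _.
by rewrite mxE mulr0.
Qed.

(** The indicator of [F X = 0] is expanded by [mx_char_sum]; after exchanging the sums, the
    independence of the coordinates makes the sum over x a product of characteristic functions. *)
Lemma fourier_herm r n (F : 'M[A]_(r, n)) (mu : 'I_n * 'I_n -> S -> C) :
  (#|{: A}| ^ (r * n))%:R *
    \sum_(x : {ffun 'I_n * 'I_n -> S} | F *m herm_mx T D x == 0) \prod_p mu p (x p) =
  \sum_(N : 'M[A]_(r, n))
    \prod_p \sum_y mu p y * psi (y * gram_coef (F^T *m N) p).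
Proof.
transitivity (\sum_(x : {ffun 'I_n * 'I_n -> S}) \sum_(N : 'M[A]_(r, n))
    (\prod_p mu p (x p)) * psi (\sum_p x p * gram_coef (F^T *m N) p)).
  rewrite mulr_sumr big_mkcond; apply: eq_bigr => x _.
  rewrite -mulr_sumr.
  have -> : \sum_(N : 'M[A]_(r, n)) psi (\sum_p x p * gram_coef (F^T *m N) p) =
     \sum_(N : 'M[A]_(r, n)) psi (qcoef (\sum_k \sum_j N k j * (F *m herm_mx T D x) k j)).
    apply: eq_bigr => N _; rewrite -gram_pairing; congr (psi (qcoef _)).
    under [RHS]eq_bigr => k _.
      under eq_bigr => j _ do rewrite mxE mulr_sumr.
      rewrite exchange_big /=; over.
    rewrite [RHS]exchange_big /=; apply: eq_bigr => i _.
    rewrite [RHS]exchange_big /=; apply: eq_bigr => j _.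
    rewrite mxE mulr_suml; apply: eq_bigr => k _; rewrite mxE; ring.
  rewrite mx_char_sum; case: eqP => _; last by rewrite mulr0.
  by rewrite mulrC.
rewrite exchange_big /=; apply: eq_bigr => N _.
rewrite bigA_distr_bigA /=; apply: eq_bigr => x _.
by rewrite achar_sum -big_split.
Qed.

End Fourier.

(** * The hyperbolic hermitian form and the Fourier bound *)

Section HyperbolicForm.
Variables (C : numClosedFieldType) (S : finComNzRingType) (psi : additive_char C S).
Variables (T D : S) (r : nat).
Local Notation A := (quad T D).
Implicit Types f c : 'cV[A]_r.

Definition cdot f c : A := \sum_k f k 0 * c k 0.

Lemma cdotDl f f' c : cdot (f + f') c = cdot f c + cdot f' c.
Proof. by rewrite /cdot -big_split; apply: eq_bigr => k _; rewrite mxE mulrDl. Qed.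
Lemma cdotC f c : cdot f c = cdot c f.
Proof. by apply: eq_bigr => k _; rewrite mulrC. Qed.
Lemma cdotBr f c c' : cdot f (c - c') = cdot f c - cdot f c'.
Proof. by rewrite /cdot -sumrB; apply: eq_bigr => k _; rewrite !mxE mulrBr. Qed.

Lemma cdot_char_sum c :
  \sum_f psi (qcoef (cdot f c)) = if c == 0 then (#|{: A}| ^ r)%:R else 0.
Proof.
have := mx_char_sum psi c; rewrite muln1 => <-; apply: eq_bigr => f _.
by congr (psi (qcoef _)); apply: eq_bigr => k _; rewrite big_ord1.
Qed.

Variable G : {set 'cV[A]_r}.
Hypotheses (G0 : 0 \in G) (GD : {in G &, forall a b, a + b \in G})
  (GN : {in G, forall a, - a \in G}).

Let P := [set c | [forall f in G, psi (qcoef (cdot f c)) == 1]].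

Lemma annihilator_char_sum c :
  \sum_(f in G) psi (qcoef (cdot f c)) = if c \in P then #|G|%:R else 0.
Proof.
rewrite (@char_sum _ _ G (fun f => psi (qcoef (cdot f c)))) ?inE //.
by move=> f f'; rewrite cdotDl raddfD acharD.
Qed.

(** Both orders of summation of one double character sum: summing over f in G first detects the
    annihilator [P], summing over c first leaves only f = 0. *)
Lemma card_annihilator : (#|G| * #|P| = #|{: A}| ^ r)%N.
Proof.
apply/eqP; rewrite -(eqr_nat C); apply/eqP.
transitivity (\sum_c \sum_(f in G) psi (qcoef (cdot f c))).
  under eq_bigr do rewrite annihilator_char_sum.
  by rewrite -big_mkcond sumr_const natrM mulr_natr.
rewrite exchange_big /= (bigD1 0) //=.
have e f : \sum_c psi (qcoef (cdot f c)) = if f == 0 then (#|{: A}| ^ r)%:R else 0.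
  by rewrite -cdot_char_sum; apply: eq_bigr => c _; rewrite cdotC.
rewrite e eqxx big1 ?addr0 // => f /andP[_ /negPf f0].
by rewrite e f0.
Qed.

(* The columns of F paired with those of the Fourier variable dual to F X = 0. *)
Definition hyp_vec := {w : 'cV[A]_r * 'cV[A]_r | w.1 \in G}.
HB.instance Definition _ := SubType.on hyp_vec.
HB.instance Definition _ := Finite.on hyp_vec.
Implicit Types w : hyp_vec.

Definition hyp_re w w' : S :=
  qcoef (cdot (val w).1 (val w').2 + cdot (val w').1 (val w).2).
Definition hyp_im w w' : S :=
  qcoef (cdot (val w).1 (val w').2 * qgen T D
         + cdot (val w').1 (val w).2 * qconj (qgen T D)).
Definition hyp_diag w : S := qcoef (cdot (val w).1 (val w).2).
(** The two [hyp_im] conditions make the relation symmetric; by [hyp_imC] either of them follows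
    from the other together with [hyp_re], because the conjugate of the generator is T minus the
    generator. *)
Definition hyp_orth w w' :=
  [&& hyp_re w w' == 0, hyp_im w w' == 0 & hyp_im w' w == 0].

Lemma hyp_imC w w' : hyp_re w w' = 0 -> hyp_im w w' = 0 -> hyp_im w' w = 0.
Proof.
rewrite /hyp_re /hyp_im.
move: (cdot (val w).1 (val w').2) (cdot (val w').1 (val w).2) => x y.
have -> : y * qgen T D + x * qconj (qgen T D) =
   qconst T D T * (x + y) - (x * qgen T D + y * qconj (qgen T D)).
  have -> : qconj (qgen T D) = qconst T D T - qgen T D.
    by congr pair => /=; ring.
  by ring.
by rewrite raddfB /= qcoefZ => -> ->; rewrite mulr0 subr0.
Qed.

Lemma sum_hyp_vec (h : 'cV[A]_r -> 'cV[A]_r -> C) :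
  \sum_(w : hyp_vec) h (val w).1 (val w).2 = \sum_(f in G) \sum_c h f c.
Proof.
rewrite pair_big_dep /=.
rewrite [RHS](reindex_omap (fun w : hyp_vec => val w)
  (fun v => @insub _ (fun v => v.1 \in G) hyp_vec v)) /=.
  by apply: eq_bigl => w; rewrite (valP w) valK eqxx.
by move=> v /andP[vG _]; rewrite insubT.
Qed.

(** The radical of [hyp_re] is {0} x P, so duality predicts the bound [|W| |P| = |A| ^ r |G| |P| =
    (|A| ^ r) ^ 2]. As X is an arbitrary set and not a subgroup, the bound is obtained from a second
    moment. *)
Lemma card_hyp_orth (X : {set hyp_vec}) :
  (#|[set w | [forall a in X, hyp_orth w a]]| * #|X| <= (#|{: A}| ^ r) ^ 2)%N.
Proof.
set Y := [set w | _]; case: (posnP #|X|) => [->|X0]; first by rewrite muln0.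
rewrite -(leq_pmul2r X0) -mulnA -(ler_nat C).
(* On the left, the second moment of g is at least its part over Y, where g = #|X|. *)
pose g w := \sum_(a in X) psi (hyp_re w a).
apply: (@le_trans _ _ (\sum_w `|g w| ^+ 2)).
  rewrite (bigID (mem Y)) /=; apply: ler_wpDr.
    by apply: sumr_ge0 => w _; rewrite exprn_ge0.
  rewrite (eq_bigr (fun=> (#|X| * #|X|)%:R)).
    by rewrite sumr_const -mulrnA mulnC.
  move=> w; rewrite inE => /forall_inP orw.
  suff -> : g w = #|X|%:R by rewrite normr_nat expr2 natrM.
  rewrite /g (eq_bigr (fun=> 1)) ?sumr_const // => a /orw/andP[/eqP -> _].
  exact: achar0.
(* Over w = (f, c) the character of a difference splits into a sum over f in G, detecting [P], and a
   sum over c, detecting equality of first components. Hence each a admits at most |P| elements a'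
   with a nonzero term. *)
pose K (a a' : hyp_vec) := (if (val a).2 - (val a').2 \in P then #|G|%:R else 0) *
  (if (val a).1 - (val a').1 == 0 then (#|{: A}| ^ r)%:R else 0 : C).
have -> : \sum_w `|g w| ^+ 2 = \sum_(a in X) \sum_(a' in X) K a a'.
  transitivity (\sum_w \sum_(a in X) \sum_(a' in X) psi (hyp_re w a - hyp_re w a')).
    apply: eq_bigr => w _; rewrite normCK /g rmorph_sum mulr_suml.
    apply: eq_bigr => a _; rewrite mulr_sumr; apply: eq_bigr => a' _.
    by rewrite acharD acharN.
  rewrite exchange_big /=; apply: eq_bigr => a _.
  rewrite exchange_big /=; apply: eq_bigr => a' _.
  rewrite /K -annihilator_char_sum -cdot_char_sum mulr_suml.
  under [RHS]eq_bigr do rewrite mulr_sumr.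
  rewrite -(sum_hyp_vec (fun f c => psi (qcoef (cdot f ((val a).2 - (val a').2))) *
     psi (qcoef (cdot c ((val a).1 - (val a').1))))) /=.
  apply: eq_bigr => w _; rewrite -acharD -!raddfD -raddfB; congr (psi (qcoef _)).
  by rewrite !cdotBr !(cdotC (val w).2) opprD addrACA.
have e a : a \in X -> \sum_(a' in X) K a a' <= (#|{: A}| ^ r * (#|G| * #|P|))%:R.
  move=> aX; pose Xa := [set a' in X | ((val a).2 - (val a').2 \in P)
                                    && ((val a).1 - (val a').1 == 0)].
  have cXa : (#|Xa| <= #|P|)%N.
    have injc : {in Xa &, injective (fun a' : hyp_vec => (val a).2 - (val a').2)}.
      move=> b b'; rewrite !inE => /and3P[_ _ /eqP b1] /and3P[_ _ /eqP b1'].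
      move=> /addrI/oppr_inj e2; apply/val_inj.
      have e1 : (val b).1 = (val b').1.
        by apply: oppr_inj; apply: (addrI (val a).1); rewrite b1 b1'.
      by move: e1 e2; case: (val b) (val b') => ? ? [? ?] /= -> ->.
    rewrite -(card_in_imset injc); apply: subset_leq_card.
    by apply/fintype.subsetP => _ /imsetP[a' + ->]; rewrite inE => /and3P[].
  apply: (@le_trans _ _ (\sum_(a' in Xa) (#|{: A}| ^ r * #|G|)%:R)).
    rewrite big_mkcond [leRHS]big_mkcond; apply: ler_sum => a' _.
    rewrite /K !inE; case: ifP => // _ /=; case: ifP => //= _; last by rewrite mul0r.
    by case: ifP => _; rewrite ?mulr0 // -natrM mulnC.
  by rewrite sumr_const -[leLHS]mulrnA ler_nat mulnA leq_mul2l cXa orbT.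
apply: le_trans (ler_sum _ e) _.
by rewrite sumr_const -mulrnA card_annihilator ler_nat expnS expn1.
Qed.

Lemma hyp_orth_le (X : {set hyp_vec}) :
  {in X &, forall a b, hyp_orth a b} -> (#|X| <= #|{: A}| ^ r)%N.
Proof.
move=> orX; rewrite -(@leq_exp2r _ _ 2) //; apply: leq_trans (card_hyp_orth X).
rewrite expnS expn1 leq_mul2r; apply/orP; right; apply: subset_leq_card.
by apply/fintype.subsetP => a aX; rewrite inE; apply/forall_inP => b; exact: orX.
Qed.

(** An orthogonal X lies in its orthogonal set, and for |X| = |A| ^ r the bound on the latter leaves
    room for equality only. *)
Lemma hyp_orth_max (X : {set hyp_vec}) :
  {in X &, forall a b, hyp_orth a b} -> #|X| = (#|{: A}| ^ r)%N ->
  forall w, {in X, forall a, hyp_orth w a} -> w \in X.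
Proof.
move=> orX cX w orw; have := card_hyp_orth X; set Y := [set w | _].
have X0 : (0 < #|X|)%N by rewrite cX expn_gt0; apply/orP; left; apply/card_gt0P; exists 0.
rewrite -cX expnS expn1 leq_pmul2r // => YX.
have XY : X \subset Y.
  by apply/fintype.subsetP => a aX; rewrite inE; apply/forall_inP => b; exact: orX.
have /eqP -> : X == Y by rewrite eqEcard XY.
by rewrite inE; apply/forall_inP.
Qed.

End HyperbolicForm.

(** * Comparison of a balanced law with the uniform law *)

Section FourierError.
Variables (C : numClosedFieldType) (S : finComNzRingType) (psi : additive_char C S).
Variables (T D : S) (r : nat).
Local Notation A := (quad T D).
Variable G : {set 'cV[A]_r}.
Hypothesis G0 : 0 \in G.
Local Notation W := (hyp_vec G).

Lemma mulr_sum_char (s : S) : s != 0 -> \sum_y psi (y * s) = 0.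
Proof.
move=> s0; have := @char_sum C S finset.setT (fun y => psi (y * s)).
rewrite (eq_bigl predT) => [->|y]; last by rewrite inE.
- case: ifP => // /forall_inP /(_ 1 (finset.in_setT _)); rewrite mul1r => /eqP /achar_eq1 s00.
  by rewrite s00 eqxx in s0.
- by move=> a b; rewrite mulrDl acharD.
- by move=> *; rewrite inE.
- by move=> *; rewrite inE.
Qed.

Definition hyp_energy n (u : {ffun 'I_n -> W}) : nat :=
  energy (@hyp_orth S T D r G) (fun w => hyp_diag w == 0) u.

(** A nonorthogonal pair adds 2 to the energy but may come from a single nonzero coordinate, hence
    the factor 2. The bound [theta ^+ 2] required of each characteristic function below matches
    it. *)
Lemma energy_gram n (F N : 'M[A]_(r, n)) (u : {ffun 'I_n -> W}) :
  (forall j, val (u j) = (col j F, col j N)) ->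
  (hyp_energy u <= (\sum_p (gram_coef (F^T *m N) p != 0%R)) * 2)%N /\
  ((0 < \sum_p (gram_coef (F^T *m N) p != 0%R)) -> 0 < hyp_energy u)%N.
Proof.
move=> hu; pose K i j := gram_coef (F^T *m N) (i, j).
have gE i j : (F^T *m N) i j = cdot (val (u i)).1 (val (u j)).2.
  by rewrite !hu mxE; apply: eq_bigr => k _; rewrite !mxE.
have Klt (i j : 'I_n) : (i < j)%N -> K i j = hyp_re (u i) (u j).
  by move=> ij; rewrite /K /= ij !gE.
have Kgt (i j : 'I_n) : (j < i)%N -> K i j = hyp_im (u j) (u i).
  by move=> ij; rewrite /K /= ltnNge (ltnW ij) ij !gE.
have Keq i : K i i = hyp_diag (u i) by rewrite /K /= ltnn gE.
have reC (w w' : W) : hyp_re w w' = hyp_re w' w by rewrite /hyp_re addrC.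
have orC (w w' : W) : hyp_orth w w' = hyp_orth w' w.
  by rewrite /hyp_orth reC [X in _ && X]andbC.
have orE (i j : 'I_n) : (i < j)%N -> hyp_orth (u i) (u j) = (K i j == 0) && (K j i == 0).
  move=> ij; rewrite Klt // Kgt // /hyp_orth.
  case: eqP => //= re0; case: eqP => //= im0.
  by rewrite (hyp_imC re0 im0) eqxx.
have -> : (\sum_p (gram_coef (F^T *m N) p != 0%R) = \sum_i \sum_j (K i j != 0%R))%N.
  by rewrite pair_bigA; apply: eq_bigr => -[i j] _.
split.
- rewrite muln2 -addnn {2}exchange_big /= -big_split /= /hyp_energy /energy -big_split /=.
  apply: leq_sum => i _; rewrite -big_split /=.
  rewrite (bigD1 i) //= eqxx add0n [leqRHS](bigD1 i) //= Keq addnC.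
  apply: leq_add; first exact: leq_addr.
  apply: leq_sum => j ji; rewrite eq_sym ji /=.
  case: (ltngtP i j) => [ij|ij|/val_inj ij].
  + by rewrite orE //; case: (K i j == 0); case: (K j i == 0).
  + by rewrite orC orE //; case: (K i j == 0); case: (K j i == 0).
  + by rewrite ij eqxx in ji.
- rewrite !lt0n; apply: contra; rewrite /hyp_energy /energy addn_eq0.
  rewrite !sum_nat_eq0 => /andP[/forallP e1 /forallP e2].
  apply/forallP => i /=; rewrite sum_nat_eq0; apply/forallP => j /=.
  have or i' j' : i' != j' -> hyp_orth (u i') (u j').
    move=> ij; have := e1 i'; rewrite /= sum_nat_eq0 => /forallP/(_ j') /=.
    by rewrite ij /=; case: hyp_orth.
  case: (ltngtP i j) => [ij|ij|/val_inj ->].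
  + have := or i j; rewrite orE // neq_ltn ij => /(_ isT)/andP[/eqP -> _].
    by rewrite eqxx.
  + have := or j i; rewrite orE // neq_ltn ij => /(_ isT)/andP[_ /eqP ->].
    by rewrite eqxx.
  + by have := e2 j; rewrite /= Keq; case: eqP.
Qed.

Variables (n : nat) (adm : pred 'M[A]_(r, n)) (mu : 'I_n * 'I_n -> S -> C) (theta : C).
Hypothesis admG : forall F, adm F -> forall j, col j F \in G.
Hypotheses (theta_ge0 : 0 <= theta) (theta_le1 : theta <= 1).
Hypothesis mu1 : forall p, \sum_y mu p y = 1.
Hypothesis mu_char : forall p s, s != 0 ->
  `|\sum_y mu p y * psi (y * s)| <= theta ^+ 2.

(** In the difference of the two Fourier expansions, the terms with vanishing Gram coordinates are 1
    for both laws and cancel. In the others the uniform law contributes 0, having one vanishing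
    factor, and [mu] contributes at most [theta ^+ 2] per nonzero coordinate. *)
Lemma fourier_error :
  `|\sum_(F | adm F)
      (\sum_(x | F *m herm_mx T D x == 0) \prod_p mu p (x p)
       - #|[set x | F *m herm_mx T D x == 0]|%:R / (#|S| ^ (n * n))%:R)|
  <= ((#|{: A}| ^ r) ^ n)%:R^-1 *
     \sum_(u : {ffun 'I_n -> W} | (0 < hyp_energy u)%N) theta ^+ hyp_energy u.
Proof.
set cA := ((#|{: A}| ^ r) ^ n)%:R.
have cS0 : (#|S|%:R : C) != 0.
  by rewrite pnatr_eq0 -lt0n; apply/card_gt0P; exists 0.
have cA0 : 0 < cA.
  by rewrite ltr0n !expn_gt0; apply/orP; left; apply/orP; left; apply/card_gt0P; exists 0.
pose nz (F N : 'M[A]_(r, n)) := (\sum_p (gram_coef (F^T *m N) p != 0%R))%N.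
pose g (F N : 'M[A]_(r, n)) : C := if nz F N == 0%N then 0 else theta ^+ (nz F N * 2).
have g0 F N : 0 <= g F N by rewrite /g; case: ifP => // _; rewrite exprn_ge0.
have diff F : `|\sum_(x | F *m herm_mx T D x == 0) \prod_p mu p (x p)
       - #|[set x | F *m herm_mx T D x == 0]|%:R / (#|S| ^ (n * n))%:R|
     <= cA^-1 * \sum_N g F N.
  have e1 := fourier_herm psi F mu.
  have e2 := fourier_herm psi F (fun _ _ => #|S|%:R^-1).
  rewrite expnM -/cA in e1; rewrite expnM -/cA in e2.
  have -> : #|[set x | F *m herm_mx T D x == 0]|%:R / (#|S| ^ (n * n))%:R =
     \sum_(x : {ffun 'I_n * 'I_n -> S} | F *m herm_mx T D x == 0)
        \prod_(p : 'I_n * 'I_n) #|S|%:R^-1 :> C.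
    rewrite sumr_const prodr_const card_prod card_ord natrX -exprVn.
    by rewrite mulr_natl cardsE.
  rewrite ler_pdivlMl // -[X in X * `|_|](ger0_norm (ltW cA0)) -normrM mulrBr e1 e2 -sumrB.
  apply: le_trans (ler_norm_sum _ _ _) _; apply: ler_sum => N _.
  rewrite /g; case: eqP => [nz0|/eqP nz0].
    have k0 p : gram_coef (F^T *m N) p = 0.
      apply/eqP; move/eqP: nz0; rewrite sum_nat_eq0 => /forallP/(_ p) /=.
      by case: (gram_coef (F^T *m N) p == 0).
    rewrite !big1 ?subrr ?normr0 // => p _; rewrite k0;
      under eq_bigr do rewrite mulr0 achar0 mulr1.
      by rewrite sumr_const -[LHS]mulr_natl divff.
    exact: mu1.
  have [p0 p0nz] : exists p0, gram_coef (F^T *m N) p0 != 0.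
    apply/existsP; apply: contraNT nz0; rewrite negb_exists => /forallP h.
    by rewrite sum_nat_eq0; apply/forallP => p /=; have := h p; rewrite negbK => ->.
  rewrite [X in _ - X](bigD1 p0) //= -mulr_sumr mulr_sum_char // mulr0 mul0r subr0.
  rewrite normr_prod mulnC exprM -prodrXr.
  apply: ler_prod => p _; rewrite normr_ge0 /=.
  case: (eqVneq (gram_coef (F^T *m N) p) 0) => [->|knz] /=; last exact: mu_char.
  under eq_bigr do rewrite mulr0 achar0 mulr1.
  by rewrite mu1 normr1.
apply: le_trans (ler_norm_sum _ _ _) _.
apply: le_trans (ler_sum _ (fun F _ => diff F)) _.
rewrite -mulr_sumr ler_pM2l ?invr_gt0 //.
rewrite pair_big /=.
(* Default for columns outside G; it is never taken, since [adm] puts the columns of F in G. *)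
pose u0 : W := Sub (0, 0) G0.
pose h (u : {ffun 'I_n -> W}) : 'M[A]_(r, n) * 'M[A]_(r, n) :=
  (\matrix_(k, j) (val (u j)).1 k 0, \matrix_(k, j) (val (u j)).2 k 0).
pose h' (v : 'M[A]_(r, n) * 'M[A]_(r, n)) : {ffun 'I_n -> W} :=
  [ffun j => insubd u0 (col j v.1, col j v.2)].
rewrite (reindex_onto h h') /=; last first.
  move=> [F N] /=; rewrite andbT => SF; congr pair; apply/matrixP => k j;
  by rewrite mxE ffunE val_insubd /= admG //= mxE.
rewrite big_mkcond [leRHS]big_mkcond; apply: ler_sum => u _.
have vu j : val (u j) = (col j (h u).1, col j (h u).2).
  rewrite [LHS]surjective_pairing; congr pair; apply/matrixP => k l;
  by rewrite !mxE ord1.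
have [le1 lt1] := energy_gram vu.
have t0 : 0 <= (if (0 < hyp_energy u)%N then theta ^+ hyp_energy u else 0).
  by case: ifP => // _; rewrite exprn_ge0.
case: ifP => // _; rewrite /g; case: eqP => // /eqP nz0.
rewrite lt1 ?lt0n //; exact: ler_wiXn2l.
Qed.

End FourierError.

Section Universality.
Variables (R : realType) (S : finComNzRingType) (psi : additive_char R[i] S).
Variables (T D : S) (r : nat).
Local Notation A := (quad T D).
Variable G : {set 'cV[A]_r}.
Hypotheses (G0 : 0 \in G) (GD : {in G &, forall a b, a + b \in G})
  (GN : {in G, forall a, - a \in G}).
Variables (regular : pred S) (eps : R).
Hypothesis regularP : forall a s, regular a -> a * s = 0 -> s = 0.
Hypotheses (eps_gt0 : 0 < eps) (eps_le1 : eps <= 1).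

Lemma universality : exists K rho : R, [/\ 0 < K, 0 < rho, rho < 1 &
  forall n (adm : pred 'M[A]_(r, n)) (mu : 'I_n * 'I_n -> S -> R),
    (forall F, adm F -> forall j, col j F \in G) ->
    (forall p y, 0 <= mu p y) -> (forall p, \sum_y mu p y = 1) ->
    (forall p y, \sum_(z | ~~ regular (y - z)) mu p z <= 1 - eps) ->
    `|\sum_(F | adm F)
      (\sum_(x | F *m herm_mx T D x == 0) \prod_p mu p (x p)
       - #|[set x | F *m herm_mx T D x == 0]|%:R / (#|S| ^ (n * n))%:R)|
    <= K * rho ^+ n].
Proof.
have [||theta [th0 th1 bal]] := @balanced_char_bound _ _ psi regular eps%:C%C regularP.
- by rewrite ltcR.
- by rewrite lecR.
have [t et] : exists t : R, theta = t%:C%C.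
  by apply/complex_realP; rewrite ger0_real // ltW.
rewrite {theta}et ltcR in th0 th1 bal *; rewrite ltcR in th1.
(* The half makes [expR (- c)] the square root of the bound [t] on the characteristic functions, as
   [fourier_error] asks for. *)
pose c := - ln t / 2; pose M := (#|{: A}| ^ r)%N.
have c0 : 0 < c by rewrite divr_gt0 // oppr_gt0 ln_lt0 // th0.
have M0 : (0 < M)%N.
  by rewrite expn_gt0; apply/orP; left; apply/card_gt0P; exists 0.
have [K [rho [K0 r0 r1 bound]]] := @energy_sum_decay R (hyp_vec G)
  (@hyp_orth S T D r G) (fun w => hyp_diag w == 0) M c M0 c0
  (@hyp_orth_le _ _ psi _ _ _ _ G0 GD GN) (@hyp_orth_max _ _ psi _ _ _ _ G0 GD GN).
exists K, rho; split=> // n adm mu admG mu0 mu1 muE.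
apply: le_trans (bound n); pose th : R := expR (- c).
have th_ge0 : (0 : R[i]) <= th%:C%C by rewrite lecR expR_ge0.
have th_le1 : th%:C%C <= 1 :> R[i].
  by rewrite lecR /th -[leRHS]expR0 ler_expR oppr_le0 ltW.
have th2 : th ^+ 2 = t.
  rewrite /th -expRM_natl mulrN /c mulrCA mulfV ?pnatr_eq0 // mulr1 opprK lnK //.
have muC1 p : \sum_y (mu p y)%:C%C = 1 :> R[i] by rewrite -rmorph_sum mu1.
have muCchar p s : s != 0 -> `|\sum_y (mu p y)%:C%C * psi (y * s)| <= th%:C%C ^+ 2.
  move=> s0; rewrite -rmorphXn th2; apply: bal => //.
  - by move=> y; rewrite lecR.
  - by move=> y; rewrite -rmorph_sum -(rmorph1 (real_complex R)) -rmorphB lecR; exact: muE.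
have := @fourier_error _ _ psi _ _ _ _ G0 n adm (fun p y => (mu p y)%:C%C) th%:C%C
  admG th_ge0 th_le1 muC1 muCchar.
set E := \sum_(F | adm F) _; set e := \sum_(F | adm F) _.
have -> : E = e%:C%C.
  rewrite /e rmorph_sum; apply: eq_bigr => F _.
  rewrite rmorphB rmorph_sum rmorphM fmorphV !rmorph_nat; congr (_ - _).
  by apply: eq_bigr => x _; rewrite rmorph_prod.
have -> : ((#|{: A}| ^ r) ^ n)%:R^-1 *
     \sum_(u : {ffun 'I_n -> hyp_vec G} | (0 < hyp_energy u)%N) th%:C%C ^+ hyp_energy u =
   (((#|{: A}| ^ r) ^ n)%:R^-1 *
     \sum_(u : {ffun 'I_n -> hyp_vec G} | (0 < hyp_energy u)%N) th ^+ hyp_energy u)%:C%C.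
  rewrite rmorphM fmorphV rmorph_nat rmorph_sum; congr (_ * _).
  by apply: eq_bigr => u _; rewrite rmorphXn.
have -> : `|e%:C%C| = `|e|%:C%C :> R[i].
  by rewrite normc_def /= expr0n addr0 sqrtr_sqr.
rewrite lecR => /le_trans; apply; apply: le_trans (ler_norm _).
rewrite mulrC natrX -/M; apply: ler_wpM2r; first by rewrite invr_ge0 exprn_ge0.
apply: ler_sum => u _; rewrite /th -expRM_natl mulrN mulrC.
exact: lexx.
Qed.

End Universality.

(** * Counting hermitian matrices with F X = 0 *)

(** [x |-> (f x, x - s (f x))] is a bijection onto the product of E and the kernel. The section is a
    mere map of sets, so it may be obtained by choice. *)
Lemma card_section (U V : finZmodType) (D : {set U}) (E : {set V})
    (f : {additive U -> V}) (s : V -> U) :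
  {in D &, forall x y, x - y \in D} -> {in D, forall x, f x \in E} ->
  {in E, forall y, s y \in D} -> {in E, forall y, f (s y) = y} ->
  #|D| = (#|E| * #|[set x in D | f x == 0%R]|)%N.
Proof.
move=> DB fE sD fK; rewrite -cardsX.
have D0 x : x \in D -> 0 \in D by move=> xD; rewrite -(subrr x) DB.
have DN x : x \in D -> - x \in D by move=> xD; rewrite -(sub0r x) DB ?(D0 x).
pose g x := (f x, x - s (f x)).
have injg : {in D &, injective g}.
  by move=> x y _ _ [fxy]; rewrite fxy => /addIr.
rewrite -(card_in_imset injg); congr #|pred_of_set _|; apply/setP => -[y k].
rewrite !inE /=; apply/imsetP/andP => [[x xD [-> ->]]|[yE /andP[kD /eqP fk]]].
  by rewrite fE // DB ?sD ?fE //= raddfB /= fK ?fE // subrr.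
exists (s y + k); first by rewrite -[k]opprK DB ?sD ?DN.
by rewrite /g raddfD /= fK // fk addr0 addrAC subrr add0r.
Qed.

Section HermitianCount.
Variables (S : finComNzRingType) (T D : S).
Local Notation A := (quad T D).

Definition adjmx m n (M : 'M[A]_(m, n)) : 'M[A]_(n, m) := map_mx (@qconj S T D) M^T.
Local Notation "M ^H" := (adjmx M) (at level 8, format "M ^H").

Lemma adjmxK m n : cancel (@adjmx m n) (@adjmx n m).
Proof. by move=> M; apply/matrixP => i j; rewrite !mxE qconjK. Qed.
Lemma adjmxD m n (M N : 'M[A]_(m, n)) : (M + N)^H = M^H + N^H.
Proof. by apply/matrixP => i j; rewrite !mxE rmorphD. Qed.
Lemma adjmxB m n (M N : 'M[A]_(m, n)) : (M - N)^H = M^H - N^H.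
Proof. by apply/matrixP => i j; rewrite !mxE rmorphB. Qed.
Lemma adjmxM m n k (M : 'M[A]_(m, n)) (N : 'M[A]_(n, k)) :
  (M *m N)^H = N^H *m M^H.
Proof. by rewrite /adjmx trmx_mul map_mxM. Qed.
Lemma adjmx1 n : (1%:M : 'M[A]_n)^H = 1%:M.
Proof. by rewrite /adjmx trmx1 map_mx1. Qed.

(* The diagonal condition does not follow from X = X^H when 2 is a zero
   divisor in S. *)
Definition hermitian n (X : 'M[A]_n) := (X == X^H) && [forall i, qcoef (X i i) == 0].

Lemma hermitianP n (X : 'M[A]_n) :
  reflect (X = X^H /\ forall i, qcoef (X i i) = 0) (hermitian X).
Proof.
apply: (iffP andP) => [[/eqP h /forallP h']|[h h']]; split=> //.
- by move=> i; apply/eqP.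
- exact/eqP.
- by apply/forallP => i; apply/eqP.
Qed.

Lemma hermitianB n (X Y : 'M[A]_n) : hermitian X -> hermitian Y -> hermitian (X - Y).
Proof.
move=> /hermitianP[hX dX] /hermitianP[hY dY]; apply/hermitianP; split.
  by rewrite adjmxB -hX -hY.
by move=> i; rewrite !mxE raddfB /= dX dY subrr.
Qed.

Lemma hermitian0 n : hermitian (0 : 'M[A]_n).
Proof.
apply/hermitianP; split; first by apply/matrixP => i j; rewrite !mxE raddf0.
by move=> i; rewrite mxE raddf0.
Qed.

Lemma hermitianD n (X Y : 'M[A]_n) : hermitian X -> hermitian Y -> hermitian (X + Y).
Proof.
move=> hX hY; rewrite -[Y]opprK; apply: hermitianB => //; rewrite -sub0r.
by apply: hermitianB => //; exact: hermitian0.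
Qed.

Lemma hermitian_trace n (M : 'M[A]_n) : hermitian (M + M^H).
Proof.
apply/hermitianP; split; first by rewrite adjmxD adjmxK addrC.
by move=> i; rewrite !mxE qcoef_trace.
Qed.

Lemma herm_mx_hermitian n (x : {ffun 'I_n * 'I_n -> S}) : hermitian (herm_mx T D x).
Proof.
apply/hermitianP; split; last by move=> i; rewrite mxE ltnn.
apply/matrixP => i j; rewrite !mxE.
case: ltngtP => [_|_|/val_inj ->].
- by rewrite rmorphD rmorphM /= !qconj_const qconjK.
- by rewrite rmorphD rmorphM /= !qconj_const.
- by rewrite qconj_const.
Qed.

Definition herm_coords n (X : 'M[A]_n) : {ffun 'I_n * 'I_n -> S} :=
  [ffun p : 'I_n * 'I_n => if (p.1 <= p.2)%N then (X p.1 p.2).1 else (X p.2 p.1).2].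

Lemma herm_mxK n : cancel (@herm_mx S T D n) (@herm_coords n).
Proof.
move=> x; apply/ffunP => -[i j]; rewrite ffunE /= !mxE.
by case: (ltngtP i j) => [ij|ij|/val_inj ->]; rewrite ?ltnn ?quad_pairE.
Qed.

Lemma herm_coordsK n (X : 'M[A]_n) : hermitian X -> herm_mx T D (herm_coords X) = X.
Proof.
move=> /hermitianP[hX dX]; apply/matrixP => i j; rewrite mxE !ffunE /=.
have quadE (a : A) : a = qconst T D a.1 + qgen T D * qconst T D a.2.
  by rewrite quad_pairE; case: a.
case: (ltngtP i j) => [ij|ij|/val_inj ->].
- by rewrite -quadE.
- by rewrite [in RHS]hX !mxE [in RHS](quadE (X j i)) rmorphD rmorphM /= !qconj_const.
- by rewrite leqnn; have := dX j; case: (X j j) => a b; rewrite /qcoef /= => ->.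
Qed.

Lemma card_herm_mx n (P : pred 'M[A]_n) :
  #|[set x | P (herm_mx T D x)]| = #|[set X | hermitian X & P X]|.
Proof.
rewrite -(card_imset _ (can_inj (@herm_mxK n))); congr #|pred_of_set _|; apply/setP => X.
rewrite inE; apply/imsetP/andP => [[x + ->]|[hX PX]].
  by rewrite inE herm_mx_hermitian.
by exists (herm_coords X); rewrite ?inE ?herm_coordsK.
Qed.

Lemma card_hermitian n : #|[set X : 'M[A]_n | hermitian X]| = (#|S| ^ (n * n))%N.
Proof.
have := card_herm_mx (fun _ : 'M[A]_n => true).
have -> : [set X : 'M[A]_n | hermitian X & true] = [set X | hermitian X].
  by apply/setP => X; rewrite !inE andbT.
by move=> <-; rewrite cardsE card_ffun card_prod card_ord.
Qed.

(** Only the diagonal condition is delicate. Writing X as [U + U^H] plus a diagonal with entries in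
    S reduces it to traces and norms, on which [qcoef] vanishes. *)
Lemma hermitian_congr m n (V : 'M[A]_(m, n)) (X : 'M[A]_n) :
  hermitian X -> hermitian (V *m X *m V^H).
Proof.
move=> /hermitianP[eX dX].
pose U : 'M[A]_n := \matrix_(i, j) if (i < j)%N then X i j else 0.
pose d : 'rV[A]_n := \row_i X i i.
have -> : X = U + U^H + diag_mx d.
  apply/matrixP => i j; rewrite !mxE.
  case: (ltngtP i j) => [ij|ij|/val_inj ->].
  - by rewrite -val_eqE /= ltn_eqF // raddf0 !addr0.
  - by rewrite -val_eqE /= gtn_eqF // add0r addr0 [in LHS]eX !mxE.
  - by rewrite eqxx raddf0 !add0r.
have dH : (diag_mx d)^H = diag_mx d.
  apply/matrixP => i j; rewrite !mxE eq_sym; case: eqP => [->|_]; last by rewrite raddf0.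
  by rewrite /= mulr1n [in RHS]eX !mxE.
rewrite !(mulmxDr, mulmxDl); apply: hermitianD.
  rewrite -[V *m U^H *m V^H](_ : (V *m U *m V^H)^H = _) ?hermitian_trace //.
  by rewrite !adjmxM adjmxK mulmxA.
apply/hermitianP; split; first by rewrite !adjmxM adjmxK dH mulmxA.
move=> i; rewrite mul_mx_diag mxE raddf_sum big1 // => j _.
rewrite !mxE; have -> : X j j = qconst T D (X j j).1.
  by have := dX j; case: (X j j) => a b; rewrite /qcoef /= => ->.
exact: qcoef_norm.
Qed.

(** If [F V = 1], this matrix X solves [F X = Q], see [section_hermitian]: the subtracted term
    removes the part common to [V Q] and its adjoint. *)
Lemma hermitian_sandwich m n (V : 'M[A]_(m, n)) (Q : 'M[A]_(n, m)) (F : 'M[A]_(n, m)) :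
  hermitian (Q *m F^H) ->
  hermitian (V *m Q + (V *m Q)^H - V *m (Q *m F^H) *m V^H).
Proof.
by move=> h; apply: hermitianB; [exact: hermitian_trace|exact: hermitian_congr].
Qed.

End HermitianCount.

Section SplitCount.
Variables (S : finComNzRingType) (T D : S).
Local Notation A := (quad T D).
Local Notation "M ^H" := (adjmx M) (at level 8, format "M ^H").
Variables (r n : nat) (F : 'M[A]_(r, n)) (V : 'M[A]_(n, r)).
Hypothesis FV : F *m V = 1%:M.

Let ker_row m (K : 'M[A]_r) := [set Q : 'M[A]_(r, m) | K *m Q == 0].
Let herm_ker (K : 'M[A]_r) := [set Y : 'M[A]_r | hermitian Y & K *m Y == 0].

Let Q0 (K : 'M[A]_r) := [set Q : 'M[A]_(r, n) | (K *m Q == 0) && (Q *m F^H == 0)].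
Let Q1 (K : 'M[A]_r) := [set Q : 'M[A]_(r, n) | (K *m Q == 0) && hermitian (Q *m F^H)].

Let Z0 := [set X : 'M[A]_n | hermitian X & F *m X == 0].
Let H (K : 'M[A]_r) := [set X : 'M[A]_n | hermitian X & K *m F *m X == 0].

Let VF : V^H *m F^H = 1%:M.
Proof. by rewrite -adjmxM FV adjmx1. Qed.

Let card_ker_row (K : 'M[A]_r) : #|ker_row n K| = (#|ker_row r K| * #|Q0 K|)%N.
Proof.
have -> : Q0 K = [set Q in ker_row n K | Q *m F^H == 0] by apply/setP => Q; rewrite !inE.
apply: (@card_section _ _ (ker_row n K) (ker_row r K) (mulmxr F^H) (fun Y => Y *m V^H)) => /=.
- by move=> P Q; rewrite !inE mulmxBr => /eqP -> /eqP ->; rewrite subrr.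
- by move=> Q; rewrite !inE mulmxA => /eqP ->; rewrite mul0mx.
- by move=> Q; rewrite !inE mulmxA => /eqP ->; rewrite mul0mx.
- by move=> Q _ /=; rewrite -mulmxA VF mulmx1.
Qed.

Let card_Q1 (K : 'M[A]_r) : #|Q1 K| = (#|herm_ker K| * #|Q0 K|)%N.
Proof.
have -> : Q0 K = [set Q in Q1 K | Q *m F^H == 0].
  apply/setP => Q; rewrite !inE; case: (K *m Q == 0) => //=.
  by case: eqP => [->|_]; rewrite ?andbF // hermitian0.
apply: (@card_section _ _ (Q1 K) (herm_ker K) (mulmxr F^H) (fun Y => Y *m V^H)) => /=.
- move=> P Q; rewrite !inE => /andP[/eqP KP hP] /andP[/eqP KQ hQ].
  apply/andP; split; first by rewrite mulmxBr KP KQ subrr.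
  by rewrite mulmxBl; exact: hermitianB hP hQ.
- move=> Q; rewrite !inE => /andP[/eqP KQ hQ].
  by apply/andP; split; [exact: hQ | rewrite mulmxA KQ mul0mx].
- move=> Y; rewrite !inE => /andP[hY /eqP KY].
  apply/andP; split; first by rewrite mulmxA KY mul0mx.
  by rewrite -mulmxA VF mulmx1.
- by move=> Q _ /=; rewrite -mulmxA VF mulmx1.
Qed.

Let section_hermitian (Q : 'M[A]_(r, n)) : hermitian (Q *m F^H) ->
  F *m (V *m Q + (V *m Q)^H - V *m (Q *m F^H) *m V^H) = Q.
Proof.
move=> /hermitianP[hQ _]; rewrite mulmxBr mulmxDr (adjmxM V Q).
have FQ : F *m Q^H = Q *m F^H by rewrite [RHS]hQ adjmxM adjmxK.
have -> : F *m (V *m Q) = Q by rewrite mulmxA FV mul1mx.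
have -> : F *m (Q^H *m V^H) = Q *m F^H *m V^H by rewrite mulmxA FQ.
have -> : F *m (V *m (Q *m F^H) *m V^H) = Q *m F^H *m V^H.
  by rewrite mulmxA (mulmxA F V) FV mul1mx.
by rewrite addrK.
Qed.

Let card_herm_split (K : 'M[A]_r) : #|H K| = (#|Q1 K| * #|Z0|)%N.
Proof.
have -> : Z0 = [set X in H K | F *m X == 0].
  have HE X : (X \in H K) = hermitian X && (K *m F *m X == 0) by exact: finset.in_set.
  have ZE X : (X \in Z0) = hermitian X && (F *m X == 0) by exact: finset.in_set.
  apply/setP => X; rewrite [LHS]ZE [RHS]finset.in_set /= [X \in H K]HE.
  apply/andP/andP => [[hX /eqP FX]|[/andP[hX _] FX]].
    rewrite hX FX; split; last exact: eqxx.
    by rewrite -(mulmxA K F X) FX mulmx0; exact: eqxx.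
  by split; [exact: hX|exact: FX].
apply: (@card_section _ _ (H K) (Q1 K) (mulmx F)
  (fun Q => V *m Q + (V *m Q)^H - V *m (Q *m F^H) *m V^H)) => /=.
- move=> X Y; rewrite !inE => /andP[hX /eqP KX] /andP[hY /eqP KY].
  apply/andP; split; first exact: hermitianB hX hY.
  by rewrite mulmxBr KX KY subrr.
- move=> X; rewrite !inE => /andP[hX KX]; apply/andP; split; first by rewrite mulmxA.
  exact: hermitian_congr.
- move=> Q; rewrite !inE => /andP[/eqP KQ hQ]; apply/andP; split.
    exact: hermitian_sandwich.
  by rewrite -mulmxA section_hermitian // KQ.
- by move=> Q; rewrite inE => /andP[_ hQ] /=; exact: section_hermitian.
Qed.

(** [X |-> F X] maps the matrices counted onto the Q with [K Q = 0] and [Q F^H] hermitian, and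
    [Q |-> Q F^H] reduces these to size r. The fibres [Z0] and [Q0] have unknown sizes; they are
    eliminated by comparison with K = 0, where everything else is known. *)
Lemma card_split_hermitian (K : 'M[A]_r) :
  (#|[set X : 'M[A]_n | hermitian X & K *m F *m X == 0%R]| * #|S| ^ (r * r)
   * #|{: A}| ^ (r * n) * #|[set Q : 'M[A]_r | K *m Q == 0%R]| =
   #|S| ^ (n * n) * #|[set Y : 'M[A]_r | hermitian Y & K *m Y == 0%R]|
   * #|[set Q : 'M[A]_(r, n) | K *m Q == 0%R]| * #|{: A}| ^ (r * r))%N.
Proof.
have k0 m : ker_row m 0 = finset.setT.
  by apply/setP => Q; rewrite !inE mul0mx eqxx.
have h0 m (M : 'M[A]_(r, m)) : [set X : 'M[A]_m | hermitian X & 0 *m M *m X == 0] =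
   [set X | hermitian X].
  by apply/setP => X; rewrite !inE !mul0mx eqxx andbT.
have hk0 : herm_ker 0 = [set Y | hermitian Y].
  by apply/setP => X; rewrite !inE !mul0mx eqxx andbT.
have e1 := card_herm_split K; have e2 := card_herm_split 0.
have e3 := card_Q1 K; have e4 := card_Q1 0.
have e5 := card_ker_row K; have e6 := card_ker_row 0.
rewrite /H h0 card_hermitian in e2; rewrite hk0 card_hermitian in e4.
rewrite !k0 !cardsT !card_mx in e6.
have arith (a b c d e f g h k l m o x : nat) : (a = b * c -> d = f * c -> b = g * h ->
    f = k * l -> m = o * h -> e = x * l -> a * k * e * o = d * g * m * x)%N.
  by move=> -> -> -> -> -> ->; ring.
exact: arith e1 e2 e3 e4 e5 e6.
Qed.

End SplitCount.

Lemma card_ord_geq (r m : nat) : #|[pred j : 'I_r | (m <= j)%N]| = (r - m)%N.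
Proof.
rewrite -sum1_card -(big_mkord (fun j => m <= j)%N (fun=> 1%N)).
by rewrite -(big_nat_widenl _ _ _ predT) // sum_nat_const_nat muln1.
Qed.

(** * Matrices annihilated by a diagonal matrix *)

Section KernelCount.
Variables (S : finComNzRingType) (T D : S) (r : nat).
Local Notation A := (quad T D).
Variables (kappa : 'I_r -> A) (I J : 'I_r -> {set S}).
Hypothesis kerP : forall i a, kappa i * a = 0 <-> (a.1 \in I i) && (a.2 \in J i).
Hypothesis J0 : forall i, 0 \in J i.
Hypothesis ker_conj : forall (i j : 'I_r) a, (i <= j)%N -> kappa i * a = 0 -> kappa j * qconj a = 0.

Let K : 'M[A]_r := diag_mx (\row_i kappa i).

Lemma mul_diag_row_eq0 m (Q : 'M[A]_(r, m)) :
  reflect (forall i j, kappa i * Q i j = 0) (K *m Q == 0).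
Proof.
apply: (iffP eqP) => [h i j|h].
  by have := congr1 (fun M : 'M[A]_(r, m) => M i j) h; rewrite mul_diag_mx !mxE.
by apply/matrixP => i j; rewrite mul_diag_mx !mxE h.
Qed.

Lemma card_ker_kappa i : #|[set a : A | kappa i * a == 0]| = (#|I i| * #|J i|)%N.
Proof.
rewrite -cardsX -(card_imset (finset.setX (I i) (J i)) (f := id : S * S -> A)) //.
congr #|pred_of_set _|; apply/setP => a; rewrite inE.
apply/eqP/imsetP => [/kerP h|[b + ->]]; last by rewrite inE => /kerP.
by exists a => //; rewrite inE.
Qed.

Lemma card_ker_diag m :
  #|[set Q : 'M[A]_(r, m) | K *m Q == 0]| = (\prod_i (#|I i| * #|J i|) ^ m)%N.
Proof.
pose Fam (p : 'I_r * 'I_m) := [pred a : A | kappa p.1 * a == 0].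
pose h (Q : 'M[A]_(r, m)) : {ffun 'I_r * 'I_m -> A} := [ffun p => Q p.1 p.2].
have hinj : injective h.
  move=> P Q /ffunP e; apply/matrixP => i j.
  by have := e (i, j); rewrite !ffunE.
rewrite -(card_imset _ hinj).
transitivity #|family Fam|.
  apply: eq_card => f; apply/imsetP/familyP => [[Q + ->] [i j]|fF].
    by rewrite inE => /mul_diag_row_eq0 hQ; rewrite ffunE !inE /= hQ.
  exists (\matrix_(i, j) f (i, j)); last by apply/ffunP => -[i j]; rewrite ffunE mxE.
  rewrite inE; apply/mul_diag_row_eq0 => i j; rewrite mxE.
  by have := fF (i, j); rewrite inE => /eqP.
rewrite card_family foldrE big_map big_enum /= -(pair_bigA _ (fun i j => #|Fam (i, j)|)) /=.
apply: eq_bigr => i _; rewrite -card_ker_kappa.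
rewrite (eq_bigr (fun=> #|[set a : A | kappa i * a == 0]|)) => [|j _].
  by rewrite prod_nat_const card_ord.
by rewrite cardsE.
Qed.

(** By [ker_conj] the condition on an entry above the diagonal implies that on its conjugate below.
    So row i has [r - i] free coordinates in [I i], the diagonal one included, and [r - i.+1] in
    [J i]. *)
Lemma card_herm_ker_diag :
  #|[set Y : 'M[A]_r | hermitian Y & K *m Y == 0]| =
  (\prod_(i < r) (#|I i| ^ (r - i) * #|J i| ^ (r - i.+1)))%N.
Proof.
rewrite -card_herm_mx.
(* Below the diagonal, the position (i, j) stores the second coordinate of the entry (j, i), which
   is constrained by row j. *)
pose Fam (p : 'I_r * 'I_r) := [pred y | y \in if (p.1 <= p.2)%N then I p.1 else J p.2].
transitivity #|family Fam|.
  apply: eq_card => x; rewrite inE; apply/mul_diag_row_eq0/familyP => [h [i j]|h i j].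
    rewrite inE /=; case: (ltngtP i j) => [ij|ij|/val_inj ij].
    - by have /kerP := h i j; rewrite mxE ij quad_pairE => /andP[].
    - by have /kerP := h j i; rewrite mxE ij quad_pairE => /andP[].
    - by have /kerP := h i j; rewrite mxE ij ltnn => /andP[].
  have hlt (i' j' : 'I_r) : (i' < j')%N -> kappa i' * herm_mx T D x i' j' = 0.
    move=> ij; apply/kerP; have := h (i', j'); have := h (j', i').
    by rewrite !inE /= (ltnW ij) leqNgt ij /= mxE ij quad_pairE /= => -> ->.
  case: (ltngtP i j) => [ij|ij|/val_inj ij]; first exact: hlt.
    have -> : herm_mx T D x i j = qconj (herm_mx T D x j i).
      have /hermitianP[e _] := herm_mx_hermitian T D x.
      by rewrite {1}e !mxE.
    exact: ker_conj (ltnW ij) (hlt _ _ ij).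
  rewrite ij; apply/kerP; have := h (j, j).
  by rewrite inE /= leqnn mxE ltnn /= => ->; exact: J0.
rewrite card_family foldrE big_map big_enum /= -(pair_bigA _ (fun i j => #|Fam (i, j)|)) /=.
transitivity (\prod_(i < r) \prod_(j < r) ((if (i <= j)%N then #|I i| else 1) *
   (if (j < i)%N then #|J j| else 1)))%N.
  apply: eq_bigr => i _; apply: eq_bigr => j _; rewrite /Fam /= ltnNge.
  by case: (i <= j)%N; rewrite /= ?muln1 ?mul1n; apply: eq_card => y; rewrite !inE.
transitivity (\prod_(i < r) \prod_(j < r) (if (i <= j)%N then #|I i| else 1) *
   \prod_(i < r) \prod_(j < r) (if (j < i)%N then #|J j| else 1))%N.
  by rewrite -big_split /=; apply: eq_bigr => i _; rewrite -big_split.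
rewrite [X in (_ * X)%N]exchange_big -big_split /=.
apply: eq_bigr => i _; rewrite -!big_mkcond /= !prod_nat_const; congr (_ ^ _ * _ ^ _)%N.
  exact: card_ord_geq.
exact: card_ord_geq i.+1.
Qed.

End KernelCount.

(** Neumann series, finite as [a] is nilpotent. *)
Lemma nilpotent_scale_rinv (A : comNzRingType) (r m : nat) (a : A) (B : 'M[A]_r) :
  a ^+ m = 0 -> exists U : 'M[A]_r, (1%:M + a *: B) *m U = 1%:M.
Proof.
move=> am; pose N : 'M[A]_r := - (a *: B).
have NX k : exists Bk : 'M[A]_r, N ^+ k = a ^+ k *: Bk.
  elim: k => [|k [Bk IH]]; first by exists 1; rewrite !expr0 scale1r.
  exists (- (B *m Bk)); rewrite exprS IH /N -mulmxE mulNmx -scalemxAl -scalemxAr.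
  by rewrite scalerN scalerA -exprS.
exists (\sum_(i < m) N ^+ i).
have [Bm Nm] := NX m; rewrite am scale0r in Nm.
have -> : 1%:M + a *: B = 1 - N by rewrite /N opprK.
by rewrite mulmxE -opprB mulNr -subrX1 Nm sub0r opprK.
Qed.

Section UniformCount.
Variables (S : finComNzRingType) (T D : S) (r : nat).
Local Notation A := (quad T D).
Variables (kappa : 'I_r -> A) (I J : 'I_r -> {set S}).
Hypothesis kerP : forall i a, kappa i * a = 0 <-> (a.1 \in I i) && (a.2 \in J i).
Hypothesis J0 : forall i, 0 \in J i.
Hypothesis ker_conj : forall (i j : 'I_r) a, (i <= j)%N -> kappa i * a = 0 -> kappa j * qconj a = 0.
Variables (varpi : A) (m : nat).
Hypothesis varpi_nil : varpi ^+ m = 0.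
Hypothesis ker_varpi : forall i a, kappa i * a = 0 -> exists b, a = varpi * b.

(* In the application A = O / p ^ N with kappa i a power of pi such that
   kappa i * A is isomorphic to O / pi ^ lam i, so that this is a copy of G, and the
   matrices F with [spans F] below are the surjections from A ^ n onto it. *)
Definition kappa_mod : {set 'cV[A]_r} :=
  [set g : 'cV[A]_r | [forall k, exists a, g k 0 == kappa k * a]].

Lemma kappa_modP (g : 'cV[A]_r) :
  reflect (exists h : 'cV[A]_r, g = diag_mx (\row_i kappa i) *m h) (g \in kappa_mod).
Proof.
rewrite inE; apply: (iffP forallP) => [h|[h ->] k].
  have /choice[f fP] k : exists a, g k 0 = kappa k * a.
    by have /existsP[a /eqP e] := h k; exists a.
  exists (\col_k f k); apply/matrixP => k j; rewrite mul_diag_mx !mxE ord1.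
  exact: fP.
by apply/existsP; exists (h k 0); rewrite mul_diag_mx !mxE.
Qed.

Lemma kappa_mod0 : 0 \in kappa_mod.
Proof. by apply/kappa_modP; exists 0; rewrite mulmx0. Qed.
Lemma kappa_modD : {in kappa_mod &, forall a b, a + b \in kappa_mod}.
Proof.
move=> a b /kappa_modP[x ->] /kappa_modP[y ->]; apply/kappa_modP.
by exists (x + y); rewrite mulmxDr.
Qed.
Lemma kappa_modN : {in kappa_mod, forall a, - a \in kappa_mod}.
Proof.
move=> a /kappa_modP[x ->]; apply/kappa_modP.
by exists (- x); rewrite mulmxN.
Qed.

Definition spans n (F : 'M[A]_(r, n)) := [set F *m v | v : 'cV[A]_n] == kappa_mod.

Lemma spans_col n (F : 'M[A]_(r, n)) j : spans F -> col j F \in kappa_mod.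
Proof. by move=> /eqP <-; rewrite colE; apply: imset_f. Qed.

(** A form of Nakayama's lemma. Lift the columns to [F = K Ft]; as the columns of K are in the image
    of F, some V0 satisfies [K Ft V0 = K]. The kernel of each [kappa i] lies in [varpi A], so
    [Ft V0] is 1 plus a multiple of the nilpotent [varpi], hence invertible on the right. *)
Lemma spans_split n (F : 'M[A]_(r, n)) : spans F ->
  exists (Ft : 'M[A]_(r, n)) (V : 'M[A]_(n, r)),
    F = diag_mx (\row_i kappa i) *m Ft /\ Ft *m V = 1%:M.
Proof.
set K := diag_mx _ => sF.
have /choice[ft ftP] j : exists h : 'cV[A]_r, col j F = K *m h.
  exact/kappa_modP/spans_col.
pose Ft : 'M[A]_(r, n) := \matrix_(k, j) ft j k 0.
have FE : F = K *m Ft.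
  apply/matrixP => k j; have := congr1 (fun g : 'cV[A]_r => g k 0) (ftP j).
  by rewrite /K !mul_diag_mx !mxE.
have /choice[v vP] i : exists v : 'cV[A]_n, F *m v = K *m delta_mx i 0.
  have : K *m delta_mx i 0 \in kappa_mod by apply/kappa_modP; eexists.
  by rewrite -(eqP sF) => /imsetP[v _ ->]; exists v.
pose V0 : 'M[A]_(n, r) := \matrix_(j, i) v i j 0.
have FV0 : K *m (Ft *m V0) = K.
  rewrite mulmxA -FE; apply/matrixP => k i.
  have := congr1 (fun g : 'cV[A]_r => g k 0) (vP i).
  rewrite /K mul_diag_mx !mxE eqxx andbT => e.
  transitivity (\sum_j F k j * v i j 0); first by apply: eq_bigr => j _; rewrite mxE.
  by rewrite e mulr_natr.
have /choice[b bP] p : exists b, (Ft *m V0 - 1%:M) p.1 p.2 = varpi * b.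
  apply: (ker_varpi (i := p.1)).
  have : K *m (Ft *m V0 - 1%:M) = 0 by rewrite mulmxBr FV0 mulmx1 subrr.
  by move=> /(congr1 (fun M : 'M[A]_r => M p.1 p.2)); rewrite mul_diag_mx !mxE.
pose B : 'M[A]_r := \matrix_(i, j) b (i, j).
have [U UP] := nilpotent_scale_rinv B varpi_nil.
exists Ft, (V0 *m U); split=> //; rewrite mulmxA.
have -> : Ft *m V0 = 1%:M + varpi *: B.
  apply/matrixP => i j; have := bP (i, j) => /= e.
  by rewrite [RHS]mxE [(varpi *: B) i j]mxE [B i j]mxE -e !mxE addrCA subrr addr0.
exact: UP.
Qed.

Lemma card_kappa_mod : (#|kappa_mod| * \prod_i (#|I i| * #|J i|) = #|{: A}| ^ r)%N.
Proof.
pose K : 'M[A]_r := diag_mx (\row_i kappa i).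
pose s (g : 'cV[A]_r) : 'cV[A]_r := if pselect (exists h, g = K *m h) is left e
  then projT1 (cid e) else 0.
have := @card_section _ _ finset.setT kappa_mod (mulmx K : {additive 'cV[A]_r -> 'cV[A]_r}) s.
rewrite cardsT card_mx muln1 => -> //.
- congr (_ * _)%N.
  have := card_ker_diag kerP 1; rewrite (eq_bigr (fun i => #|I i| * #|J i|)%N) => [<-|i _].
    by apply: eq_card => v; rewrite !inE.
  by rewrite expn1.
- by move=> x y _ _; rewrite inE.
- by move=> x _; apply/kappa_modP; exists x.
- move=> y /kappa_modP ey /=; rewrite /s; case: pselect => // e.
  exact: esym (projT2 (cid e)).
Qed.

Lemma card_herm_spans n (F : 'M[A]_(r, n)) : spans F ->
  (#|[set x | F *m herm_mx T D x == 0%R]| * #|kappa_mod| ^ n * #|S| ^ (r * r) =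
   #|S| ^ (n * n) * (\prod_(i < r) (#|I i| ^ (r - i) * #|J i| ^ (r - i.+1)))
   * #|kappa_mod| ^ r)%N.
Proof.
move=> sF; have [Ft [V [FE FV]]] := spans_split sF.
have a0 : (0 < \prod_i (#|I i| * #|J i|))%N.
  have : (0 < #|{: A}| ^ r)%N by rewrite expn_gt0; apply/orP; left; apply/card_gt0P; exists 0.
  by rewrite -card_kappa_mod muln_gt0 => /andP[].
have := card_split_hermitian FV (diag_mx (\row_i kappa i)).
rewrite -FE !(card_ker_diag kerP) (card_herm_ker_diag kerP J0 ker_conj).
rewrite (card_herm_mx (fun X : 'M[A]_n => F *m X == 0)).
have e (k : nat) : (\prod_i (#|I i| * #|J i|) ^ k = (\prod_i (#|I i| * #|J i|)) ^ k)%N.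
  by apply/esym; apply: (big_morph (expn^~ k) (fun x y => expnMn x y k) (exp1n k)).
rewrite !e !expnM -card_kappa_mod !expnMn.
set a := (\prod_i _)%N in a0 *; set b := (\prod_(i < r) _)%N; set g := #|kappa_mod|.
set d := #|_|; move=> h; apply/eqP.
have ak k : (0 < a ^ k)%N by rewrite expn_gt0 a0.
rewrite -(eqn_pmul2r (ak r)) -(eqn_pmul2r (ak n)); apply/eqP.
move: h; move: ((#|S| ^ r) ^ r)%N ((#|S| ^ n) ^ n)%N (g ^ n)%N (g ^ r)%N (a ^ n)%N (a ^ r)%N => *.
lia.
Qed.

End UniformCount.

Lemma card_columns_in (A : finComNzRingType) (r n : nat) (X : {set 'cV[A]_r}) :
  #|[set F : 'M[A]_(r, n) | [forall j, col j F \in X]]| = (#|X| ^ n)%N.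
Proof.
pose h (F : 'M[A]_(r, n)) : {ffun 'I_n -> 'cV[A]_r} := [ffun j => col j F].
have hinj : injective h.
  move=> F F' /ffunP e; apply/matrixP => k j.
  by have := e j; rewrite !ffunE => /(congr1 (fun c : 'cV[A]_r => c k 0)); rewrite !mxE.
have e0 : #|(ffun_on (mem X) : simpl_pred {ffun 'I_n -> 'cV[A]_r})| = (#|X| ^ n)%N.
  by rewrite card_ffun_on card_ord.
rewrite -(card_imset _ hinj) -e0.
apply: eq_card => f; apply/imsetP/ffun_onP => [[F + ->] j|fX].
  by rewrite inE ffunE => /forallP.
have e : f = h (\matrix_(k, j) f j k 0).
  by apply/ffunP => j; rewrite ffunE; apply/matrixP => k l; rewrite !mxE ord1.
exists (\matrix_(k, j) f j k 0) => //; rewrite inE; apply/forallP => j.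
by have := fX j; rewrite {1}e ffunE.
Qed.

(** * Moments over the finite ring *)

Section FiniteLevel.
Variables (S : finComNzRingType) (T D : S) (r : nat).
Local Notation A := (quad T D).
Variables (kappa : 'I_r -> A).
Local Notation G := (kappa_mod kappa).

(** Union bound: if F has its columns in G but does not span, these columns lie in its image, a
    proper subset of G. Bounding the number of images by that of all subsets is enough, being
    independent of n. *)
Lemma nonspanning_le n :
  (#|G| ^ n - #|[set F : 'M[A]_(r, n) | spans kappa F]|
     <= 2 ^ #|{: 'cV[A]_r}| * (#|G| - 1) ^ n)%N.
Proof.
rewrite -card_columns_in -cardsT -card_powerset leq_subLR.
pose Y (X : {set 'cV[A]_r}) := [set F : 'M[A]_(r, n) | [forall j, col j F \in X]].
apply: (@leq_trans #|[set F : 'M[A]_(r, n) | spans kappa F] :|: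
    \bigcup_(X in powerset finset.setT | X \proper G) Y X|).
  apply: subset_leq_card; apply/fintype.subsetP => F; rewrite inE => /forallP colF.
  rewrite finset.in_setU finset.in_set; case: (boolP (spans kappa F)) => //= nsF.
  apply/finset.bigcupP; exists [set F *m v | v : 'cV[A]_n].
    rewrite powersetE finset.subsetT /= finset.properEneq nsF /=.
    apply/fintype.subsetP => _ /imsetP[v _ ->].
    have /choice[h hP] j : exists h : 'cV[A]_r, col j F = diag_mx (\row_i kappa i) *m h.
      by apply/kappa_modP; exact: colF.
    apply/kappa_modP; exists ((\matrix_(k, j) h j k 0) *m v); rewrite mulmxA; congr (_ *m v).
    apply/matrixP => k j; have := congr1 (fun c : 'cV[A]_r => c k 0) (hP j).
    by rewrite !mul_diag_mx !mxE.
  by rewrite inE; apply/forallP => j; rewrite colE; apply: imset_f.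
rewrite cardsU; apply: leq_trans (leq_subr _ _) _; rewrite leq_add2l.
apply: (@leq_trans (\sum_(X in powerset finset.setT | X \proper G) #|Y X|)).
  elim/big_rec2: _ => [|X a B _ IH]; first by rewrite finset.cards0.
  by rewrite cardsU; apply: leq_trans (leq_subr _ _) _; rewrite leq_add2l.
apply: (@leq_trans (\sum_(X in powerset [set: 'cV[A]_r]%SET) (#|G| - 1) ^ n)%N); last first.
  by rewrite sum_nat_const.
rewrite big_mkcondr /=; apply: leq_sum => X _; case: ifP => // XG.
rewrite card_columns_in; case: n {Y} => [|n]; first by rewrite !expn0.
by rewrite leq_exp2r // leq_subRL ?add1n ?proper_card //; apply: leq_ltn_trans (proper_card XG).
Qed.

Lemma card_spans_le n : (#|[set F : 'M[A]_(r, n) | spans kappa F]| <= #|G| ^ n)%N.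
Proof.
rewrite -card_columns_in; apply: subset_leq_card; apply/fintype.subsetP => F.
by rewrite !inE => sF; apply/forallP => j; exact: spans_col.
Qed.

Variables (I J : 'I_r -> {set S}).
Hypothesis kerP : forall i a, kappa i * a = 0 <-> (a.1 \in I i) && (a.2 \in J i).
Hypothesis J0 : forall i, 0 \in J i.
Hypothesis ker_conj : forall (i j : 'I_r) a, (i <= j)%N -> kappa i * a = 0 -> kappa j * qconj a = 0.
Variables (varpi : A) (m : nat).
Hypothesis varpi_nil : varpi ^+ m = 0.
Hypothesis ker_varpi : forall i a, kappa i * a = 0 -> exists b, a = varpi * b.
Variables (R : realType) (psi : additive_char R[i] S).
Variables (regular : pred S) (eps : R).
Hypothesis regularP : forall a s, regular a -> a * s = 0 -> s = 0.
Hypotheses (eps_gt0 : 0 < eps) (eps_le1 : eps <= 1).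
Variable L : nat.
Hypothesis LP : (L * #|S| ^ (r * r) =
  (\prod_(i < r) (#|I i| ^ (r - i) * #|J i| ^ (r - i.+1))) * #|G| ^ r)%N.

(** For a uniform X, [card_herm_spans] and [LP] give each spanning F the probability [L / |G| ^ n]
    of [F X = 0], and all but an exponentially small proportion of the [|G| ^ n] matrices with
    columns in G are spanning. *)
Lemma finite_level_moment : exists K rho : R, [/\ 0 < K, 0 < rho, rho < 1 &
  forall n (mu : 'I_n * 'I_n -> S -> R),
    (forall p y, 0 <= mu p y) -> (forall p, \sum_y mu p y = 1) ->
    (forall p y, \sum_(z | ~~ regular (y - z)) mu p z <= 1 - eps) ->
    `|\sum_(F | spans kappa F)
      \sum_(x : {ffun 'I_n * 'I_n -> S} | F *m herm_mx T D x == 0) \prod_p mu p (x p)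
      - L%:R| <= K * rho ^+ n].
Proof.
have [K [rho [K0 r0 r1 univ]]] := universality psi (kappa_mod0 kappa)
  (@kappa_modD _ _ _ _ kappa) (@kappa_modN _ _ _ _ kappa) regularP eps_gt0 eps_le1.
have G0 : (0 < #|G|)%N by apply/card_gt0P; exists 0; exact: kappa_mod0.
have GR0 : 0 < #|G|%:R :> R by rewrite ltr0n.
have S0 : 0 < #|S|%:R :> R by rewrite ltr0n; apply/card_gt0P; exists 0.
pose q : R := (#|G| - 1)%:R / #|G|%:R.
have q0 : 0 <= q by rewrite divr_ge0.
have q1 : q < 1 by rewrite ltr_pdivrMr // mul1r ltr_nat subn1 prednK.
have [K' [rho' [K0' r0' r1' bound]]] : geometric_decay (fun n => K * rho ^+ n +
    (L%:R * (2 ^ #|{: 'cV[A]_r}|)%:R) * q ^+ n).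
  apply: geometric_decayD; apply: geometric_decayZ; apply: geometric_decayX => //.
  exact: ltW.
exists K', rho'; split=> // n mu mu0 mu1 muE.
apply: le_trans (bound n); apply: le_trans (ler_norm _).
have unif (F : 'M[A]_(r, n)) : spans kappa F ->
    #|[set x | F *m herm_mx T D x == 0]|%:R / (#|S| ^ (n * n))%:R = L%:R / #|G|%:R ^+ n :> R.
  move=> /(card_herm_spans kerP J0 ker_conj varpi_nil ker_varpi).
  rewrite -[RHS]mulnA -LP => e.
  have Sn k : ((#|S| ^ k)%:R : R) != 0 by rewrite natrX expf_neq0 ?gt_eqF.
  have Gn : #|G|%:R ^+ n != 0 :> R by rewrite expf_neq0 ?gt_eqF.
  apply/eqP; rewrite eqr_div // -natrX; apply/eqP; apply: (mulIf (Sn (r * r)%N)).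
  move: e => /(congr1 (fun k => k%:R : R)); rewrite !natrM => ->.
  by rewrite mulrCA mulrA.
have := univ n (spans kappa (n := n)) mu (fun F sF j => spans_col j sF) mu0 mu1 muE.
set s := \sum_(F | spans kappa F) (_ - _); set e := \sum_(F | spans kappa F) \sum_(x | _) _.
have -> : s = e - #|[set F : 'M[A]_(r, n) | spans kappa F]|%:R * (L%:R / #|G|%:R ^+ n).
  rewrite /s sumrB; congr (_ - _); rewrite (eq_bigr _ unif) sumr_const -[LHS]mulr_natl.
  by congr (_%:R * _); apply: eq_card => F; rewrite inE.
set c := #|[set F | _]| => h.
have -> : e - L%:R = (e - c%:R * (L%:R / #|G|%:R ^+ n)) +
    L%:R * ((c%:R - #|G|%:R ^+ n) / #|G|%:R ^+ n).
  have Gn : #|G|%:R ^+ n != 0 :> R by rewrite expf_neq0 ?gt_eqF.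
  rewrite mulrBl divff //; ring.
apply: le_trans (ler_normD _ _) _; apply: lerD => //.
rewrite normrM normr_nat -mulrA; apply: ler_wpM2l => //.
rewrite normrM normfV [X in _ / X]ger0_norm ?exprn_ge0 //.
have := nonspanning_le n; have := card_spans_le n; rewrite -/c => c1 c2.
rewrite -natrX distrC ger0_norm ?subr_ge0 ?ler_nat // -natrB //.
rewrite /q expr_div_n -!natrX mulrA; apply: ler_wpM2r; first by rewrite invr_ge0.
by rewrite -natrM ler_nat.
Qed.

End FiniteLevel.

(** * Integers of a quadratic extension of the p-adic numbers *)

Section PadicIntegers.
Variables (p : nat) (p_pr : prime p).
Local Notation Zp := (padic_int p_pr).
Implicit Types x y z : Zp.

Let p_gt0 : (0 < p)%N := prime_gt0 p_pr.
Let p_gt1 : (1 < p)%N := prime_gt1 p_pr.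

Definition residue k x : 'Z_(p ^ k.+1) := padic_residue x k.

Fact residue_is_nmod k : nmod_morphism (residue k).
Proof. by []. Qed.
Fact residue_is_monoid k : monoid_morphism (residue k).
Proof. by []. Qed.
HB.instance Definition _ k := GRing.isNmodMorphism.Build Zp ('Z_(p ^ k.+1))
  (residue k) (residue_is_nmod k).
HB.instance Definition _ k := GRing.isMonoidMorphism.Build Zp ('Z_(p ^ k.+1))
  (residue k) (residue_is_monoid k).

Lemma pexp_gt1 k : (1 < p ^ k.+1)%N.
Proof. by rewrite -(exp1n k.+1) ltn_exp2r. Qed.

Lemma residue_inj x y : (forall k, residue k x = residue k y) -> x = y.
Proof.
move=> h; apply/val_inj/functional_extensionality_dep => k; exact: h.
Qed.

Lemma val_Zp_natr k n : ((n%:R : 'Z_(p ^ k.+1)) : nat) = (n %% p ^ k.+1)%N.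
Proof. by rewrite Zp_nat /= [X in (_ %% X)%N](Zp_trunc_expn p_pr k). Qed.

Lemma Zp_ltn k (a : 'Z_(p ^ k.+1)) : (a < p ^ k.+1)%N.
Proof. by have := ltn_ord a; rewrite [X in (_ < X)%N](Zp_trunc_expn p_pr k). Qed.

Lemma eqmod_residue k (a : 'Z_(p ^ k.+1)) (n : nat) :
  (a = n %[mod p ^ k.+1])%N -> a = n%:R.
Proof.
by move=> e; apply/val_inj; rewrite /= val_Zp_natr -e modn_small // Zp_ltn.
Qed.

Lemma padic_of_seq (a : nat -> nat) : (forall k, (a k.+1 = a k %[mod p ^ k.+1])%N) ->
  exists x, forall k, residue k x = (a k)%:R.
Proof.
move=> h; pose v : residues p := fun k => (a k)%:R.
have cv : v \in coherent p_pr.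
  apply/asboolP => k; rewrite /v !val_Zp_natr.
  by rewrite modn_dvdm ?dvdn_exp2l // modn_mod.
by exists (PadicInt cv) => k.
Qed.

Lemma residue_mod x k : (residue k.+1 x = residue k x %[mod p ^ k.+1])%N.
Proof. exact: (padic_coherent x (leqnSn k)). Qed.

Lemma residue_natE k x : residue k x = (residue k x : nat)%:R.
Proof. exact: eqmod_residue. Qed.

Lemma residue_natE_le k j x : (k <= j)%N -> residue k x = (residue j x : nat)%:R.
Proof. by move=> kj; apply: eqmod_residue; rewrite -(padic_coherent x kj). Qed.

Lemma natr_Zp_eq0 k n : ((n%:R : 'Z_(p ^ k.+1)) == 0) = (p ^ k.+1 %| n)%N.
Proof. by rewrite -val_eqE /= val_Zp_natr. Qed.

Lemma residue_eq0P k x : reflect (exists y, x = p%:R ^+ k.+1 * y) (residue k x == 0).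
Proof.
apply: (iffP eqP) => [xk0|[y ->]]; last first.
  rewrite rmorphM rmorphXn rmorph_nat -natrX.
  suff -> : (p ^ k.+1)%:R = 0 :> 'Z_(p ^ k.+1) by rewrite mul0r.
  by apply/eqP; rewrite natr_Zp_eq0.
(* Division by [p ^ k.+1] loses [k.+1] digits, so level j of the quotient is read off level
   [j + k.+1] of x. *)
pose b j : nat := residue (j + k.+1) x.
have db j : (p ^ k.+1 %| b j)%N.
  have := xk0; rewrite (residue_natE_le (j := j + k.+1) x) ?addnS ?leqW ?leq_addl //.
  by rewrite -addnS => /eqP; rewrite natr_Zp_eq0.
pose a j := (b j %/ p ^ k.+1)%N.
have ba j : b j = (p ^ k.+1 * a j)%N by rewrite /a mulnC divnK.
have [|y hy] := @padic_of_seq a.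
  move=> j; have : (b j.+1 = b j %[mod p ^ (j.+1 + k.+1)])%N := residue_mod x (j + k.+1).
  rewrite !ba expnD mulnC [(_ * a j)%N]mulnC -!muln_modl.
  by move=> /eqP; rewrite eqn_pmul2r ?expn_gt0 ?p_gt0 // => /eqP.
exists y; apply: residue_inj => j.
rewrite rmorphM rmorphXn rmorph_nat /= hy -natrX -natrM -ba.
by apply: residue_natE_le; exact: leq_addr.
Qed.

Lemma residue_natr_surj k (a : 'Z_(p ^ k.+1)) : residue k (a : nat)%:R = a.
Proof. by rewrite rmorph_nat natr_Zp. Qed.

Lemma padic_unitP x : reflect (exists y, x * y = 1) (residue 0 x != 0).
Proof.
apply: (iffP idP) => [x0|[y xy]]; last first.
  apply: contraNneq (oner_neq0 'Z_(p ^ 1)) => x0.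
  by rewrite -[1](rmorph1 (residue 0)) -xy rmorphM /= x0 mul0r.
have cop j : coprime p (residue j x).
  rewrite prime_coprime //; apply: contra x0 => d.
  by rewrite (residue_natE_le (j := j)) // natr_Zp_eq0 expn1.
have uj j : residue j x \is a GRing.unit.
  rewrite residue_natE unitZpE ?pexp_gt1 //.
  by rewrite coprime_pexpl // cop.
pose a j : nat := (residue j x)^-1.
have ea j : (residue j x * a j = 1 %[mod p ^ j.+1])%N.
  have : ((residue j x * a j)%N%:R : 'Z_(p ^ j.+1)) = 1%:R.
    by rewrite natrM [X in X * _]natr_Zp [X in _ * X]natr_Zp (divrr (uj j)).
  by move=> /(congr1 (fun z : 'Z_(p ^ j.+1) => z : nat)); rewrite !val_Zp_natr.
have [|y hy] := @padic_of_seq a.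
  move=> j; have e1 : (residue j x * a j.+1 = 1 %[mod p ^ j.+1])%N.
    rewrite -modnMml -(residue_mod x j) modnMml.
    have dv : (p ^ j.+1 %| p ^ j.+2)%N by rewrite dvdn_exp2l.
    by rewrite -(modn_dvdm (_ * _) dv) ea modn_dvdm.
  have : (a j * residue j x * a j.+1 = a j.+1 %[mod p ^ j.+1])%N.
    by rewrite -modnMml [(a j * _)%N]mulnC ea modnMml mul1n.
  by rewrite -mulnA -modnMmr e1 modnMmr muln1 => ->.
exists y; apply: residue_inj => j; rewrite rmorphM rmorph1 /= hy.
rewrite [residue j x]residue_natE -natrM; apply/esym/eqmod_residue.
by rewrite ea /= modn_small // pexp_gt1.
Qed.

Lemma padic_nat_neq0 n : (0 < n)%N -> (n%:R : Zp) != 0.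
Proof.
move=> n0; apply/eqP => e.
have : residue n (n%:R : Zp) == 0 by rewrite e rmorph0.
rewrite rmorph_nat natr_Zp_eq0 => /(dvdn_leq n0).
by rewrite leqNgt (ltn_trans (ltn_expl n p_gt1)) // ltn_exp2l.
Qed.

Lemma padic_p_neq0 : (p%:R : Zp) != 0.
Proof. exact: padic_nat_neq0. Qed.

Lemma padic_nonunitP x : (~ exists y, x * y = 1) <-> exists y, x = p%:R * y.
Proof.
split=> [h|[y ->] [z]].
  have : residue 0 x == 0 by apply: contra_notT h => /padic_unitP.
  by move=> /residue_eq0P.
move=> e; have /padic_unitP : exists y, p%:R * y = 1 :> Zp by exists (y * z); rewrite mulrA.
by rewrite rmorph_nat natr_Zp_eq0 expn1 dvdnn.
Qed.

Lemma padic_factor x : x != 0 -> exists k u v, x = p%:R ^+ k * u /\ u * v = 1.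
Proof.
move=> x0; have [k xk] : exists k, residue k x != 0.
  apply/not_existsP => h; case/eqP: x0; apply: residue_inj => k.
  by have := h k; rewrite rmorph0 => /negP; rewrite negbK => /eqP.
have [k0 xk0 mink] := ex_minnP (ex_intro (fun k => residue k x != 0) k xk).
have [y xy] : exists y, x = p%:R ^+ k0 * y.
  case: k0 xk0 mink => [|k0] _ mink; first by exists x; rewrite expr0 mul1r.
  apply/residue_eq0P; apply: contraT => /mink; by rewrite ltnn.
exists k0, y; suff /padic_unitP [v yv] : residue 0 y != 0 by exists v.
apply: contra xk0 => /residue_eq0P[z yz]; apply/residue_eq0P.
by exists z; rewrite xy yz mulrA expr1 exprSr.
Qed.

Lemma padic_eq_opp x : x = - x -> x = 0.
Proof.
move=> /eqP; rewrite -addr_eq0 -mulr2n -mulr_natl mulf_eq0 => /orP[/eqP two0|/eqP //].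
(* Working modulo [p ^ 2 >= 4] rather than p covers p = 2. *)
have : ((2%:R : 'Z_(p ^ 2)) == 0) by rewrite -(rmorph_nat (residue 1)) two0 rmorph0.
rewrite natr_Zp_eq0 => /(@dvdn_leq _ 2 isT).
by nia.
Qed.

End PadicIntegers.

Lemma frac_numden (R : idomainType) (z : {fraction R}) :
  exists n d : R, d != 0 /\ z * FracField.tofrac d = FracField.tofrac n.
Proof.
exists (frac (repr z)).1, (frac (repr z)).2; split; first exact: denom_ratioP.
rewrite -{1}[z]reprK; set r := repr z; rewrite !piE; apply/eqmodP => /=.
rewrite FracField.equivfE /FracField.mulf /= !numden_Ratio ?oner_neq0 ?mulr1 ?denom_ratioP //.
by rewrite mulrC.
Qed.

(** * Integral closedness of the p-adic integers *)

Section IntegralElements.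
Variables (p : nat) (p_pr : prime p) (K : fieldExtType (padic_rat p_pr)).
Local Notation Zp := (padic_int p_pr).
Local Notation O := (int_ring K).
Local Notation emb := (padic_embed K).
Local Notation integral := (integralOver (padic_embed K)).
Implicit Types (x y : O) (a b : Zp).

Lemma emb_inj : injective emb.
Proof.
move=> a b e; have {}e : FracField.tofrac a = FracField.tofrac b.
  by apply: (fmorph_inj (in_alg K)).
by apply/eqP; rewrite -tofrac_eq e.
Qed.

Lemma emb_eq0 a : (emb a == 0) = (a == 0).
Proof. by rewrite -(rmorph0 emb) (inj_eq emb_inj). Qed.

Lemma emb_p_neq0 : emb p%:R != 0.
Proof. by rewrite emb_eq0 padic_p_neq0. Qed.

Lemma in_alg_numden (z : padic_rat p_pr) :
  exists a b, b != 0 /\ z%:A * emb b = emb a.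
Proof.
have [a [b [b0 e]]] := frac_numden z; exists a, b; split=> //.
by rewrite -[RHS]/(in_alg K _) -e rmorphM.
Qed.

(** Multiplying a monic equation of degree k for 1/p by [p ^ k] yields [1 + p c = 0], although p is
    not a unit. *)
Lemma inv_p_not_integral : ~ integral (emb p%:R)^-1.
Proof.
move=> [P Pmon /rootP rP].
have sP : (size P).-1.+1 = size P by rewrite prednK // lt0n size_poly_eq0 monic_neq0.
pose k := (size P).-1.
have : exists c, emb (1 + p%:R * c) = 0.
  exists (\sum_(i < k) P`_i * p%:R ^+ (k - i.+1)).
  have : emb p%:R ^+ k * (map_poly emb P).[(emb p%:R)^-1] = 0 by rewrite rP mulr0.
  rewrite (horner_coef_wide (n := k.+1)); last first.
    by rewrite size_map_inj_poly ?rmorph0 ?sP //; exact: emb_inj.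
  rewrite big_ord_recr /= mulrDr coef_map /=.
  have -> : P`_k = 1 by apply/eqP.
  rewrite rmorph1 mul1r exprVn mulfV ?expf_neq0 ?emb_p_neq0 // => e.
  rewrite rmorphD rmorph1 rmorphM rmorph_sum mulr_sumr addrC -[RHS]e mulr_sumr.
  congr (_ + _); apply: eq_bigr => i _; rewrite coef_map /= rmorphM rmorphXn mulrCA.
  rewrite [RHS]mulrCA; congr (_ * _); rewrite -exprS.
  by rewrite -subSn // subSS exprVn expfB.
move=> [c /eqP]; rewrite emb_eq0 => /eqP e.
have : ~ exists y : Zp, p%:R * y = 1 by apply/padic_nonunitP; exists 1; rewrite mulr1.
by apply; exists (- c); rewrite mulrN; apply/eqP; rewrite eq_sym -subr_eq0 opprK e.
Qed.

(** A nonzero z is a unit times [p ^ (i - j)]. If i < j, then 1/p is z times a unit times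
    [p ^ (j - i - 1)], so it would be integral. *)
Lemma integral_in_alg (z : padic_rat p_pr) : integral z%:A -> exists a, z%:A = emb a.
Proof.
move=> iz; have [a [b [b0 e]]] := in_alg_numden z.
have eb0 c : c != 0 -> emb c != 0 by rewrite emb_eq0.
have [a0|a0] := eqVneq a 0.
  exists 0; rewrite rmorph0; move/eqP: e; rewrite a0 rmorph0 mulf_eq0 emb_eq0 (negPf b0) orbF.
  by move/eqP.
have [i [u [u' [ea uu']]]] := padic_factor a0.
have [j [v [v' [eb vv']]]] := padic_factor b0.
have ev : z%:A * emb p%:R ^+ j = emb p%:R ^+ i * emb (u * v').
  have : z%:A * emb b * emb v' = emb a * emb v' by rewrite e.
  rewrite ea eb -[LHS]mulrA -!rmorphM -[_ * _ * v']mulrA vv' mulr1 -mulrA.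
  by rewrite rmorphXn [X in _ = X -> _]rmorphM rmorphXn.
have [ij|ij] := leqP j i.
  exists (p%:R ^+ (i - j) * (u * v')).
  apply: (mulIf (expf_neq0 j emb_p_neq0)); rewrite ev -(subnK ij) exprD.
  by rewrite addnK [emb (_ * (u * _))]rmorphM rmorphXn mulrAC.
exfalso; apply: inv_p_not_integral.
have [d jE] : exists d, j = (i + d).+1 by exists (j - i).-1; lia.
have e1 : emb (u * v') * emb (u' * v) = 1.
  by rewrite -rmorphM mulrACA uu' mul1r mulrC vv' rmorph1.
have -> : (emb p%:R)^-1 = z%:A * emb (u' * v) * emb p%:R ^+ d.
  apply: (mulIf (expf_neq0 j emb_p_neq0)); rewrite mulrAC [z%:A * _ * _]mulrAC ev.
  rewrite -[emb p%:R ^+ i * _ * _]mulrA e1 mulr1 jE -exprD exprS.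
  by rewrite mulKf ?emb_p_neq0.
apply: integral_mul; first apply: integral_mul => //; first exact: integral_id.
by rewrite -rmorphXn; exact: integral_id.
Qed.

End IntegralElements.

Section QuadraticExtension.
Variables (F : fieldType) (K : fieldExtType F).
Hypothesis dimK : \dim {:K} = 2%N.
Variable theta : K.
Hypothesis theta1 : theta \notin 1%VS.
Local Notation iota := (in_alg K).

Lemma in_alg_free a b : iota a + iota b * theta = 0 -> a = 0 /\ b = 0.
Proof.
move=> e; have b0 : b = 0.
  apply: contraNeq theta1 => b0; apply/vlineP; exists (- (b^-1 * a)).
  have ib0 : iota b != 0 by rewrite fmorph_eq0.
  apply: (mulfI ib0); rewrite -[_%:A]/(iota _) -rmorphM mulrN mulVKf // rmorphN /=.
  by apply/eqP; rewrite -addr_eq0 addrC; apply/eqP.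
by move: e; rewrite b0 rmorph0 mul0r addr0 => /eqP; rewrite fmorph_eq0 => /eqP.
Qed.

Lemma in_alg_basis x : exists a b, x = iota a + iota b * theta.
Proof.
have : (1 + <[theta]>)%VS = fullv.
  apply/eqP; rewrite eqEdim subvf dimK dimv_disjoint_sum ?dim_vline ?oner_neq0 //.
    have -> : theta != 0 by apply: contraNneq theta1 => ->; exact: mem0v.
    by [].
  apply/eqP; rewrite -subv0; apply/subvP => y; rewrite memv_cap => /andP[y1 /vlineP[c yE]].
  rewrite memv0; case: (eqVneq c 0) => [c0|c0]; first by rewrite yE c0 scale0r.
  case/negP: theta1; have -> : theta = c^-1 *: y by rewrite yE scalerK.
  exact: memvZ.
move=> e; have : x \in (1 + <[theta]>)%VS by rewrite e memvf.
move=> /memv_addP[u /vlineP[a ->] [v /vlineP[b ->] ->]].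
by exists a, b; rewrite mulr_algl.
Qed.

Lemma in_alg_inj2 a b c d :
  iota a + iota b * theta = iota c + iota d * theta -> a = c /\ b = d.
Proof.
move=> /eqP; rewrite -subr_eq0 => /eqP e.
have [] := @in_alg_free (a - c) (b - d); first by rewrite !rmorphB -e /=; ring.
by move=> /eqP; rewrite subr_eq0 => /eqP -> /eqP; rewrite subr_eq0 => /eqP ->.
Qed.

Lemma quadratic_relation : exists T D, theta ^+ 2 = iota T * theta - iota D.
Proof.
have [a [b e]] := in_alg_basis (theta ^+ 2); exists b, (- a).
by rewrite e rmorphN opprK addrC.
Qed.

Variables T D : F.
Hypothesis thetaE : theta ^+ 2 = iota T * theta - iota D.

(** [iota T - theta] is the other root of the equation of theta, and multiplication of coordinates
    depends on that equation only. *)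
Lemma quadratic_conj_aut : exists tau : 'AEnd(K), tau theta = iota T - theta.
Proof.
have /choice[c cP] x : exists ab : F * F, x = iota ab.1 + iota ab.2 * theta.
  by have [a [b e]] := in_alg_basis x; exists (a, b).
pose f x := iota (c x).1 + iota (c x).2 * (iota T - theta).
have fE a b : f (iota a + iota b * theta) = iota a + iota b * (iota T - theta).
  by rewrite /f; have [<- <-] := in_alg_inj2 (cP (iota a + iota b * theta)).
have flin : linear f.
  move=> k x y; rewrite [in LHS](cP x) [in LHS](cP y).
  rewrite -[k *: _]mulr_algl -[k%:A]/(iota k).
  have -> : iota k * (iota (c x).1 + iota (c x).2 * theta) + (iota (c y).1 + iota (c y).2 * theta)
    = iota (k * (c x).1 + (c y).1) + iota (k * (c x).2 + (c y).2) * theta.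
    by rewrite !rmorphD !rmorphM /=; ring.
  rewrite fE /f -[k *: _]mulr_algl -[k%:A]/(iota k) !rmorphD !rmorphM /=; ring.
have fmul : monoid_morphism f.
  split; first by rewrite -[1](_ : iota 1 + iota 0 * theta = 1) ?fE ?rmorph1 ?rmorph0 ?mul0r ?addr0.
  move=> x y; rewrite [in LHS](cP x) [in LHS](cP y) [in RHS]/f.
  move: (c x) (c y) => [a b] [a' b'] /=.
  have prodE (s : K) : s ^+ 2 = iota T * s - iota D ->
      (iota a + iota b * s) * (iota a' + iota b' * s) =
      iota (a * a' - b * b' * D) + iota (a * b' + b * a' + b * b' * T) * s.
    move=> sE; transitivity (iota a * iota a' + (iota a * iota b' + iota b * iota a') * s
       + iota b * iota b' * s ^+ 2); first by ring.
    by rewrite sE rmorphB !rmorphD !rmorphM /=; ring.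
  have conjE : (iota T - theta) ^+ 2 = iota T * (iota T - theta) - iota D.
    have -> : (iota T - theta) ^+ 2 = iota T ^+ 2 - 2%:R * iota T * theta + theta ^+ 2 by ring.
    by rewrite thetaE; ring.
  by rewrite -/(iota a) -/(iota b) -/(iota a') -/(iota b') (prodE _ thetaE) (prodE _ conjE) fE.
pose fL := GRing.isLinear.Build F K K *:%R f flin.
pose fM := GRing.isMonoidMorphism.Build K K f fmul.
pose f' : {lrmorphism K -> K} := HB.pack f fL fM.
exists (linfun_ahom f'); rewrite lfunE /=.
by have := fE 0 1; rewrite !rmorph0 !rmorph1 !add0r !mul1r.
Qed.

Hypothesis char2 : (2%:R : F) != 0.

Lemma quadratic_conj_neq : iota T - theta != theta.
Proof.
apply: contraNneq theta1 => e; apply/vlineP; exists (T / 2%:R).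
have i2 : iota 2%:R != 0 by rewrite fmorph_eq0.
apply: (mulIf i2); rewrite -[_%:A]/(iota _) -rmorphM divfK //.
rewrite rmorph_nat mulr_natr mulr2n -{2}e addrCA subrr addr0.
by [].
Qed.

(** sigma sends theta to one of the two roots. If it fixed theta, so would all its iterates, among
    them the conjugation of [quadratic_conj_aut]. *)
Lemma conj_quadratic (sigma : 'AEnd(K)) :
  (forall tau : 'AEnd(K), exists m : nat, forall x, tau x = iter m sigma x) ->
  sigma theta = iota T - theta.
Proof.
move=> gen; have iF a : sigma (iota a) = iota a.
  by rewrite linearZ /= rmorph1.
have : (sigma theta - theta) * (sigma theta - (iota T - theta)) = 0.
  have : sigma (theta ^+ 2) = iota T * sigma theta - iota D.
    by rewrite thetaE rmorphB rmorphM /= !iF.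
  rewrite rmorphXn /= => e.
  have -> : (sigma theta - theta) * (sigma theta - (iota T - theta)) =
    sigma theta ^+ 2 - iota T * sigma theta + (iota T * theta - theta ^+ 2) by ring.
  by rewrite e thetaE subKr addrAC subrK subrr.
move=> /eqP; rewrite mulf_eq0 !subr_eq0 => /orP[/eqP sid|/eqP //].
have [tau tauE] := quadratic_conj_aut; have [m mE] := gen tau.
have : iter m sigma theta = theta by elim: m {mE} => //= m ->.
rewrite -mE tauE => e; by have := quadratic_conj_neq; rewrite e eqxx.
Qed.

End QuadraticExtension.

Lemma quadratic_norm_trace (F : fieldType) (K : fieldExtType F) (sigma : 'AEnd(K)) :
  \dim {:K} = 2%N -> (2%:R : F) != 0 ->
  (forall tau : 'AEnd(K), exists m : nat, forall x, tau x = iter m sigma x) ->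
  forall u : K, (exists v, u * sigma u = in_alg K v) /\ (exists v, u + sigma u = in_alg K v).
Proof.
move=> dimK char2 gen u.
have [theta th1] : exists theta : K, theta \notin 1%VS.
  have /subvPn[theta _ ?] : ~~ ({:K} <= 1)%VS.
    by apply/negP => /dimvS; rewrite dimK dimv1.
  by exists theta.
have [T [D thE]] := quadratic_relation dimK th1.
have sE := conj_quadratic dimK th1 thE char2 gen.
have iF c : sigma (in_alg K c) = in_alg K c by rewrite linearZ /= rmorph1.
have [a [b ->]] := in_alg_basis dimK th1 u.
have -> : sigma (in_alg K a + in_alg K b * theta) =
    in_alg K a + in_alg K b * (in_alg K T - theta).
  have sD x y : sigma (x + y) = sigma x + sigma y by exact: rmorphD.
  have sM x y : sigma (x * y) = sigma x * sigma y by exact: rmorphM.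
  by rewrite sD sM !iF sE.
split; [exists (a ^+ 2 + a * b * T + b ^+ 2 * D)|exists (a + a + b * T)].
- transitivity (in_alg K a ^+ 2 + in_alg K a * in_alg K b * in_alg K T
     + in_alg K b ^+ 2 * (in_alg K T * theta - theta ^+ 2)); first by ring.
  by rewrite thE subKr -!(rmorphXn (in_alg K)) -!(rmorphM (in_alg K)) -!(rmorphD (in_alg K)).
- by rewrite !(rmorphD (in_alg K)) !(rmorphM (in_alg K)); ring.
Qed.

Section IntegerRingBasics.
Variables (p : nat) (p_pr : prime p) (K : fieldExtType (padic_rat p_pr)).
Local Notation Zp := (padic_int p_pr).
Local Notation O := (int_ring K).
Local Notation emb := (padic_embed K).
Local Notation ival := (@int_ring_val p p_pr K).
Implicit Types (x y z : O) (a b c : Zp).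

Lemma ivalD x y : ival (x + y) = ival x + ival y. Proof. exact: (rmorphD (val : O -> K)). Qed.
Lemma ivalB x y : ival (x - y) = ival x - ival y. Proof. exact: (rmorphB (val : O -> K)). Qed.
Lemma ivalM x y : ival (x * y) = ival x * ival y. Proof. exact: (rmorphM (val : O -> K)). Qed.
Lemma ivalX x n : ival (x ^+ n) = ival x ^+ n. Proof. exact: (rmorphXn (val : O -> K)). Qed.
Lemma ival1 : ival 1 = 1. Proof. exact: (rmorph1 (val : O -> K)). Qed.
Lemma ival0 : ival 0 = 0. Proof. exact: (rmorph0 (val : O -> K)). Qed.
Lemma ival_inj : injective ival. Proof. exact: val_inj. Qed.
Lemma ival_nat n : ival n%:R = n%:R. Proof. exact: (rmorph_nat (val : O -> K)). Qed.
Lemma ival_integral x : integralOver (padic_embed K) (ival x).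
Proof. by have /asboolP := valP x. Qed.
Lemma of_integral (u : K) : integralOver (padic_embed K) u -> exists x, ival x = u.
Proof.
move=> iu; have h : u \in integral_elt (K := K) by apply/asboolP.
by exists (IntRing h).
Qed.

Lemma embM a b : emb (a * b) = emb a * emb b. Proof. exact: rmorphM. Qed.
Lemma emb1 : emb 1 = 1. Proof. exact: rmorph1. Qed.

Lemma int_mulf_eq0 x y : x * y = 0 -> x = 0 \/ y = 0.
Proof.
move=> /(congr1 ival); rewrite ivalM ival0 => /eqP; rewrite mulf_eq0.
by case/orP => /eqP e; [left|right]; apply: ival_inj; rewrite e ival0.
Qed.

Lemma int_mulfI x : x <> 0 -> injective ( *%R x).
Proof.
move=> x0 y z e; apply/eqP; rewrite -subr_eq0; apply/eqP.
have : x * (y - z) = 0 by rewrite mulrBr e subrr.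
by case/int_mulf_eq0.
Qed.

Fact embO_subproof a : emb a \in integral_elt (K := K).
Proof. by apply/asboolP; exact: integral_id. Qed.
Definition embO a : O := IntRing (embO_subproof a).

Fact embO_is_nmod : nmod_morphism embO.
Proof.
by split=> [|a b]; apply: ival_inj; rewrite ?ivalD ?ival0 /= ?rmorph0 ?rmorphD.
Qed.
Fact embO_is_monoid : monoid_morphism embO.
Proof.
by split=> [|a b]; apply: ival_inj; rewrite ?ivalM ?ival1 /= ?rmorph1 ?rmorphM.
Qed.
HB.instance Definition _ := GRing.isNmodMorphism.Build Zp O embO embO_is_nmod.
HB.instance Definition _ := GRing.isMonoidMorphism.Build Zp O embO embO_is_monoid.

Lemma embOM a b : embO (a * b) = embO a * embO b. Proof. exact: rmorphM. Qed.
Lemma embOB a b : embO (a - b) = embO a - embO b. Proof. exact: rmorphB. Qed.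
Lemma embON a : embO (- a) = - embO a. Proof. exact: rmorphN. Qed.
Lemma embOX a n : embO (a ^+ n) = embO a ^+ n. Proof. exact: rmorphXn. Qed.
Lemma embO1 : embO 1 = 1. Proof. exact: rmorph1. Qed.

Lemma embO_inj : injective embO.
Proof. by move=> a b /(congr1 ival) /emb_inj. Qed.

Lemma embO_p : embO p%:R = p%:R. Proof. exact: rmorph_nat. Qed.

Lemma int_p_neq0 : (p%:R : O) <> 0.
Proof.
rewrite -embO_p -(rmorph0 embO) => /embO_inj /eqP; apply/negP; exact: padic_p_neq0.
Qed.

Lemma int_pX_neq0 n : (p%:R ^+ n : O) <> 0.
Proof.
elim: n => [|n IHn]; first by apply/eqP; rewrite expr0 oner_neq0.
by rewrite exprS => /int_mulf_eq0[/int_p_neq0|].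
Qed.

Hypothesis dimK : \dim {:K} = 2%N.
Variable sigma : 'AEnd(K).
Hypothesis sigma_gen : generates_Gal sigma.

Lemma sigma_in_alg u : sigma (in_alg K u) = in_alg K u.
Proof. by rewrite linearZ /= rmorph1. Qed.

Lemma sigma_emb a : sigma (emb a) = emb a.
Proof. exact: sigma_in_alg. Qed.

Lemma char2_padic_rat : (2%:R : padic_rat p_pr) != 0.
Proof.
rewrite -(rmorph_nat (@FracField.tofrac Zp) 2) tofrac_eq0.
exact: padic_nat_neq0.
Qed.

Lemma sigma_int x : exists y, ival y = sigma (ival x).
Proof.
apply: of_integral; have [P Pmon rP] := ival_integral x; exists P => //.
have := rmorph_root sigma rP; rewrite -map_poly_comp.
by rewrite (eq_map_poly (g := emb)) // => a; rewrite /= sigma_emb.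
Qed.

Lemma norm_trace_in_alg (u : K) :
  (exists v, u * sigma u = in_alg K v) /\ (exists v, u + sigma u = in_alg K v).
Proof. exact: quadratic_norm_trace dimK char2_padic_rat sigma_gen u. Qed.

Lemma int_norm x : exists n, ival x * sigma (ival x) = emb n.
Proof.
have [[c e] _] := norm_trace_in_alg (ival x); rewrite e.
apply: integral_in_alg; rewrite -[_%:A]/(in_alg K c) -e.
have [y yE] := sigma_int x; rewrite -yE.
by apply: integral_mul; exact: ival_integral.
Qed.

Lemma int_trace x : exists n, ival x + sigma (ival x) = emb n.
Proof.
have [_ [c e]] := norm_trace_in_alg (ival x); rewrite e.
apply: integral_in_alg; rewrite -[_%:A]/(in_alg K c) -e.
have [y yE] := sigma_int x; rewrite -yE.
by apply: integral_add; exact: ival_integral.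
Qed.

(** The inverse of x is its conjugate times the inverse of its norm. This brings questions on units
    of O down to the p-adic integers. *)
Lemma int_unit_norm x n : ival x * sigma (ival x) = emb n ->
  (exists y, x * y = 1) <-> (exists m, n * m = 1).
Proof.
move=> xn; split=> [[y xy]|[m nm]].
  have [m ym] := int_norm y; exists m; apply: (@emb_inj _ p_pr K).
  rewrite embM -xn -ym mulrACA -ivalM xy.
  have sM u v : sigma (u * v) = sigma u * sigma v by exact: rmorphM.
  by rewrite -sM -ivalM xy ival1 mul1r emb1; exact: rmorph1.
have [y yE] := sigma_int x; exists (y * embO m); apply: ival_inj.
by rewrite mulrA !ivalM yE xn ival1 -embM nm emb1.
Qed.

Lemma embO_unit a : (exists y, embO a * y = 1) <-> (exists b, a * b = 1).
Proof.
have e : ival (embO a) * sigma (ival (embO a)) = emb (a * a).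
  by rewrite /= sigma_emb embM.
split=> [/(int_unit_norm e)[m mE]|[b ab]]; first by exists (a * m); rewrite mulrA.
by exists (embO b); rewrite -embOM ab embO1.
Qed.

Lemma embO_nonunit a : ~ (exists y, embO a * y = 1) <-> exists b, a = p%:R * b.
Proof. by rewrite -padic_nonunitP embO_unit. Qed.

Lemma p_nonunit : ~ exists y, p%:R * y = 1 :> O.
Proof. by rewrite -embO_p embO_nonunit; exists 1; rewrite mulr1. Qed.

(* 1 and t generate O/pO freely over Z/p. *)
Definition independent_mod_p (t : O) :=
  forall a b y, embO a + t * embO b = p%:R * y ->
    (exists a', a = p%:R * a') /\ (exists b', b = p%:R * b').

Section Basis.
Variable t : O.
Hypothesis tP : independent_mod_p t.

(** Infinite descent: dividing the relation by p again and again shows that every power of p divides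
    [a] and [b]. *)
Lemma basis_free a b : embO a + t * embO b = 0 -> a = 0 /\ b = 0.
Proof.
move=> e; have h n : (exists a', a = p%:R ^+ n * a') /\ (exists b', b = p%:R ^+ n * b').
  elim: n => [|n [[a' aE] [b' bE]]].
    by split; [exists a|exists b]; rewrite expr0 mul1r.
  have : embO a' + t * embO b' = p%:R * 0.
    apply: (int_mulfI (@int_pX_neq0 n)); rewrite !mulr0 mulrDr -e aE bE !embOM !embOX.
    by rewrite embO_p mulrCA.
  move=> /tP[[a'' a'E] [b'' b'E]]; split; [exists a''|exists b''].
    by rewrite aE a'E exprSr mulrA.
  by rewrite bE b'E exprSr mulrA.
split; apply: residue_inj => k; rewrite rmorph0; apply/eqP/residue_eq0P.
  by case: (h k.+1).1 => a' ->; exists a'.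
by case: (h k.+1).2 => b' ->; exists b'.
Qed.

Lemma basis_inj a b a' b' :
  embO a + t * embO b = embO a' + t * embO b' -> a = a' /\ b = b'.
Proof.
move=> e; have [] := @basis_free (a - a') (b - b').
  by rewrite !embOB mulrBr addrACA -opprD e subrr.
by move=> /eqP; rewrite subr_eq0 => /eqP -> /eqP; rewrite subr_eq0 => /eqP ->.
Qed.

Lemma basis_notin : ival t \notin 1%VS.
Proof.
apply/negP => /vlineP[c tE]; have [a [b [b0 e]]] := in_alg_numden K c.
have [] := @basis_free (- a) b.
  apply: ival_inj; by rewrite ivalD ivalM ival0 /= tE e rmorphN addNr.
by move=> _ bz; rewrite bz eqxx in b0.
Qed.

(** Up to units the denominators of x over the p-adic numbers are powers of p, so some [p ^ k x] has
    integral coordinates; independence modulo p then removes one factor p at a time. *)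
Lemma basis_span x : exists a b, x = embO a + t * embO b.
Proof.
have pdesc n : forall a b, embO a + t * embO b = p%:R ^+ n * x ->
    exists a b, x = embO a + t * embO b.
  elim: n => [|n IHn] a b e; first by exists a, b; rewrite e expr0 mul1r.
  have [[a' aE] [b' bE]] : (exists a', a = p%:R * a') /\ (exists b', b = p%:R * b').
    by apply: (tP (y := p%:R ^+ n * x)); rewrite e exprS mulrA.
  apply: (IHn a' b'); apply: (int_mulfI int_p_neq0).
  by rewrite mulrA -exprS -e aE bE !embOM embO_p mulrDr mulrCA.
have [c [d xE]] := in_alg_basis dimK basis_notin (ival x).
have [a1 [b1 [b10 e1]]] := in_alg_numden K c.
have [a2 [b2 [b20 e2]]] := in_alg_numden K d.
have [k [u [v [bE uv]]]] := padic_factor (mulf_neq0 b10 b20).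
apply: (pdesc k (a1 * b2 * v) (a2 * b1 * v)); apply: ival_inj.
rewrite ivalD !ivalM ivalX ival_nat /= !embM -e1 -e2 xE -[c%:A]/(in_alg K c) -[d%:A]/(in_alg K d).
have -> : (p%:R : K) ^+ k = emb b1 * emb b2 * emb v.
  by rewrite -!embM bE -mulrA uv mulr1; rewrite rmorphXn rmorph_nat.
ring.
Qed.

Lemma basis_relation : exists T D : Zp,
  [/\ t ^+ 2 = t * embO T - embO D, sigma (ival t) = emb T - ival t
    & ival t * sigma (ival t) = emb D].
Proof.
have [T TE] := int_trace t; have [D DE] := int_norm t.
have sE : sigma (ival t) = emb T - ival t by rewrite -TE addrC addKr.
exists T, D; split=> //; apply: ival_inj.
by rewrite ivalB ivalM ivalX /= -DE sE; ring.
Qed.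

End Basis.

End IntegerRingBasics.

Section Ramification.
Variables (p : nat) (p_pr : prime p) (K : fieldExtType (padic_rat p_pr)).
Local Notation Zp := (padic_int p_pr).
Local Notation O := (int_ring K).
Local Notation emb := (padic_embed K).
Local Notation ival := (@int_ring_val p p_pr K).
Implicit Types (x y z : O) (a b c : Zp).
Hypothesis dimK : \dim {:K} = 2%N.
Variable sigma : 'AEnd(K).
Hypothesis sigma_gen : generates_Gal sigma.
Variable pi : O.
Hypothesis pi_unif : uniformizer pi.

(* [e] is the ramification index, and [a + t b] lies in the ideal [pi ^ l] iff
   [p ^ al l] divides [a] and [p ^ be l] divides [b]. *)
Record int_basis (t : O) (al be : nat -> nat) (T D : Zp) (e : nat) (u v : O) : Prop := IntBasis {
  ib_indep : independent_mod_p t;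
  ib_sq : t ^+ 2 = t * embO K T - embO K D;
  ib_conj : sigma (ival t) = emb T - ival t;
  ib_e : (0 < e <= 2)%N;
  ib_p : p%:R = pi ^+ e * u;
  ib_uv : u * v = 1;
  ib_ideal : forall l a b, (exists y, embO K a + t * embO K b = pi ^+ l * y) <->
    (exists c, a = p%:R ^+ al l * c) /\ (exists c, b = p%:R ^+ be l * c) }.

Lemma pi_nonunit : ~ exists y, pi * y = 1.
Proof. by apply/pi_unif; exists 1; rewrite mulr1. Qed.

Lemma unit_or_pi x : (exists y, x * y = 1) \/ (exists y, x = pi * y).
Proof. by case: (pselect (exists y, x * y = 1)) => h; [left|right; apply/pi_unif]. Qed.

Lemma p_in_pi : exists z, p%:R = pi * z.
Proof. by apply/pi_unif; exact: (p_nonunit dimK sigma_gen). Qed.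

Lemma embO_in_pi a : (exists y, embO K a = pi * y) -> exists b, a = p%:R * b.
Proof. by move=> /pi_unif /(embO_nonunit dimK sigma_gen). Qed.

Lemma pi_neq0 : pi <> 0.
Proof.
move=> pi0; have [z] := p_in_pi; rewrite pi0 mul0r; exact: int_p_neq0.
Qed.

Lemma piX_neq0 n : pi ^+ n <> 0.
Proof.
elim: n => [|n IHn]; first by apply/eqP; rewrite expr0 oner_neq0.
by rewrite exprS => /int_mulf_eq0[/pi_neq0|].
Qed.

Lemma unramified_unit : unramified K -> exists u v, p%:R = pi * u /\ u * v = 1.
Proof.
move=> unr; have [u pu] := p_in_pi; have [v pv] : exists v, pi = p%:R * v.
  by apply/unr; exact: pi_nonunit.
exists u, v; split=> //; apply: (int_mulfI pi_neq0).
by rewrite mulr1 mulrA -pu -pv.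
Qed.

(** If p / pi were a unit, p would be a uniformizer; so [p = pi ^ 2 u]. Taking norms,
    [p ^ 2 = N(pi) ^ 2 N(u)] with [N(pi) = p c], whence [c ^ 2 N(u) = 1] and u is a unit. *)
Lemma ramified_unit : ~ unramified K -> exists u v, p%:R = pi ^+ 2 * u /\ u * v = 1.
Proof.
move=> ram; have [z pz] := p_in_pi.
have [[y zy]|[u zu]] := unit_or_pi z.
  case: ram => x; split=> [[y' ->]|/pi_unif[y' ->]].
    by apply/pi_unif; exists (z * y'); rewrite mulrA pz.
  by exists (y * y'); rewrite pz mulrA -[pi * z * y]mulrA zy mulr1.
have pE : p%:R = pi ^+ 2 * u by rewrite pz zu expr2 mulrA.
have [n nE] := int_norm dimK sigma_gen pi; have [m mE] := int_norm dimK sigma_gen u.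
have [c cE] : exists c, n = p%:R * c.
  apply/padic_nonunitP => hu; apply: pi_nonunit.
  by apply/(int_unit_norm dimK sigma_gen nE).
have /(int_unit_norm dimK sigma_gen mE)[v uv] : exists c', m * c' = 1.
  exists (c * c); have p0 : (p%:R * p%:R : Zp) != 0 by rewrite mulf_neq0 ?padic_p_neq0.
  apply: (mulfI p0); apply: (@emb_inj _ p_pr K); rewrite mulr1.
  have -> : p%:R * p%:R * (m * (c * c)) = n * n * m by rewrite cE; ring.
  have sM (y y' : K) : sigma (y * y') = sigma y * sigma y' by exact: rmorphM.
  rewrite !embM -nE -mE.
  transitivity (ival p%:R * sigma (ival p%:R)).
    by rewrite pE ivalM ivalX expr2 !sM; ring.
  by rewrite ival_nat -(rmorph_nat emb) (sigma_emb sigma).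
by exists u, v.
Qed.

(** Up to a unit [pi ^ (2 m)] is [p ^ m], which acts alike on both coordinates; a further factor pi
    exchanges them and, p dividing D, adds a factor p to the first one only. *)
Lemma int_basis_ramified : ~ unramified K ->
  exists T D e u v, int_basis pi uphalf half T D e u v.
Proof.
move=> ram; have [u [v [pE uv]]] := ramified_unit ram.
have ind : independent_mod_p pi.
  move=> a b y e; have [a' aE] : exists a', a = p%:R * a'.
    apply: embO_in_pi; exists (pi * u * y - embO K b).
    by rewrite mulrBr !mulrA -expr2 -pE -e addrK.
  split; first by exists a'.
  apply: embO_in_pi; exists (u * (y - embO K a')); apply: (int_mulfI pi_neq0).
  rewrite !mulrA -expr2 -pE mulrBr -e aE embOM embO_p addrAC subrr add0r //.
have [T [D [sqE cE nE]]] := basis_relation dimK sigma_gen pi.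
exists T, D, 2%N, u, v; split=> //.
have [D' DE] : exists D', D = p%:R * D'.
  apply/padic_nonunitP => hu; apply: pi_nonunit.
  by apply/(int_unit_norm dimK sigma_gen nE).
have pmX m : p%:R ^+ m = pi ^+ m.*2 * u ^+ m by rewrite pE exprMn -exprM mul2n.
have pimX m : pi ^+ m.*2 = p%:R ^+ m * v ^+ m.
  by rewrite pmX -mulrA -exprMn uv expr1n mulr1.
have embOpX n c : embO K (p%:R ^+ n * c) = p%:R ^+ n * embO K c.
  by rewrite embOM embOX embO_p.
move=> l a b; split=> [[y e]|[[a' ->] [b' ->]]].
- have [m [lE [-> ->]]] : exists m : nat,
      (l = m.*2 \/ l = m.*2.+1) /\ (uphalf l = m + odd l)%N /\ (half l = m).
    exists l./2; split; last by split=> //; rewrite uphalf_half addnC.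
    by have e0 := odd_double_half l; case: (odd l) e0 => /= e0; [right|left]; exact: esym e0.
  case: lE => lE.
    have [c [d yE]] := basis_span dimK ind (v ^+ m * y).
    have [-> ->] : a = p%:R ^+ m * c /\ b = p%:R ^+ m * d.
      apply: (basis_inj ind).
      rewrite e lE pimX.
      rewrite -mulrA yE.
      rewrite !embOpX.
      by rewrite mulrDr mulrCA.
    rewrite lE odd_double addn0; split; [by exists c|by exists d].
  have [c [d yE]] := basis_span dimK ind (v ^+ m * y).
  (* Expansion of [pi (c + pi d)] by [pi ^ 2 = T pi - D]. *)
  have [-> ->] : a = p%:R ^+ m * (- (D * d)) /\ b = p%:R ^+ m * (c + d * T).
    apply: (basis_inj ind); rewrite e lE exprS pimX !embOpX.
    have id1 (R : comNzRingType) (q w x z : R) : q * (w * x) * z = w * (q * (x * z)) by ring.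
    rewrite id1.
    have embOD a1 b1 : embO K (a1 + b1) = embO K a1 + embO K b1 by exact: rmorphD.
    have id2 (R : comNzRingType) (P s c0 d0 T0 D0 : R) :
      P * (s * c0 + (s * T0 - D0) * d0) = P * - (D0 * d0) + s * (P * (c0 + d0 * T0)) by ring.
    by rewrite yE mulrDr (mulrA pi pi) -expr2 sqE embOD embON !embOM id2.
  rewrite lE /= odd_double addn1; split; last by eexists.
  by exists (- (D' * d)); rewrite DE exprSr !mulrN !mulrA.
- have lE : (l = (odd l) + l./2.*2)%N by rewrite odd_double_half.
  rewrite uphalf_half; move: lE; set m := l./2; case: (odd l) => lE; rewrite lE !embOpX.
  + exists (u ^+ m * (pi * u * embO K a' + embO K b')).
    have id3 (R : comNzRingType) (s Q U w x z : R) :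
      s ^+ 2 * w * (Q * U) * x + s * (Q * U * z) = s * Q * (U * (s * w * x + z)) by ring.
    by rewrite add1n exprS (exprS pi) {1}pE pmX id3.
  + exists (u ^+ m * (embO K a' + pi * embO K b')); rewrite !add0n pmX.
    by rewrite [RHS]mulrA mulrDr mulrCA.
Qed.

Lemma padic_fermat c : exists c', c ^+ p - c = p%:R * c'.
Proof.
suff /residue_eq0P[c' ->] : residue 0 (c ^+ p - c) == 0 by exists c'; rewrite expr1.
rewrite rmorphB rmorphXn /= subr_eq0 [residue 0 c]residue_natE -natrX.
apply/eqP/val_inj; rewrite /= !val_Zp_natr //.
by move: (nat_of_ord (residue 0 c)) => m; rewrite expn1 fermat_little.
Qed.

(** The ideals are generated by powers of p, so membership is read coordinatewise; what has to be
    shown is that 1 and w stay independent modulo p. *)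
Lemma int_basis_unramified (w : K) : unramified K -> (p ^ 2 - 1).-primitive_root w ->
  exists t, ival t = w /\ exists T D e u v, int_basis t id id T D e u v.
Proof.
move=> unr prw; have p1 := prime_gt1 p_pr; have p0 := prime_gt0 p_pr.
have N0 : (0 < p ^ 2 - 1)%N by rewrite subn_gt0 -(exp1n 2) ltn_exp2r.
have [t tw] : exists t, ival t = w.
  apply: of_integral; exists ('X^(p ^ 2 - 1) - 1); first exact: monicXnsubC.
  rewrite rmorphB rmorph1 /= map_polyXn /root !hornerE.
  by rewrite (prim_expr_order prw) subrr.
have tN : t ^+ (p ^ 2 - 1) = 1 by apply: ival_inj; rewrite ivalX tw ival1 prim_expr_order.
exists t; split=> //.
have [u [v [pE uv]]] := unramified_unit unr.
have embO_pdiv a y : embO K a = p%:R * y -> exists b, a = p%:R * b.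
  by move=> e; apply: embO_in_pi; exists (u * y); rewrite e pE mulrA.
have t_unit : t * t ^+ (p ^ 2 - 2) = 1.
  rewrite -exprS -tN; congr (_ ^+ _).
  have : (1 < p ^ 2)%N by rewrite -(exp1n 2) ltn_exp2r.
  by lia.
have ind : independent_mod_p t.
  move=> a b y e; have [[b' bb']|/(embO_nonunit dimK sigma_gen)[b' bE]] :=
    pselect (exists y, embO K b * y = 1); last first.
    split; last by exists b'.
    apply: (embO_pdiv _ (y - t * embO K b')).
    by rewrite mulrBr -e bE embOM embO_p mulrCA addrK.
  (* Otherwise t = c mod p with c in Zp, so that t ^ p = t mod p and z := t ^ (p - 1)
     is a (p + 1)-st root of unity equal to 1 mod p. Then 1 + z + .. + z ^ p = 1 mod p
     is not zero, hence z = 1, and w is not primitive. *)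
  exfalso.
  have [b1 bb1] : exists b1, b * b1 = 1.
    by apply/(embO_unit dimK sigma_gen); exists b'.
  pose c := - (a * b1); pose y1 := y * embO K b1.
  have tc : t = embO K c + p%:R * y1.
    rewrite /c /y1 embON embOM [p%:R * _]mulrA -e mulrDl addrA addNr add0r.
    by rewrite -mulrA -embOM bb1 embO1 mulr1.
  have [y2 tp] : exists y2, t ^+ p - t = p%:R * y2.
    have [c' cp] := padic_fermat c.
    exists (y1 * (\sum_(i < p) t ^+ (p.-1 - i) * embO K c ^+ i) + embO K c' - y1).
    have -> : t ^+ p - t = (t ^+ p - embO K c ^+ p) + (embO K c ^+ p - embO K c) - (t - embO K c).
      have id4 (R : comNzRingType) (x y' z t' : R) :
        x - t' = (x - y') + (y' - z) - (t' - z) by ring.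
      exact: id4.
    rewrite -{2}embOX -embOB cp embOM embO_p subrXX.
    have -> : t - embO K c = p%:R * y1 by rewrite [in LHS]tc addrAC subrr add0r.
    by rewrite mulrBr mulrDr !mulrA.
  pose z := t ^+ p.-1.
  have [y3 zE] : exists y3, z = 1 + p%:R * y3.
    exists (t ^+ (p ^ 2 - 2) * y2); rewrite mulrCA -tp mulrBr [_ * t]mulrC t_unit addrC subrK.
    have -> : t ^+ p = t * z by rewrite -exprS (prednK p0).
    by rewrite mulrA [_ * t]mulrC t_unit mul1r.
  have zX : z ^+ p.+1 = 1.
    by rewrite /z -exprM -tN; congr (_ ^+ _); case: p p0 => // q _ /=; lia.
  have [y4 y4E] : exists y4, \sum_(i < p.+1) z ^+ i = 1 + p%:R * y4.
    have h i : exists y, z ^+ i = 1 + p%:R * y.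
      elim: i => [|i [y' IH]]; first by exists 0; rewrite mulr0 addr0.
      exists (y' + y3 * (1 + p%:R * y')); rewrite exprS IH zE.
      have id5 (R : comNzRingType) (P x z' : R) :
        (1 + P * x) * (1 + P * z') = 1 + P * (z' + x * (1 + P * z')).
        by ring.
      exact: id5.
    have /choice[f fE] := h.
    exists (\sum_(i < p.+1) f i + 1); under eq_bigr do rewrite fE.
    rewrite big_split /= sumr_const card_ord -mulr_sumr -natr1.
    have id6 (R : comNzRingType) (P x : R) : P + 1 + P * x = 1 + P * (x + 1) by ring.
    exact: id6.
  have z1 : z = 1.
    apply/eqP; rewrite -subr_eq0; apply/eqP.
    have : (z - 1) * (1 + p%:R * y4) = 0 by rewrite -y4E -subrX1 zX subrr.
    case/int_mulf_eq0 => // e0; exfalso; apply: (p_nonunit dimK sigma_gen); exists (- y4).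
    by rewrite mulrN; apply/eqP; rewrite eq_sym -subr_eq0 opprK e0.
  have : w ^+ p.-1 = 1 by rewrite -tw -ivalX -/z z1 ival1.
  move/eqP; rewrite -(prim_order_dvd prw) => /dvdn_leq.
  by case: p p1 => // -[] // q _ /(_ isT); nia.
have [T [D [sqE cE nE]]] := basis_relation dimK sigma_gen t.
exists T, D, 1%N, u, v; split=> //.
have embOpX n c : embO K (p%:R ^+ n * c) = p%:R ^+ n * embO K c.
  by rewrite embOM embOX embO_p.
have piX l : pi ^+ l = p%:R ^+ l * v ^+ l by rewrite pE -exprMn -mulrA uv mulr1.
move=> l a b; split=> [[y e]|[[a' ->] [b' ->]]].
  have [c [d yE]] := basis_span dimK ind (v ^+ l * y).
  have [-> ->] : a = p%:R ^+ l * c /\ b = p%:R ^+ l * d.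
    apply: (basis_inj ind); rewrite e piX -mulrA yE !embOpX.
    by rewrite mulrDr mulrCA.
  by split; eexists.
exists (u ^+ l * (embO K a' + t * embO K b')).
by rewrite mulrA -exprMn -pE !embOpX mulrDr mulrCA.
Qed.

End Ramification.

(** * Reduction modulo a power of p *)

Section ResidueDivisibility.
Variables (p : nat) (p_pr : prime p) (k : nat).
Local Notation Zp := (padic_int p_pr).

Lemma dvd_residue (m : nat) (a : Zp) : (m <= k.+1)%N ->
  (exists c, a = p%:R ^+ m * c) <-> (p ^ m %| residue k a)%N.
Proof.
case: m => [_|m mk]; first by split=> // _; exists a; rewrite expr0 mul1r.
rewrite -(natr_Zp_eq0 p_pr) -residue_natE_le //.
by split=> [/residue_eq0P|/residue_eq0P].
Qed.

Definition multiples_of (m : nat) : {set 'Z_(p ^ k.+1)} := [set y : 'Z_(p ^ k.+1) | (p ^ m %| y)%N].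

Lemma card_multiples_of m : (m <= k.+1)%N -> #|multiples_of m| = (p ^ (k.+1 - m))%N.
Proof.
move=> mk; have p0 := prime_gt0 p_pr; have pm0 : (0 < p ^ m)%N by rewrite expn_gt0 p0.
have qE : (p ^ k.+1 = p ^ m * p ^ (k.+1 - m))%N by rewrite -expnD subnKC.
pose f (j : 'I_(p ^ (k.+1 - m))) : 'Z_(p ^ k.+1) := (p ^ m * j)%N%:R.
have fE j : f j = (p ^ m * j)%N :> nat.
  by rewrite /f (val_Zp_natr p_pr) modn_small // qE ltn_pmul2l.
have finj : injective f.
  move=> i j /(congr1 (fun z : 'Z_(p ^ k.+1) => z : nat)); rewrite !fE => /eqP.
  by rewrite eqn_pmul2l // => /eqP /val_inj.
rewrite -[RHS]card_ord -cardsT -(card_imset _ finj); apply: eq_card => y.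
rewrite inE; apply/idP/imsetP => [/dvdnP[j yE]|[j _ ->]]; last by rewrite fE dvdn_mulr.
have jlt : (j < p ^ (k.+1 - m))%N.
  by rewrite -(ltn_pmul2l pm0) -qE mulnC -yE; exact: Zp_ltn.
exists (Ordinal jlt); rewrite ?inE //; apply/val_inj; rewrite /= fE /= mulnC yE //.
Qed.

Lemma card_Zp : #|{: 'Z_(p ^ k.+1)}| = (p ^ k.+1)%N.
Proof. by rewrite card_ord (Zp_trunc_expn p_pr). Qed.

Lemma Zp_regular (a s : 'Z_(p ^ k.+1)) : ~~ (p %| a)%N -> a * s = 0 -> s = 0.
Proof.
move=> pa as0; have ua : a \is a GRing.unit.
  rewrite -[a]natr_Zp unitZpE ?(pexp_gt1 p_pr) // coprime_pexpl //.
  by rewrite prime_coprime.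
by apply: (mulrI ua); rewrite mulr0.
Qed.

End ResidueDivisibility.

Lemma sum_odd_rev r : (\sum_(i < r) ((r - i) + (r - i.+1)) = r * r)%N.
Proof.
rewrite (reindex_inj rev_ord_inj) /=.
transitivity (\sum_(i < r) (i.+1 + i))%N.
  by apply: eq_bigr => i _; have := ltn_ord i; move: (nat_of_ord i) => j; lia.
elim: r => [|r IHr]; first by rewrite big_ord0.
by rewrite big_ord_recr /= IHr; lia.
Qed.

Lemma counting_bij (R : realType) (U : choiceType) (V : finType) (B : set U) (E : {set V})
    (f : U -> V) :
  (forall x, B x -> f x \in E) ->
  (forall x y, B x -> B y -> f x = f y -> x = y) ->
  (forall y, y \in E -> exists2 x, B x & f x = y) ->
  counting B = (#|E|%:R : R)%:E.
Proof.
move=> fE finj fsurj.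
have cB : (B #= `I_#|E|)%card.
  apply/card_set_bijP; exists (fun x => index (f x) (enum E)); split.
  - by move=> x Bx /=; rewrite cardE index_mem mem_enum fE.
  - move=> x y; rewrite !inE => Bx By e; apply: finj => //.
    by have := congr1 (nth (f x) (enum E)) e; rewrite !nth_index ?mem_enum ?fE.
  - move=> j /= jE; rewrite cardE in jE.
    have [y0 _] : exists y0, y0 \in E.
      by apply/card_gt0P; rewrite cardE (leq_ltn_trans _ jE).
    have yE : nth y0 (enum E) j \in E by rewrite -mem_enum mem_nth.
    have [x Bx fx] := fsurj _ yE; exists x => //.
    by rewrite fx index_uniq ?enum_uniq.
rewrite /counting asboolT; last by exists #|E|.
by rewrite (card_fset_set cB).
Qed.

Section QuotientModuleTheory.
Local Open Scope quotient_scope.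
Variables (R : pzRingType) (V : lmodType R) (S : submodClosed V).

Definition quotpi (v : V) : quotmod S := \pi_(quotmod S) v.

Lemma quotpi_linear : linear quotpi.
Proof.
move=> a x y; rewrite /quotpi quotmod_piD; congr (_ + _).
by rewrite -[RHS]/(quotmod_scale a _) quotmod_scale_pi.
Qed.

Lemma quotpi_eq u v : quotpi u = quotpi v <-> u - v \in (S : {pred V}).
Proof.
rewrite -[u - v \in _]/(u - v \in submod_zmod S) Quotient.idealrBE.
by split=> [/eqP|/eqP].
Qed.

Lemma quotpiK x : quotpi (repr x) = x. Proof. exact: reprK. Qed.

End QuotientModuleTheory.

Section Reduction.
Variables (p : nat) (p_pr : prime p) (K : fieldExtType (padic_rat p_pr)).
Local Notation Zp := (padic_int p_pr).
Local Notation O := (int_ring K).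
Local Notation emb := (padic_embed K).
Local Notation ival := (@int_ring_val p p_pr K).
Local Notation embO := (embO K).
Hypothesis dimK : \dim {:K} = 2%N.
Variable sigma : 'AEnd(K).
Hypothesis sigma_gen : generates_Gal sigma.
Variable pi : O.
Hypothesis pi_unif : uniformizer pi.
Variables (t : O) (al be : nat -> nat) (T D : Zp) (e : nat) (u v : O).
Hypothesis ib : int_basis sigma pi t al be T D e u v.
Variable k : nat.
Local Notation A := (quad (residue k T) (residue k D)).
Local Notation N := k.+1.

Let ind : independent_mod_p t := ib_indep ib.

(** The default (0, 0) is never taken, by [basis_span]. *)
Definition coords (x : O) : Zp * Zp :=
  if pselect (exists ab : Zp * Zp, x = embO ab.1 + t * embO ab.2) is left h
  then projT1 (cid h) else (0, 0).

Lemma coordsE x : x = embO (coords x).1 + t * embO (coords x).2.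
Proof.
rewrite /coords; case: pselect => [h|[]]; first exact: projT2 (cid h).
by have [a [b ->]] := basis_span dimK ind x; exists (a, b).
Qed.

Lemma coords_eq a b : coords (embO a + t * embO b) = (a, b).
Proof.
have [e1 e2] := basis_inj ind (coordsE (embO a + t * embO b)).
by rewrite [LHS]surjective_pairing -e1 -e2.
Qed.

Definition reduce (x : O) : A := (residue k (coords x).1, residue k (coords x).2).

Lemma reduceE a b : reduce (embO a + t * embO b) = (residue k a, residue k b).
Proof. by rewrite /reduce coords_eq. Qed.

Fact reduce_is_nmod : nmod_morphism reduce.
Proof.
have embOD a b : embO (a + b) = embO a + embO b by exact: rmorphD.
split=> [|x y]; first by have := reduceE 0 0; rewrite !rmorph0 mulr0 addr0.
rewrite {1}(coordsE x) {1}(coordsE y) addrACA -mulrDr -!embOD reduceE !rmorphD.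
by [].
Qed.

Fact reduce_is_monoid : monoid_morphism reduce.
Proof.
have embOD a b : embO (a + b) = embO a + embO b by exact: rmorphD.
split=> [|x y].
  by have := reduceE 1 0; rewrite !rmorph1 !rmorph0 mulr0 addr0.
rewrite {1}(coordsE x) {1}(coordsE y) /reduce; move: (coords x) (coords y) => [a b] [c d] /=.
have -> : (embO a + t * embO b) * (embO c + t * embO d) =
    embO (a * c - b * d * D) + t * embO (a * d + b * c + b * d * T).
  have id1 (R : comNzRingType) (a0 b0 c0 d0 s : R) : (a0 + s * b0) * (c0 + s * d0) =
      a0 * c0 + s * (a0 * d0 + b0 * c0) + s ^+ 2 * (b0 * d0) by ring.
  have id2 (R : comNzRingType) (a0 b0 c0 d0 s T0 D0 : R) :
      a0 * c0 + s * (a0 * d0 + b0 * c0) + (s * T0 - D0) * (b0 * d0) =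
      a0 * c0 - b0 * d0 * D0 + s * (a0 * d0 + b0 * c0 + b0 * d0 * T0) by ring.
  by rewrite id1 (ib_sq ib) embOB !embOD !embOM id2.
rewrite coords_eq /= quad_mulE /=.
by [].
Qed.

HB.instance Definition _ := GRing.isNmodMorphism.Build O A reduce reduce_is_nmod.
HB.instance Definition _ := GRing.isMonoidMorphism.Build O A reduce reduce_is_monoid.

Lemma reduce_surj (a : A) : exists x, reduce x = a.
Proof.
exists (embO (a.1 : nat)%:R + t * embO (a.2 : nat)%:R).
by rewrite reduceE !(residue_natr_surj p_pr); case: a.
Qed.

Lemma reduce_eq0 x : reduce x = 0 <-> exists y, x = p%:R ^+ N * y.
Proof.
split=> [|[y ->]]; last first.
  rewrite rmorphM rmorphXn rmorph_nat -natrX.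
  suff -> : ((p ^ k.+1)%:R : A) = 0 by rewrite mul0r.
  have -> : ((p ^ k.+1)%:R : A) = qconst _ _ (p ^ k.+1)%:R by rewrite rmorph_nat.
  have -> : ((p ^ k.+1)%:R : 'Z_(p ^ k.+1)) = 0 by apply/eqP; rewrite (natr_Zp_eq0 p_pr).
  by rewrite rmorph0.
move: (coordsE x); rewrite /reduce; case: (coords x) => a b /= -> [].
move=> /eqP/residue_eq0P[a' ->] /eqP/residue_eq0P[b' ->].
by exists (embO a' + t * embO b'); rewrite !embOM !embOX !embO_p mulrDr mulrCA.
Qed.

Lemma reduce_conj x y : ival y = sigma (ival x) -> reduce y = qconj (reduce x).
Proof.
move: (coordsE x); rewrite /reduce; case: (coords x) => a b /= -> yE.
have {}yE : y = embO (a + b * T) + t * embO (- b).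
  apply: (@ival_inj _ _ K); rewrite yE !ivalD !ivalM.
  have sD (z z' : K) : sigma (z + z') = sigma z + sigma z' by exact: rmorphD.
  have sM (z z' : K) : sigma (z * z') = sigma z * sigma z' by exact: rmorphM.
  have eD a1 b1 : emb (a1 + b1) = emb a1 + emb b1 by exact: rmorphD.
  have eN b1 : emb (- b1) = - emb b1 by exact: rmorphN.
  have id1 (R : comNzRingType) (a0 b0 T0 t0 : R) :
      a0 + (T0 - t0) * b0 = a0 + b0 * T0 + t0 * - b0 by ring.
  by rewrite sD sM /= !sigma_emb (ib_conj ib) eD eN embM id1.
by rewrite yE coords_eq.
Qed.

Variables (r : nat) (lam : 'I_r -> nat).
Hypothesis lam_dec : forall i j : 'I_r, (i <= j)%N -> (lam j <= lam i)%N.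
Hypothesis lam_ge1 : forall i : 'I_r, (1 <= lam i)%N.
Hypothesis lam_le : forall i, (lam i <= N)%N.
Hypotheses (al_le : forall l, (al l <= l)%N) (be_le : forall l, (be l <= l)%N).

(** As [pi ^ (e * N)] is [p ^ N] up to a unit, multiplication by this power of pi on [O / p ^ N] has
    kernel generated by [pi ^ lam i], and so its image is a copy of [O / pi ^ lam i]. *)
Definition cofactor_pi i : O := pi ^+ (e * N - lam i).
Definition kappa i : A := reduce (cofactor_pi i).

Lemma pi_expN : p%:R ^+ N = pi ^+ (e * N) * u ^+ N.
Proof. by rewrite (ib_p ib) exprMn exprM. Qed.

Lemma kappa_reduce_eq0 i x : kappa i * reduce x = 0 <-> exists y, x = pi ^+ lam i * y.
Proof.
have /andP[e0 _] := ib_e ib.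
have le : (lam i <= e * N)%N by rewrite (leq_trans (lam_le i)) // leq_pmull.
rewrite /kappa -rmorphM reduce_eq0 pi_expN -{1}(subnK le) exprD /cofactor_pi.
split=> -[y yE].
  exists (u ^+ N * y); apply: (int_mulfI (piX_neq0 dimK sigma_gen pi_unif (n := e * N - lam i))).
  have id1 (R : comNzRingType) (a0 b0 c0 d0 : R) :
    a0 * b0 * c0 * d0 = a0 * (b0 * (c0 * d0)) by ring.
  by rewrite yE id1.
exists (v ^+ N * y); rewrite yE.
have uvN : u ^+ N * v ^+ N = 1 by rewrite -exprMn (ib_uv ib) expr1n.
by rewrite -[RHS]mulrA [u ^+ N * _]mulrA uvN mul1r mulrA.
Qed.

Lemma kappa_kerP i (a : A) : kappa i * a = 0 <->
  (a.1 \in multiples_of p k (al (lam i))) && (a.2 \in multiples_of p k (be (lam i))).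
Proof.
have [x <-] := reduce_surj a; rewrite kappa_reduce_eq0.
move: (coordsE x); rewrite /reduce; case: (coords x) => b c /= ->; rewrite (ib_ideal ib).
rewrite !inE -(rwP andP).
by rewrite !(dvd_residue (k := k)) // (leq_trans _ (lam_le i)).
Qed.

Lemma zero_multiples m : 0 \in multiples_of p k m.
Proof. by rewrite inE dvdn0. Qed.

(** Conjugation preserves the powers of the maximal ideal, and [pi ^ lam i] is a multiple of
    [pi ^ lam j] because [lam] is nonincreasing. *)
Lemma kappa_conj (i j : 'I_r) (a : A) : (i <= j)%N ->
  kappa i * a = 0 -> kappa j * qconj a = 0.
Proof.
move=> ij; have [x <-] := reduce_surj a; have [x' x'E] := sigma_int sigma x.
rewrite -(reduce_conj x'E) !kappa_reduce_eq0 => -[y yE].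
have [pi' pi'E] := sigma_int sigma pi; have [y' y'E] := sigma_int sigma y.
have sM (z z' : K) : sigma (z * z') = sigma z * sigma z' by exact: rmorphM.
have sX (z : K) n : sigma (z ^+ n) = sigma z ^+ n by exact: rmorphXn.
(* The conjugate of pi has the same norm as pi, so it is not a unit either. *)
have [z pz] : exists z, pi' = pi * z.
  apply/pi_unif => -[z pz]; apply: (pi_nonunit pi_unif).
  have [n nE] := int_norm dimK sigma_gen pi; have [tr trE] := int_trace dimK sigma_gen pi.
  have sB (a0 b0 : K) : sigma (a0 - b0) = sigma a0 - sigma b0 by exact: rmorphB.
  have pi'C : sigma (ival pi') = ival pi.
    have -> : ival pi' = emb tr - ival pi by rewrite pi'E -trE addrC addKr.
    by rewrite sB sigma_emb -trE addrK.
  apply/(int_unit_norm dimK sigma_gen nE).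
  apply/(int_unit_norm dimK sigma_gen (x := pi')); first by rewrite pi'C pi'E mulrC.
  by exists z.
exists (pi ^+ (lam i - lam j) * z ^+ lam i * y'); apply: (@ival_inj _ _ K).
rewrite x'E yE !ivalM !ivalX y'E sM sX -pi'E pz ivalM exprMn.
rewrite -{1}(subnKC (lam_dec ij)) exprD.
have id1 (R : comNzRingType) (a0 b0 c0 d0 : R) : a0 * b0 * c0 * d0 = a0 * (b0 * c0 * d0) by ring.
exact: id1.
Qed.

Lemma kappa_varpi i (a : A) : kappa i * a = 0 -> exists b, a = reduce pi * b.
Proof.
have [x <-] := reduce_surj a => /kappa_reduce_eq0[y ->].
have := lam_ge1 i; case: (lam i) => // l _.
by exists (reduce (pi ^+ l * y)); rewrite -rmorphM mulrA -exprS.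
Qed.

Lemma varpi_nilpotent : reduce pi ^+ (e * N) = 0.
Proof.
rewrite -rmorphXn; apply/reduce_eq0; exists (v ^+ N).
by rewrite pi_expN -mulrA -exprMn (ib_uv ib) expr1n mulr1.
Qed.

Local Notation G := (kappa_mod kappa).

Lemma card_G : #|G| = (p ^ \sum_i (al (lam i) + be (lam i)))%N.
Proof.
have p0 := prime_gt0 p_pr.
have := card_kappa_mod kappa_kerP.
have le l i : (l i <= lam i)%N -> (l i <= N)%N by move=> h; exact: leq_trans h (lam_le i).
have hI i : #|multiples_of p k (al (lam i))| = (p ^ (N - al (lam i)))%N.
  by rewrite card_multiples_of // (leq_trans (al_le _)).
have hJ i : #|multiples_of p k (be (lam i))| = (p ^ (N - be (lam i)))%N.
  by rewrite card_multiples_of // (leq_trans (be_le _)).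
under eq_bigr do rewrite hI hJ -expnD.
rewrite -expn_sum card_quad card_Zp // -!expnM => h.
apply/eqP; rewrite -(eqn_pmul2r (_ : 0 < p ^ \sum_i (N - al (lam i) + (N - be (lam i))))%N);
  last by rewrite expn_gt0 p0.
rewrite h -expnD -big_split /=; apply/eqP; congr (_ ^ _)%N.
rewrite (eq_bigr (fun=> (N * 2)%N)) => [|i _]; first by rewrite sum_nat_const card_ord; lia.
have := leq_trans (al_le (lam i)) (lam_le i); have := leq_trans (be_le (lam i)) (lam_le i).
lia.
Qed.

(** Index by index, both exponents equal [N ((r - i) + (r - i - 1)) + i al + (i + 1) be]. The level
    N enters only through the power of |S|, so the limit does not depend on it. *)
Lemma moment_limitP :
  (p ^ (\sum_(i < r) (i * al (lam i) + i.+1 * be (lam i))) * #|{: 'Z_(p ^ N)}| ^ (r * r) =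
  (\prod_(i < r) (#|multiples_of p k (al (lam i))| ^ (r - i) *
                  #|multiples_of p k (be (lam i))| ^ (r - i.+1))) * #|G| ^ r)%N.
Proof.
have hI i : #|multiples_of p k (al (lam i))| = (p ^ (N - al (lam i)))%N.
  by rewrite card_multiples_of // (leq_trans (al_le _)).
have hJ i : #|multiples_of p k (be (lam i))| = (p ^ (N - be (lam i)))%N.
  by rewrite card_multiples_of // (leq_trans (be_le _)).
rewrite [X in (_ = X * _)%N](eq_bigr (fun i : 'I_r =>
  p ^ ((N - al (lam i)) * (r - i) + (N - be (lam i)) * (r - i.+1)))%N); last first.
  by move=> i _; rewrite hI hJ -!expnM -expnD.
rewrite -expn_sum card_Zp // card_G -!expnM -!expnD; congr (_ ^ _)%N.
rewrite -sum_odd_rev !big_distrr big_distrl -!big_split /=; apply: eq_bigr => i _.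
have := leq_trans (al_le (lam i)) (lam_le i); have := leq_trans (be_le (lam i)) (lam_le i).
have := ltn_ord i; move: (nat_of_ord i) (al _) (be _) => j a b jr bN aN.
have [r' rE] : exists r', r = (j.+1 + r')%N by exists (r - j.+1)%N; rewrite subnKC.
have [a' aE] : exists a', N = (a + a')%N by exists (N - a)%N; rewrite subnKC.
have [b' bE] : exists b', N = (b + b')%N by exists (N - b)%N; rewrite subnKC.
have -> : (N - a = a')%N by rewrite aE addKn.
have -> : (N - b = b')%N by rewrite bE addKn.
have -> : (r - j = r'.+1)%N by rewrite rE; lia.
have -> : (r - j.+1 = r')%N by rewrite rE addKn.
rewrite mulnDr {1}aE bE rE; ring.
Qed.

Local Notation red := reduce.
Local Notation kap := kappa.
Local Notation P := (prod_cyclic pi lam).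

Definition embed_cyclic (g : P) : 'cV[A]_r := \col_i (kap i * red (repr (g i))).

Lemma kappa_red_repr i (x : O) :
  kap i * red (repr (quotpi (multiples (pi ^+ lam i)) x)) = kap i * red x.
Proof.
apply/eqP; rewrite -subr_eq0 -mulrBr -rmorphB; apply/eqP.
apply/kappa_reduce_eq0.
have /quotpi_eq/asboolP [y yE] :=
  quotpiK (quotpi (multiples (pi ^+ lam i)) x).
by exists y.
Qed.

Lemma embed_cyclicE (f : 'I_r -> O) :
  embed_cyclic (fun i => quotpi (multiples (pi ^+ lam i)) (f i) : cyclic_mod _) =
  \col_i (kap i * red (f i)).
Proof. by apply/matrixP => i j; rewrite !mxE kappa_red_repr. Qed.

Lemma prod_cyclicP (g : P) : exists f : 'I_r -> O,
  g = (fun i => quotpi (multiples (pi ^+ lam i)) (f i) : cyclic_mod _).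
Proof.
exists (fun i => repr (g i)); apply: functional_extensionality_dep => i.
by rewrite quotpiK.
Qed.

Lemma embed_cyclic_linear a (g h : P) :
  embed_cyclic (a *: g + h) = red a *: embed_cyclic g + embed_cyclic h.
Proof.
have [f ->] := prod_cyclicP g; have [f' ->] := prod_cyclicP h.
rewrite !embed_cyclicE.
transitivity (embed_cyclic (fun i =>
    quotpi (multiples (pi ^+ lam i)) (a * f i + f' i) : cyclic_mod _)).
  congr embed_cyclic; apply: functional_extensionality_dep => i.
  by rewrite -[a * f i]/(a *: (f i : O^o)) quotpi_linear.
by rewrite embed_cyclicE; apply/matrixP => i j; rewrite !mxE rmorphD rmorphM mulrDr mulrCA.
Qed.

Lemma embed_cyclic_inj : injective embed_cyclic.
Proof.
move=> g h; have [f ->] := prod_cyclicP g; have [f' ->] := prod_cyclicP h.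
rewrite !embed_cyclicE => eq; apply: functional_extensionality_dep => i.
apply/quotpi_eq/asboolP.
have := congr1 (fun M : 'cV[A]_r => M i 0) eq; rewrite !mxE => /eqP.
rewrite -subr_eq0 -mulrBr -rmorphB => /eqP.
by move=> /kappa_reduce_eq0.
Qed.

Lemma embed_cyclic_in g : embed_cyclic g \in G.
Proof.
apply/kappa_modP; exists (\col_i red (repr (g i))).
by apply/matrixP => i j; rewrite mul_diag_mx !mxE.
Qed.

Lemma embed_cyclic_surj y : y \in G -> exists g, embed_cyclic g = y.
Proof.
move=> /kappa_modP[h ->].
have /choice[f fE] i : exists x, red x = h i 0 := reduce_surj (h i 0).
exists (fun i => quotpi (multiples (pi ^+ lam i)) (f i) : cyclic_mod _).
by rewrite embed_cyclicE; apply/matrixP => i j; rewrite mul_diag_mx !mxE fE ord1.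
Qed.

Variables (n : nat) (X : 'M[O]_n).
Local Notation cokpi := (quotpi (colspan X)).

(** The matrix over A of the composite of [O^n -> cok X -> P] with the embedding of P into
    [A ^ r]. *)
Definition sur_mx (f : cok X -> P) : 'M[A]_(r, n) :=
  \matrix_(i, j) embed_cyclic (f (cokpi (delta_mx j 0))) i 0.

Lemma sur_mxE (f : cok X -> P) (w : 'cV[O]_n) : linear f ->
  embed_cyclic (f (cokpi w)) = sur_mx f *m map_mx red w.
Proof.
move=> flin.
have f0 : f 0 = 0.
  have := flin (-1) 0 0; rewrite scaler0 addr0 scaleN1r addNr //.
have e0 : embed_cyclic 0 = 0.
  by have := embed_cyclic_linear (-1) 0 0; rewrite scaler0 addr0 rmorphN1 scaleN1r addNr.
have q0 : cokpi 0 = 0.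
  by have := quotpi_linear (colspan X) (-1) 0 0; rewrite scaler0 addr0 scaleN1r addNr.
pose F (w : 'cV[O]_n) := embed_cyclic (f (cokpi w)).
have Flin a w1 w2 : F (a *: w1 + w2) = red a *: F w1 + F w2.
  by rewrite /F quotpi_linear flin embed_cyclic_linear.
have F0 : F 0 = 0 by rewrite /F q0 f0 e0.
have Fsum (I : Type) (s : seq I) (c : I -> O) (d : I -> 'cV[O]_n) :
    F (\sum_(i <- s) c i *: d i) = \sum_(i <- s) red (c i) *: F (d i).
  elim: s => [|i s IHs]; first by rewrite !big_nil.
  by rewrite !big_cons Flin IHs.
rewrite -/(F w) {1}[w]matrix_sum_delta.
under eq_bigr do rewrite big_ord1.
rewrite Fsum; apply/matrixP => i j; rewrite summxE !mxE ord1.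
by apply: eq_bigr => l _; rewrite !mxE (ord1 j) mulrC.
Qed.

Lemma cok_surj (m : cok X) : exists w, m = cokpi w.
Proof. by exists (repr m); rewrite quotpiK. Qed.

(** [f] is determined by [sur_mx f], which kills X and has image G. Conversely, a matrix that kills
    X factors through the cokernel, and pulling back along the embedding of P onto G gives f. *)
Lemma counting_Sur (R : realType) :
  counting (Sur (cok X) P) =
  (#|[set F : 'M[A]_(r, n) | spans kap F & F *m map_mx red X == 0]|%:R : R)%:E.
Proof.
have mx_surj (y : 'cV[A]_n) : exists w : 'cV[O]_n, y = map_mx red w.
  have /choice[g gE] j : exists x, red x = y j 0 := reduce_surj (y j 0).
  by exists (\col_j g j); apply/matrixP => i j; rewrite !mxE gE ord1.
apply: (@counting_bij _ _ _ _ _ sur_mx).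
- move=> f [flin fsurj]; rewrite inE; apply/andP; split.
    apply/eqP/setP => y; apply/imsetP/idP => [[w _ ->]|yG].
      by have [w' ->] := mx_surj w; rewrite -sur_mxE //; exact: embed_cyclic_in.
    have [g gE] := embed_cyclic_surj yG.
    have [m _ mE] := fsurj g I; have [w wE] := cok_surj m.
    by exists (map_mx red w); rewrite // -sur_mxE // -wE mE gE.
  apply/eqP/matrixP => i j.
  have : sur_mx f *m map_mx red (col j X) = 0.
    rewrite -sur_mxE //.
    have -> : cokpi (col j X) = 0 *: cokpi 0 + cokpi 0.
      rewrite -quotpi_linear scale0r add0r; apply/quotpi_eq/asboolP.
      by exists (delta_mx j 0); rewrite subr0 colE.
    rewrite flin embed_cyclic_linear rmorph0 scale0r add0r sur_mxE //.
    by rewrite map_mx0 mulmx0.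
  move=> /(congr1 (fun M : 'cV[A]_r => M i 0)).
  by rewrite map_col colE mulmxA -colE [LHS]mxE => ->; rewrite !mxE.
- move=> f g [flin _] [glin _] fg; apply/funext => m.
  apply: embed_cyclic_inj; have [w ->] := cok_surj m.
  by rewrite !sur_mxE // fg.
- move=> F; rewrite inE => /andP[/eqP sF /eqP FX].
  have /choice[f fE] (m : cok X) : exists g, embed_cyclic g = F *m map_mx red (repr m).
    by apply: embed_cyclic_surj; rewrite -sF; apply: imset_f.
  have fE' (w : 'cV[O]_n) : embed_cyclic (f (cokpi w)) = F *m map_mx red w.
    rewrite fE; apply/eqP; rewrite -subr_eq0 -mulmxBr -map_mxB.
    have /quotpi_eq/asboolP[c ->] := quotpiK (cokpi w).
    by rewrite map_mxM mulmxA FX mul0mx.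
  exists f; first split.
  + move=> a m m'; apply: embed_cyclic_inj; rewrite embed_cyclic_linear.
    have [w ->] := cok_surj m; have [w' ->] := cok_surj m'.
    by rewrite -quotpi_linear !fE' map_mxD map_mxZ mulmxDr scalemxAr.
  + move=> g _; have := embed_cyclic_in g; rewrite -sF => /imsetP[y _ gE].
    have [w wE] := mx_surj y; exists (cokpi w) => //.
    by apply: embed_cyclic_inj; rewrite fE' gE wE.
  + apply/matrixP => i j; rewrite mxE fE'.
    rewrite map_delta_mx -colE mxE //.
Qed.

End Reduction.

(** * Laws of residues *)

Local Open Scope classical_set_scope.
Local Open Scope ring_scope.

Section FiniteValued.
Variables (R : realType) (d : measure_display) (T : measurableType d) (P : probability T R).
Variables (V : finType) (h : T -> V).
Hypothesis mh : forall z, measurable [set w | h w = z].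

Definition law (z : V) : R := fine (P [set w | h w = z]).

Lemma lawE z : P [set w | h w = z] = (law z)%:E.
Proof. by rewrite /law fineK // fin_num_measure. Qed.

Lemma law_ge0 z : 0 <= law z.
Proof. by rewrite /law fine_ge0. Qed.

Lemma integral_finite_valued (g : V -> R) : (forall z, 0 <= g z) ->
  (\int[P]_w (g (h w))%:E = (\sum_z g z * law z)%:E)%E.
Proof.
move=> g0.
transitivity (\int[P]_w (\sum_(z <- index_enum V) (g z * \1_[set w | h w = z] w)%:E))%E.
  apply: eq_integral => w _; rewrite sumEFin; congr (_%:E).
  rewrite (bigD1 (h w)) //= indicE mem_set // mulr1 big1 ?addr0 // => z zh.
  rewrite indicE memNset ?mulr0 //= => e; by rewrite e eqxx in zh.
have mi z : measurable_fun setT ((fun w => (\1_[set w | h w = z] w)%:E) : T -> \bar R).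
  by apply/measurable_EFinP; exact: measurable_indic.
rewrite ge0_integral_sum //; last first.
- by move=> z w _; rewrite lee_fin mulr_ge0.
- move=> z; under eq_fun do rewrite EFinM.
  by apply: measurable_funeM.
rewrite -sumEFin; apply: eq_bigr => z _.
under eq_integral do rewrite EFinM.
rewrite ge0_integralZl_EFin //.
by rewrite integral_indic // setIT EFinM -lawE.
Qed.

Lemma law_sum (Q : pred V) : P [set w | Q (h w)] = (\sum_(z | Q z) law z)%:E.
Proof.
have := @integral_finite_valued (fun z => (Q z)%:R) (fun z => ler0n _ _).
have -> : \sum_z (Q z)%:R * law z = \sum_(z | Q z) law z.
  rewrite [RHS]big_mkcond; apply: eq_bigr => z _.
  by case: (Q z); rewrite ?mul1r ?mul0r.
move=> <-.
have mQ : measurable [set w | Q (h w)].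
  have -> : [set w | Q (h w)] = \big[setU/set0]_(z <- enum Q) [set w | h w = z].
    apply/seteqP; split=> [w Qw|w].
      by rewrite -bigcup_seq; exists (h w) => //=; rewrite mem_enum.
    by rewrite -bigcup_seq => -[z /=]; rewrite mem_enum => Qz ->.
  by apply: bigsetU_measurable => z _; exact: mh.
rewrite -(setIT [set w | Q (h w)]) -integral_indic //; apply: eq_integral => w _.
rewrite indicE; case: (boolP (Q (h w))) => q; first by rewrite mem_set.
by rewrite memNset //; exact/negP.
Qed.

Lemma law_sum1 : \sum_z law z = 1.
Proof.
have := law_sum predT; have -> : [set w | predT (h w)] = setT by apply/seteqP.
by rewrite probability_setT => -[].
Qed.

End FiniteValued.

Section PadicLaw.
Variables (R : realType) (p : nat) (p_pr : prime p).
Variables (d : measure_display) (T : measurableType d) (P : probability T R).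
Local Notation Zp := (padic_int p_pr).
Variable k : nat.

Lemma eqmod_residue_eq (a b : Zp) : padic_eqmod k.+1 a b <-> residue k a = residue k b.
Proof.
split=> [ab|ab].
  have /residue_eq0P : exists z, a - b = p%:R ^+ k.+1 * z by [].
  by rewrite rmorphB subr_eq0 => /eqP.
by apply/residue_eq0P; rewrite rmorphB /= ab subrr.
Qed.

Lemma measurable_residue_set (z : 'Z_(p ^ k.+1)) :
  measurable ([set a | residue k a = z] : set (padic_borel p_pr)).
Proof.
apply: sub_sigma_algebra => a az; exists k.+1 => b /eqmod_residue_eq e.
by rewrite /= -e.
Qed.

Variables (I : finType) (x : I -> T -> Zp).
Hypothesis mx : forall i, measurable_fun setT (x i : T -> padic_borel p_pr).

Lemma measurable_residue_preimage i z : measurable [set w | residue k (x i w) = z].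
Proof.
have := mx i measurableT (measurable_residue_set z); rewrite setTI; exact.
Qed.

Definition residue_vec (w : T) : {ffun I -> 'Z_(p ^ k.+1)} := [ffun i => residue k (x i w)].

Lemma residue_vec_preimage (y : {ffun I -> 'Z_(p ^ k.+1)}) :
  [set w | residue_vec w = y] = \bigcap_(i in [set` [set: I]%SET])
    (x i @^-1` [set a | residue k a = y i]).
Proof.
apply/seteqP; split=> w /=; first by move=> <- i _ /=; rewrite ffunE.
by move=> h; apply/ffunP => i; rewrite ffunE; apply: h; rewrite /= inE.
Qed.

Lemma measurable_residue_vec y : measurable [set w | residue_vec w = y].
Proof.
rewrite residue_vec_preimage; apply: fin_bigcap_measurable; first exact: finite_finset.
by move=> i _; exact: measurable_residue_preimage.
Qed.

Hypothesis ind : independent_padic P x.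

Lemma law_residue_vec y :
  law P residue_vec y = \prod_i law P (fun w => residue k (x i w)) (y i).
Proof.
apply: EFin_inj; rewrite -lawE; last exact: measurable_residue_vec.
rewrite residue_vec_preimage ind; last by move=> i; exact: measurable_residue_set.
rewrite -prodEFin; apply: eq_big => [i|i _]; first by rewrite inE.
by rewrite -lawE //; exact: measurable_residue_preimage.
Qed.

(** The double negation comes from taking the residues not divisible by p as [regular]; the sum is
    the probability that x is congruent to y modulo p. *)
Lemma balanced_law (eps : R) i (y : 'Z_(p ^ k.+1)) : balanced P eps (x i) ->
  \sum_(z | ~~ ~~ (p %| (y - z)%R)%N) law P (fun w => residue k (x i w)) z <= 1 - eps.
Proof.
move=> bal; rewrite -lee_fin -law_sum; last exact: measurable_residue_preimage.
apply: le_trans (bal (y : nat)); rewrite le_eqVlt; apply/orP; left; apply/eqP.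
congr (P _); apply/seteqP.
have e (w : T) : (p %| (y - residue k (x i w))%R)%N <-> padic_eqmod 1 (x i w) (y : nat)%:R.
  have -> : y - residue k (x i w) = residue k ((y : nat)%:R - x i w).
    by rewrite rmorphB /= (residue_natr_surj p_pr).
  rewrite -[X in (X %| _)%N]expn1 -dvd_residue //; split=> -[c cE]; exists (- c).
    by rewrite mulrN -cE opprB.
  by rewrite mulrN -cE opprB.
by split=> w /=; rewrite negbK => /e.
Qed.

End PadicLaw.

(** * Convergence of the moments *)

Lemma exponential_convergence (R : realType) (E : nat -> \bar R) (f : nat -> R) (L K rho : R) :
  (forall n, (0 < n)%N -> E n = (f n)%:E) -> 0 < K -> 0 < rho -> rho < 1 ->
  (forall n, (0 < n)%N -> `|f n - L| <= K * rho ^+ n) ->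
  E n @[n --> \oo] --> L%:E /\
  exists c K0 : R, [/\ 0 < c, 0 < K0 & forall n : nat, (0 < n)%N ->
    (`| E n - L%:E | <= (K0 * expR (- c * n%:R))%:E)%E].
Proof.
move=> EE K0 r0 r1 h; split.
  apply/fine_cvgP; split; first by exists 1%N => // n /= n0; rewrite EE.
  apply/cvgrPdist_le => e e0.
  have rho1 : `|rho| < 1 by rewrite ger0_norm // ltW.
  have /cvgr0_norm_le /(_ _ e0) := cvg_geometric K rho1.
  move=> [N _ hN]; exists N.+1 => // n /= Nn; have n0 : (0 < n)%N by exact: leq_trans Nn.
  rewrite EE //= distrC (le_trans (h n n0)) // (le_trans (ler_norm _)) //.
  by apply: hN => /=; exact: ltnW.
exists (- ln rho), K; split=> // [|n n0]; first by rewrite oppr_gt0 ln_lt0 // r0.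
by rewrite EE // -EFinB abse_EFin lee_fin opprK expRM_natr lnK // h.
Qed.

Section Moments.
Variables (p : nat) (p_pr : prime p) (K : fieldExtType (padic_rat p_pr)).
Local Notation Zp := (padic_int p_pr).
Local Notation O := (int_ring K).
Local Notation emb := (padic_embed K).
Local Notation ival := (@int_ring_val p p_pr K).
Local Notation embO := (embO K).
Hypothesis dimK : \dim {:K} = 2%N.
Variable sigma : 'AEnd(K).
Hypothesis sigma_gen : generates_Gal sigma.
Variable pi : O.
Hypothesis pi_unif : uniformizer pi.
Variables (t : O) (al be : nat -> nat) (T D : Zp) (e : nat) (u v : O).
Hypothesis ib : int_basis sigma pi t al be T D e u v.
Variable k : nat.
Local Notation q := (p ^ k.+1)%N.
Local Notation Tk := (residue k T).
Local Notation Dk := (residue k D).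
Local Notation A := (quad Tk Dk).
Local Notation red := (reduce t T D k).

Lemma reduce_Herm n (X : 'M[O]_n) (Y Z : 'M[Zp]_n) :
  (forall i j, ival (X i j) = emb (Y i j) + ival t * emb (Z i j)) -> Herm sigma X ->
  map_mx red X =
    herm_mx Tk Dk [ffun ij : 'I_n * 'I_n =>
      residue k (if (ij.1 <= ij.2)%N then Y ij.1 ij.2 else Z ij.2 ij.1)].
Proof.
move=> XE HX.
have XE' i j : X i j = embO (Y i j) + t * embO (Z i j).
  by apply: (@ival_inj _ _ K); rewrite ivalD ivalM XE.
have redX i j : red (X i j) = (residue k (Y i j), residue k (Z i j)).
  by rewrite XE' (reduceE dimK ib).
apply/matrixP => i j; rewrite !mxE !ffunE /=; case: (ltngtP i j) => ij.
- by rewrite quad_pairE redX.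
- rewrite (reduce_conj dimK ib k (HX i j)) redX -quad_pairE rmorphD rmorphM /=.
  by rewrite !qconj_const.
- have {ij} <- : i = j by exact: val_inj.
  rewrite leqnn redX.
  (* [X i i] is fixed by sigma; comparing coordinates gives [Z i i = - Z i i], so the hermitian
     condition itself forces [Z i i = 0]. *)
  have : embO (Y i i) + t * embO (Z i i) = embO (Y i i + Z i i * T) + t * embO (- Z i i).
    apply: (@ival_inj _ _ K); rewrite -XE' [LHS](HX i i) XE'.
    rewrite !ivalD !ivalM.
    have sD (z z' : K) : sigma (z + z') = sigma z + sigma z' by exact: rmorphD.
    have sM (z z' : K) : sigma (z * z') = sigma z * sigma z' by exact: rmorphM.
    have eD a1 b1 : emb (a1 + b1) = emb a1 + emb b1 by exact: rmorphD.
    have eN b1 : emb (- b1) = - emb b1 by exact: rmorphN.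
    have id1 (R : comNzRingType) (a0 b0 T0 t0 : R) :
        a0 + (T0 - t0) * b0 = a0 + b0 * T0 + t0 * - b0 by ring.
    by rewrite sD sM /= !sigma_emb (ib_conj ib) eD eN embM id1.
  by move=> /(basis_inj (ib_indep ib))[_ /padic_eq_opp ->]; rewrite rmorph0.
Qed.

Variables (r : nat) (lam : 'I_r -> nat).
Hypothesis lam_dec : forall i j : 'I_r, (i <= j)%N -> (lam j <= lam i)%N.
Hypothesis lam_ge1 : forall i : 'I_r, (1 <= lam i)%N.
Hypothesis lam_le : forall i, (lam i <= k.+1)%N.
Hypotheses (al_le : forall l, (al l <= l)%N) (be_le : forall l, (be l <= l)%N).
Local Notation kap := (kappa pi t T D e k lam).

Lemma expected_surE (R : realType) (d : measure_display) (Om : measurableType d)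
    (P : probability Om R) n (X : Om -> 'M[O]_n) (Y Z : Om -> 'M[Zp]_n) :
  (forall w i j, ival (X w i j) = emb (Y w i j) + ival t * emb (Z w i j)) ->
  (forall w, Herm sigma (X w)) ->
  (forall ij, measurable_fun setT (herm_coord Y Z ij : Om -> padic_borel p_pr)) ->
  independent_padic P (herm_coord Y Z) ->
  expected_sur P X (prod_cyclic pi lam) =
  (\sum_(F | spans kap (n := n) F)
     \sum_(x : {ffun 'I_n * 'I_n -> 'Z_q} | F *m herm_mx Tk Dk x == 0)
       \prod_ij law P (fun w => residue k (herm_coord Y Z ij w)) (x ij))%:E.
Proof.
move=> XE HX mYZ iYZ.
pose g (x : {ffun 'I_n * 'I_n -> 'Z_q}) : R :=
  #|[set F : 'M[A]_(r, n) | spans kap F & F *m herm_mx Tk Dk x == 0]|%:R.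
transitivity (\int[P]_w (g (residue_vec k (herm_coord Y Z) w))%:E)%E.
  apply: eq_integral => w _.
  rewrite (counting_Sur dimK sigma_gen pi_unif ib lam_le); congr (_%:R%:E).
  by rewrite (reduce_Herm (XE w) (HX w)).
rewrite integral_finite_valued; last first.
- by move=> x; exact: ler0n.
- by move=> x; exact: measurable_residue_vec.
congr (_%:E).
rewrite [RHS](exchange_big_dep predT) //=; apply: eq_bigr => x _.
rewrite law_residue_vec // /g -sum1_card natr_sum mulr_suml.
by apply: eq_big => [F|F _]; rewrite ?inE ?mul1r.
Qed.

Lemma moment_decay (R : realType) (eps : R) : 0 < eps -> eps <= 1 ->
  exists C rho : R, [/\ 0 < C, 0 < rho, rho < 1 &
  forall (d : measure_display) (Om : measurableType d) (P : probability Om R)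
    n (X : Om -> 'M[O]_n), (forall w, Herm sigma (X w)) ->
    balanced_matrix P eps (ival t) X ->
    exists2 m : R, expected_sur P X (prod_cyclic pi lam) = m%:E &
      `|m - (p ^ \sum_(i < r) (i * al (lam i) + i.+1 * be (lam i)))%:R| <= C * rho ^+ n].
Proof.
move=> e0 e1; have [psi] := Zp_char R[i] q.
have [C [rho [C0 r0 r1 h]]] := finite_level_moment
  (kappa_kerP dimK sigma_gen pi_unif ib lam_le al_le be_le) (fun=> zero_multiples _ _ _)
  (kappa_conj dimK sigma_gen pi_unif ib lam_dec lam_le)
  (varpi_nilpotent dimK ib k)
  (kappa_varpi dimK sigma_gen pi_unif ib lam_ge1 lam_le)
  psi (@Zp_regular p p_pr k) e0 e1
  (moment_limitP dimK sigma_gen pi_unif ib lam_le al_le be_le).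
exists C, rho; split=> // d Om P n X HX [Y [Z [XE mYZ iYZ bYZ]]].
eexists; first exact: expected_surE XE HX mYZ iYZ.
apply: (h n (fun ij => law P (fun w => residue k (herm_coord Y Z ij w)))) => [ij y|ij|ij y].
- exact: law_ge0.
- exact: (law_sum1 P (fun z => measurable_residue_preimage mYZ ij z)).
- exact: balanced_law.
Qed.

End Moments.

Theorem theorem1p7 (R : realType) (p : nat) (p_pr : prime p)
    (K : fieldExtType (padic_rat p_pr)) (dimK : \dim {:K} = 2%N)
    (sigma : 'AEnd(K)) (sigma_gen : generates_Gal sigma)
    (pi : int_ring K) (pi_unif : uniformizer pi)
    (eps : R) (eps_gt0 : 0 < eps) (eps_lt1 : eps < 1)
    (d : nat -> measure_display) (T : forall n, measurableType (d n))
    (P : forall n, probability (T n) R)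
    (X : forall n, T n -> 'M[int_ring K]_n)
    (X_herm : forall n, (0 < n)%N -> forall w : T n, Herm sigma (X n w))
    (r : nat) (lam : 'I_r -> nat)
    (lam_dec : forall i j : 'I_r, (i <= j)%N -> (lam j <= lam i)%N)
    (lam_ge1 : forall i : 'I_r, (1 <= lam i)%N) :
  let E := fun n => expected_sur (P n) (X n) (prod_cyclic pi lam) in
  let converges_exponentially := fun L : nat =>
    E n @[n --> \oo] --> (L%:R : R)%:E /\
    exists c K0 : R, [/\ 0 < c, 0 < K0 &
      forall n : nat, (0 < n)%N ->
        (`| E n - (L%:R : R)%:E | <= (K0 * expR (- c * n%:R))%:E)%E] in
  (unramified K ->
     forall w : K, (p ^ 2 - 1).-primitive_root w ->
     (forall n, (0 < n)%N -> balanced_matrix (P n) eps w (X n)) ->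
     converges_exponentially
       (p ^ \sum_(i < r) (2 * i.+1 - 1) * lam i)%N)
  /\
  (~ unramified K ->
     (forall n, (0 < n)%N ->
        balanced_matrix (P n) eps (int_ring_val pi) (X n)) ->
     converges_exponentially
       (p ^ \sum_(i < r) ((i.+1 - 1) * lam i + lam i %/ 2))%N).
Proof.
move=> E converges_exponentially.
have main t al be : (exists T D e u v, int_basis sigma pi t al be T D e u v) ->
    (forall l, (al l <= l)%N) -> (forall l, (be l <= l)%N) ->
    (forall n, (0 < n)%N -> balanced_matrix (P n) eps (int_ring_val t) (X n)) ->
    converges_exponentially (p ^ \sum_(i < r) (i * al (lam i) + i.+1 * be (lam i)))%N.
  move=> [T' [D [e [u [v ib]]]]] al_le be_le bal.
  (* The level is [N = k.+1] with k the sum of the [lam j]; any common bound of the [lam i] would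
     serve. *)
  have lam_le i : (lam i <= (\sum_j lam j).+1)%N.
    by apply: leqW; rewrite (bigD1 i) //= leq_addr.
  have [C [rho [C0 r0 r1 h]]] := moment_decay dimK sigma_gen pi_unif ib lam_dec lam_ge1
    lam_le al_le be_le eps_gt0 (ltW eps_lt1).
  have Em n : (0 < n)%N -> exists2 m : R, E n = m%:E & `|m - _| <= C * rho ^+ n :=
    fun n0 => h _ _ _ n (X n) (X_herm n n0) (bal n n0).
  have EE n : (0 < n)%N -> E n = (fine (E n))%:E by move=> /Em[m ->].
  apply: (exponential_convergence EE C0 r0 r1) => n /Em[m -> //].
split=> [unr w prw bal|ram bal].
- have [t [tw ib]] := int_basis_unramified dimK sigma_gen pi_unif unr prw.
  have -> : (\sum_(i < r) (2 * i.+1 - 1) * lam i =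
      \sum_(i < r) (i * lam i + i.+1 * lam i))%N.
    by apply: eq_bigr => i _; rewrite -mulnDl; congr (_ * _)%N; lia.
  by apply: (main t id id) => //; rewrite tw.
- have ib := int_basis_ramified dimK sigma_gen pi_unif ram.
  (* As [uphalf l + half l = l], the exponent [i * uphalf l + i.+1 * half l] is [i * l + half l]. *)
  have -> : (\sum_(i < r) ((i.+1 - 1) * lam i + lam i %/ 2) =
      \sum_(i < r) (i * uphalf (lam i) + i.+1 * half (lam i)))%N.
    apply: eq_bigr => i _; rewrite subn1 /= divn2 mulSnr addnA -mulnDr; congr (_ * _ + _)%N.
    by rewrite uphalf_half -addnA addnn odd_double_half.
  by apply: (main pi uphalf half) => // l; [rewrite leq_uphalf_double|rewrite leq_half_double]; lia.
Qed.
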